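(* The GMLS instance $DIV^{GMLS}$ of the meshfree mimetic divergence operator with a background mesh has the following properties. (Local conservation) For every set $C_\omega$ of dual cell indices and every $\bm{u}^h\in U^h_\gamma$, $$\sum_{i\in C_\omega}\mu_i(DIV^{GMLS}\bm{u}^h)_i=\sum_{\substack{i\in C_\omega,\ j\in V_i\\ j\notin C_\omega}}\bm{c}_{ij}(\bm{u}^h)\cdot\bm{\mu}_{ij}+\sum_{\substack{k\in C_\omega\\ \Gamma_k\subseteq\gamma'}}\bm{c}_{\Gamma_k}(\bm{u}^h)\cdot\bm{\mu}_{\Gamma_k}+\sum_{\substack{k\in C_\omega\\ \Gamma_k\subseteq\gamma}}\int_{\Gamma_k}\bm{u}\cdot\bm{n}_k\,dS .$$ (Global conservation) If $\gamma=\Gamma$, then $\sum_{i}\mu_i(DIV^{GMLS}\bm{u}^h)_i=\int_\Gamma\bm{u}\cdot\bm{n}\,dS$. (First-order accuracy) There is a constant $C$, independent of the point cloud (that is, depending only on $d$, $\Omega$ and the uniformity constants listed in the context), such that for every $\bm{u}\in(C^2(\Omega))^d$ with point sample $\bm{u}^h\in U^h_\gamma$, $$\max_{\bm{x}_i\in X}\big|\nabla\cdot\bm{u}(\bm{x}_i)-(DIV^{GMLS}\bm{u}^h)_i\big|\le C\,h_X\,\|\bm{u}\|_{C^2(\Omega)} .$$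
   Context: $\Omega\subset\mathbb{R}^d$, $d=2,3$, is a bounded connected region with Lipschitz boundary $\Gamma$ and outward unit normal $\bm{n}$. $\Gamma$ is partitioned into finitely many faces (boundary segments) $\Gamma_j$, disjoint up to sets of zero surface measure, with centroids $\bm{x}_j$ and constant outward unit normals $\bm{n}_j$. $X_\Gamma$ is the set of these centroids, $X_0$ a finite set of interior points, $X=X_0\cup X_\Gamma$ the point cloud. Fill distance: $h_X=\sup_{\bm{x}\in\Omega}\min_{\bm{x}_i\in X}|\bm{x}-\bm{x}_i|$; separation distance $q_X=\frac12\min_{i\neq j}|\bm{x}_i-\bm{x}_j|$; $X$ is quasi-uniform: $q_X\le h_X\le c_{qu}q_X$. $\Gamma$ is split into $\gamma$ and $\gamma'=\Gamma\setminus\gamma$, each an exact union of segments $\Gamma_j$. $U^h_\gamma$ is the space of discrete vector fields $\bm{u}^h=\{\bm{u}_k\in\mathbb{R}^d:\bm{x}_k\in X_0\cup X_{\gamma'}\}$, $X_{\gamma'}=X\cap\gamma'$; the point sample of $\bm{u}$ is $\bm{u}_k=\bm{u}(\bm{x}_k)$; on $\gamma$ the values of $\bm{u}$ are prescribed. Functions in $C^2(\Omega)$ are understood with finite norm, so that they and their first derivatives extend continuously to $\overline\Omega$. Background mesh: $\Omega$ carries a conforming physical primal-dual mesh. The primal vertices are the points of $X$; $E$ is the set of primal edges $\bm{e}_{ij}=(\bm{x}_i,\bm{x}_j)$ and $V_i$ is the set of indices of vertices joined to $\bm{x}_i$ by an edge. The dual cells $\omega_i$ (one per $\bm{x}_i$,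 volume $\mu_i>0$) partition $\Omega$; $\mu_i$ is comparable to $h_X^d$. The dual faces $\bm{f}_{ij}=\partial\omega_i\cap\partial\omega_j$ (one per edge) are affine, with centroid $\bm{x}_{\bm{f}_{ij}}$ and unit normal $\bm{n}_{ij}=-\bm{n}_{ji}$ pointing out of $\omega_i$ into $\omega_j$. $\partial\omega_i$ is the union of the $\bm{f}_{ij}$, $j\in V_i$, and of $\Gamma_i=\partial\omega_i\cap\Gamma$ if $\bm{x}_i\in X_\Gamma$. GMLS: $n_1=d(d+1)$; $\{\bm{\phi}_s\}_{s=1}^{n_1}$ is the basis of $(P_1)^d$ (vector fields with components polynomials of degree $\le1$) given by $\bm{\phi}_s=\mathbf{e}_k\phi_r$, $s=(k-1)(d+1)+r$, where $\{\phi_r\}_{r=1}^{d+1}$ is a basis of $P_1(\mathbb{R}^d)$. Let $\kappa(\rho)=(1-\rho/\epsilon_\kappa)_+^4$, with $\epsilon_\kappa$ large enough for $P_1$-unisolvency: for every face $\bm{f}\in\{\bm{f}_{ij}\}\cup\{\Gamma_j:\bm{x}_j\in\gamma'\}$, with centroid $\bm{x}_{\bm{f}}$, the only $p\in P_1$ vanishing at all $\bm{x}_k\in X_0\cup X_{\gamma'}$ with $|\bm{x}_k-\bm{x}_{\bm{f}}|<\epsilon_\kappa$ is $0$. For such $\bm{f}$ and $\bm{u}^h\in U^h_\gamma$, $\bm{c}_{\bm{f}}(\bm{u}^h)\in\mathbb{R}^{n_1}$ is the minimizer over $\bm{b}\in\mathbb{R}^{n_1}$ of $$\frac12\sum_{\bm{x}_k\in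 X_0\cup X_{\gamma'}}\kappa(|\bm{x}_{\bm{f}}-\bm{x}_k|)\,\Big|\sum_{s}b_s\bm{\phi}_s(\bm{x}_k)-\bm{u}_k\Big|^2 .$$ The face moments are $(\bm{\mu}_{ij})_s=\int_{\bm{f}_{ij}}\bm{\phi}_s\cdot\bm{n}_{ij}\,dS$ and $(\bm{\mu}_{\Gamma_j})_s=\int_{\Gamma_j}\bm{\phi}_s\cdot\bm{n}_j\,dS$. Write $\bm{c}_{ij}=\bm{c}_{\bm{f}_{ij}}$. Then $$(DIV^{GMLS}\bm{u}^h)_i=\frac1{\mu_i}\Big[\sum_{j\in V_i}\bm{c}_{ij}(\bm{u}^h)\cdot\bm{\mu}_{ij}+\bm{c}_{\chi_i(\gamma')}(\bm{u}^h)\cdot\bm{\mu}_{\chi_i(\gamma')}+\int_{\chi_i(\gamma)}\bm{u}\cdot\bm{n}\,dS\Big],$$ where $\chi_i(\gamma')=\Gamma_i$ if $\bm{x}_i\in\gamma'$ and $\emptyset$ otherwise, and similarly for $\chi_i(\gamma)$; terms indexed by $\emptyset$ are zero. Uniformity constants: $c_{qu}$; the lower and upper bounds of $\mu_i/h_X^d$; $\epsilon_\kappa/h_X$; the maximal number of dual faces per cell; the maxima of $|\bm{f}_{ij}|/h_X^{d-1}$, $|\Gamma_i|/h_X^{d-1}$, $|\bm{x}_i-\bm{x}_{\bm{f}_{ij}}|/h_X$ and $\sup_{\bm{y}\in\Gamma_i}|\bm{y}-\bm{x}_i|/h_X$ (where $|\cdot|$ of a face is its surface measure); and the moving-least-squares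 stability constant, i.e. the smallest $S$ with $\big|\sum_s(\bm{c}_{\bm{f}}(\bm{u}^h))_s\bm{\phi}_s(\bm{x}_{\bm{f}})\big|\le S\max_{|\bm{x}_k-\bm{x}_{\bm{f}}|<\epsilon_\kappa}|\bm{u}_k|$ for all faces $\bm{f}$ and all $\bm{u}^h\in U^h_\gamma$. *)

(* Defs.v *)
From HB Require Import structures.
From mathcomp Require Import all_boot all_order all_algebra.
From mathcomp Require Import all_classical all_reals all_analysis.
From mathcomp Require Import measurable_realfun.

Set Implicit Arguments.
Unset Strict Implicit.
Unset Printing Implicit Defensive.

Import Order.TTheory GRing.Theory Num.Theory.
Import numFieldNormedType.Exports.

Local Open Scope classical_set_scope.
Local Open Scope ring_scope.

Fact rV_display : measure_display.
Proof. exact: default_measure_display. Qed.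

Section measurable_rV.
Context (R : realType) (n : nat).

Let coord : 'I_n -> 'rV[R]_n -> measurableTypeR R := fun i v => v 0 i.

Let rV_set0 : g_sigma_preimage coord set0.
Proof. exact: sigma_algebra0. Qed.

Let rV_setC A : g_sigma_preimage coord A -> g_sigma_preimage coord (~` A).
Proof. exact: sigma_algebraC. Qed.

Let rV_bigcup (F : _^nat) : (forall i, g_sigma_preimage coord (F i)) ->
  g_sigma_preimage coord (\bigcup_i (F i)).
Proof. exact: sigma_algebra_bigcup. Qed.

(* The sigma-algebra generated by the coordinates, i.e. the Borel one. *)
HB.instance Definition _ := @isMeasurable.Build rV_display
  'rV[R]_n (g_sigma_preimage coord) rV_set0 rV_setC rV_bigcup.

Lemma measurable_coord (i : 'I_n) :
  measurable_fun [set: 'rV[R]_n] (fun v : 'rV[R]_n => v 0 i : measurableTypeR R).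
Proof.
move=> _ Y mY; rewrite setTI; apply: sub_sigma_algebra => /=.
rewrite -bigcup_seq/=; exists i => /=; first by rewrite mem_index_enum.
by exists Y => //; rewrite setTI.
Qed.

Lemma measurable_fun_rV d (T : measurableType d) (f : T -> 'rV[R]_n) :
  (forall i, measurable_fun [set: T] (fun x => f x 0 i : measurableTypeR R)) ->
  measurable_fun [set: T] f.
Proof.
move=> mf; have prefS : g_sigma_preimage (fun i => @coord i \o f) `<=` measurable.
  apply: smallest_sub; first exact: sigma_algebra_measurable.
  rewrite -bigcup_seq; apply: bigcup_sub => i _ A [B mB <-].
  exact: mf.
move=> _ A mA; rewrite setTI; apply: prefS.
by rewrite g_sigma_preimage_comp; exists A => //; rewrite setTI.
Qed.

End measurable_rV.

Section lebesgue_rV.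
Context (R : realType).

Definition consrV n (p : measurableTypeR R * 'rV[R]_n) : 'rV[R]_(n.+1) :=
  \row_i (if unlift ord0 i is Some j then p.2 0 j else p.1).

Lemma measurable_consrV n : measurable_fun setT (@consrV n).
Proof.
apply: measurable_fun_rV => i; rewrite /consrV.
case: (unliftP ord0 i) => [j|] ->; under eq_fun do rewrite mxE ?liftK ?unlift_none.
- exact: (measurableT_comp (measurable_coord _) measurable_snd).
- exact: measurable_fst.
Qed.

HB.instance Definition _ n :=
  isMeasurableFun.Build _ _ _ _ (@consrV n) (@measurable_consrV n).

Section step.
Context (n : nat) (m : {sigma_finite_measure set 'rV[R]_n -> \bar R}).

Definition leb_step : set 'rV[R]_n.+1 -> \bar R :=
  pushforward (@lebesgue_measure R \x m)%E (@consrV n).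

Let leb_step0 : leb_step set0 = 0%E.
Proof. exact: measure0. Qed.

Let leb_step_ge0 A : (0 <= leb_step A)%E.
Proof. exact: measure_ge0. Qed.

Let leb_step_sigma_additive : semi_sigma_additive leb_step.
Proof. exact: measure_semi_sigma_additive. Qed.

HB.instance Definition _ := isMeasure.Build _ _ _ leb_step
  leb_step0 leb_step_ge0 leb_step_sigma_additive.

Let unconsrV (v : 'rV[R]_n.+1) : measurableTypeR R * 'rV[R]_n :=
  (v 0 ord0, \row_j v 0 (lift ord0 j)).

Let leb_step_sigma_finite : sigma_finite setT leb_step.
Proof.
have mu : measurable_fun setT unconsrV.
  apply/measurable_fun_pairP; split; first exact: measurable_coord.
  apply: measurable_fun_rV => j /=.
  by under eq_fun do rewrite mxE; exact: measurable_coord.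
have /sigma_finiteP[F [TF ndF Foo]] := sigma_finiteT (@lebesgue_measure R).
have /sigma_finiteP[G [TG ndG Goo]] := sigma_finiteT m.
exists (fun k => unconsrV @^-1` (F k `*` G k)).
  apply/esym; rewrite -subTset => v _.
  have [i _ Fi] : (\bigcup_i F i) (unconsrV v).1 by rewrite -TF.
  have [j _ Gj] : (\bigcup_j G j) (unconsrV v).2 by rewrite -TG.
  exists (maxn i j) => //; split.
    by move: Fi; exact/subsetPset/ndF/leq_maxl.
  by move: Gj; exact/subsetPset/ndG/leq_maxr.
move=> k; have [mF Fk] := Foo k; have [mG Gk] := Goo k; split.
  by rewrite -[X in measurable X]setTI; apply: mu => //; exact: measurableX.
rewrite /leb_step /pushforward -comp_preimage (_ : _ \o _ = id); last first.
  apply/funext => -[a v]; rewrite /unconsrV /=; congr pair.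
    by rewrite mxE unlift_none.
  by apply/rowP => j; rewrite !mxE liftK.
by rewrite preimage_id product_measure1E// lte_mul_pinfty// ge0_fin_numE.
Qed.

HB.instance Definition _ := Measure_isSigmaFinite.Build _ _ _ leb_step
  leb_step_sigma_finite.

End step.

Let leb0 : set 'rV[R]_0 -> \bar R := dirac (0 : 'rV[R]_0).

Let leb0_sigma_finite : sigma_finite setT leb0.
Proof.
exists (fun=> setT) => [|i]; first by rewrite bigcup_const.
by split=> //; rewrite /leb0 diracT ltry.
Qed.

HB.instance Definition _ := Measure.on leb0.
HB.instance Definition _ := Measure_isSigmaFinite.Build _ _ _ leb0
  leb0_sigma_finite.

Fixpoint leb n : {sigma_finite_measure set 'rV[R]_n -> \bar R} :=
  if n is k.+1 then leb_step (leb k) : {sigma_finite_measure set _ -> \bar R}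
  else leb0 : {sigma_finite_measure set _ -> \bar R}.

End lebesgue_rV.

Section euclidean.
Context (R : realType) (d : nat).
Implicit Types v w : 'rV[R]_d.

Definition dotv v w : R := \sum_i v 0 i * w 0 i.

(* The library norm on 'rV[R]_d is the maximum norm. *)
Definition enorm v : R := Num.sqrt (dotv v v).

End euclidean.

Section esum_measure.
Local Open Scope ereal_scope.
Context d (T : measurableType d) (R : realType) (I : choiceType).
Variables (D : set I) (m : I -> {measure set T -> \bar R}).

Definition mesum (A : set T) : \bar R := \esum_(i in D) m i A.

Let mesum0 : mesum set0 = 0.
Proof. by rewrite /mesum esum1// => i _; rewrite measure0. Qed.

Let mesum_ge0 A : 0 <= mesum A.
Proof. exact: esum_ge0. Qed.

Let mesum_sigma_additive : semi_sigma_additive mesum.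
Proof.
move=> F mF tF mUF.
rewrite [X in _ --> X](_ : _ = \sum_(n <oo) mesum (F n)).
  by apply: is_cvg_nneseries => n _ _; exact: mesum_ge0.
rewrite nneseries_esumT// /mesum.
transitivity (\esum_(i in D) \esum_(n in [set: nat]) m i (F n)).
  by apply: eq_esum => i _; rewrite -nneseries_esumT//; exact: measure_semi_bigcup.
rewrite !esum_esum//.
rewrite (@reindex_esum _ _ _ ([set: nat] `*` D) _ (fun p => (p.2, p.1)))//.
split=> [[n i] [_ /= Di]|[n i] [n' i'] _ _ [-> ->]|[i n] [/= Di _]]//.
by exists (n, i).
Qed.

HB.instance Definition _ := isMeasure.Build _ _ _ mesum
  mesum0 mesum_ge0 mesum_sigma_additive.

End esum_measure.

Section surface.
Context (R : realType) (d : nat).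

(* (k, a, b) stands for the hyperplane y_k = a . y' + b, where y' is y without
   its k-th coordinate, seen as the graph of an affine function of y'. *)
Definition hyperplane : Type := ('I_d * 'rV[R]_d.-1 * R)%type.
HB.instance Definition _ := Choice.on hyperplane.

Definition graph_pt (p : hyperplane) (t : 'rV[R]_d.-1) : 'rV[R]_d :=
  \row_i (if unlift p.1.1 i is Some j then t 0 j
          else dotv p.1.2 t + p.2).

Lemma measurable_graph_pt p : measurable_fun setT (graph_pt p).
Proof.
apply: measurable_fun_rV => i; rewrite /graph_pt.
case: (unliftP p.1.1 i) => [j|] ->; under eq_fun do rewrite mxE ?liftK ?unlift_none.
  exact: measurable_coord.
apply: measurable_funD => //; apply: measurable_sum => j.
by apply: measurable_funM => //; exact: measurable_coord.
Qed.

HB.instance Definition _ p :=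
  isMeasurableFun.Build _ _ _ _ (graph_pt p) (measurable_graph_pt p).

Section hyperplane_measure.
Variable p : hyperplane.

Definition graph_measure : set 'rV[R]_d -> \bar R :=
  pushforward (leb R d.-1) (graph_pt p).

Let graph_measure0 : graph_measure set0 = 0%E.
Proof. exact: measure0. Qed.

Let graph_measure_ge0 A : (0 <= graph_measure A)%E.
Proof. exact: measure_ge0. Qed.

Let graph_measure_sigma_additive : semi_sigma_additive graph_measure.
Proof. exact: measure_semi_sigma_additive. Qed.

HB.instance Definition _ := isMeasure.Build _ _ _ graph_measure
  graph_measure0 graph_measure_ge0 graph_measure_sigma_additive.

(* dS = sqrt (1 + |a|^2) dy' *)
Definition hyperplane_measure : {measure set 'rV[R]_d -> \bar R} :=
  mscale (NngNum (sqrtr_ge0 (1 + dotv p.1.2 p.1.2))) graph_measure.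

End hyperplane_measure.

(* Every hyperplane has exactly one representation in which k is the first
   coordinate occurring in its equation. *)
Definition reduced : set hyperplane :=
  [set p : hyperplane | forall j : 'I_d.-1, (j < p.1.1)%N -> p.1.2 0 j = 0].

(* A set contained in finitely many hyperplanes is measured by its
   (d-1)-dimensional Lebesgue measure in each of them; two distinct hyperplanes
   meet in a null set, so the sum over all hyperplanes counts nothing twice. *)
Definition surf : {measure set 'rV[R]_d -> \bar R} :=
  mesum reduced hyperplane_measure.

End surface.

Section domain.
Context (R : realType) (d : nat).
Implicit Types (A Omega : set 'rV[R]_d).

Definition boundary A : set 'rV[R]_d := closure A `\` interior A.

Definition lipschitz_boundary Omega :=
  forall x, boundary Omega x ->
  exists (r : R) (Q : 'M[R]_d) (k : 'I_d) (g : 'rV[R]_d.-1 -> R),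
    [/\ 0 < r, Q *m Q^T = 1%:M, [lipschitz g t | t in [set: 'rV[R]_d.-1]] &
        forall y, enorm (y - x) < r ->
          (Omega y <-> g (col' k (y *m Q)) < (y *m Q) 0 k)].

Definition lipschitz_region Omega :=
  [/\ open Omega, Omega !=set0, bounded_set Omega, connected Omega &
      lipschitz_boundary Omega].

(* At y, the boundary of A has a tangent hyperplane with unit normal nu, and A
   lies on the side opposite to nu. *)
Definition outward_unit_normal A (y nu : 'rV[R]_d) :=
  enorm nu = 1 /\
  forall eta : R, 0 < eta -> exists2 r : R, 0 < r &
    forall z, enorm (z - y) < r ->
      (dotv (z - y) nu < - eta * enorm (z - y) -> A z) /\
      (eta * enorm (z - y) < dotv (z - y) nu -> ~ A z).

(* 0 at the points where no outward normal exists. *)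
Definition normal_field A (y : 'rV[R]_d) : 'rV[R]_d :=
  xget 0 [set nu | outward_unit_normal A y nu].

(* The part S of the boundary of A lies in one hyperplane with unit normal nu,
   and nu is the outward normal to A on S (up to a set of zero area). *)
Definition flat_face A (S : set 'rV[R]_d) (nu : 'rV[R]_d) :=
  [/\ 0 < fine (surf R d S), exists c : R, forall y, S y -> dotv nu y = c &
      (surf R d).-negligible [set y | S y /\ ~ outward_unit_normal A y nu]].

Definition centroid (S : set 'rV[R]_d) : 'rV[R]_d :=
  \row_k ((fine (surf R d S))^-1 * \int[surf R d]_(y in S) y 0 k).

End domain.

Section fields.
Context (R : realType) (d : nat).
Implicit Types (f : 'rV[R]_d -> R) (u : 'rV[R]_d -> 'rV[R]_d).

Definition partial (i : 'I_d) f : 'rV[R]_d -> R :=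
  fun x => 'D_(delta_mx 0 i) f x.

Definition component u (k : 'I_d) : 'rV[R]_d -> R := fun x => u x 0 k.

Definition divergence u : 'rV[R]_d -> R :=
  fun x => \sum_k partial k (component u k) x.

Definition C2_on (Omega : set 'rV[R]_d) f :=
  forall x, Omega x ->
  [/\ {for x, continuous f},
      forall i, derivable f x (delta_mx 0 i) /\ {for x, continuous (partial i f)} &
      forall i j, derivable (partial i f) x (delta_mx 0 j) /\
                  {for x, continuous (partial j (partial i f))}].

(* Supremum over Omega of all components and of all their partial derivatives
   of order 1 and 2. *)
Definition C2_norm (Omega : set 'rV[R]_d) u : \bar R :=
  ereal_sup [set r | exists x k, Omega x /\
    [\/ r = `|component u k x|%:E,
        exists i, r = `|partial i (component u k) x|%:E |
        exists i j, r = `|partial j (partial i (component u k)) x|%:E]].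

(* Value at a point of the closure of Omega of the continuous extension of a
   function defined in Omega. *)
Definition extension (T : ptopologicalType) (Omega : set 'rV[R]_d)
  (f : 'rV[R]_d -> T) (x : 'rV[R]_d) : T :=
  lim (f z @[z --> within Omega (nbhs x)]).

End fields.

(* Points are numbered; X_Gamma is given by the indices in [bdry], and gamma by
   the indices in [gam] of the boundary faces it consists of, so that X_0 and
   X_gamma' together are the points with index outside [gam].  The primal edges
   are given by the relation [adj]. *)
Record pd_mesh (R : realType) (d : nat) := PdMesh {
  npts : nat ;
  pt : 'I_npts -> 'rV[R]_d ;
  bdry : {set 'I_npts} ;
  gam : {set 'I_npts} ;
  adj : rel 'I_npts ;
  cell : 'I_npts -> set 'rV[R]_d ;
  dnormal : 'I_npts -> 'I_npts -> 'rV[R]_d ;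
  bnormal : 'I_npts -> 'rV[R]_d
}.

Section mesh.
Context (R : realType) (d : nat) (Omega : set 'rV[R]_d) (M : pd_mesh R d).
Implicit Types (i j k : 'I_(npts M)) (S : set 'rV[R]_d).

Definition vol i : R := fine (leb R d (cell i)).

Definition area S : R := fine (surf R d S).

Definition dface i j : set 'rV[R]_d := boundary (cell i) `&` boundary (cell j).

(* For i in [bdry], this is the boundary face with centroid [pt i]. *)
Definition bface i : set 'rV[R]_d := boundary (cell i) `&` boundary Omega.

Definition fill_distance : R :=
  sup [set r | exists2 y, Omega y &
    r = inf [set enorm (y - pt i) | i in [set: 'I_(npts M)]]].

Definition separation_distance : R :=
  2^-1 * inf [set r | exists i j, i != j /\ r = enorm (pt i - pt j)].

Definition quasi_uniform (c : R) :=
  separation_distance <= fill_distance <= c * separation_distance.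

Definition point_cloud :=
  [/\ injective (@pt R d M),
      gam M \subset bdry M,
      forall i, i \notin bdry M -> Omega (pt i) &
      forall i, i \in bdry M -> bface i (pt i) /\ pt i = centroid (bface i)].

Definition boundary_partition :=
  [/\ boundary Omega = \bigcup_(i in [set i | i \in bdry M]) bface i,
      forall i j, i \in bdry M -> j \in bdry M -> i != j ->
        surf R d (bface i `&` bface j) = 0%E &
      forall i, i \in bdry M -> flat_face Omega (bface i) (bnormal i)].

(* The dual cells are open; they partition Omega up to their boundaries. *)
Definition dual_cells :=
  [/\ forall i : 'I_(npts M), open (cell i) /\ cell i `<=` Omega,
      forall i : 'I_(npts M), 0 < vol i,
      forall i j : 'I_(npts M), i != j -> cell i `&` cell j = set0 &
      Omega `<=` \bigcup_(i in [set: 'I_(npts M)]) closure (cell i)].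

Definition dual_faces :=
  [/\ symmetric (@adj R d M), irreflexive (@adj R d M),
      forall i j, adj i j -> flat_face (cell i) (dface i j) (dnormal i j) /\
                             dnormal i j = - dnormal j i &
      forall i, boundary (cell i) =
        (\bigcup_(j in [set j | adj i j]) dface i j) `|`
        (if i \in bdry M then bface i else set0)].

Definition is_mesh :=
  [/\ point_cloud, boundary_partition, dual_cells & dual_faces].

End mesh.

Section gmls.
Context (R : realType) (d : nat).

Definition affine_poly (p : 'rV[R]_d -> R) :=
  exists (a : R) (l : 'rV[R]_d), forall y, p y = a + dotv l y.

Definition P1_basis (phi : 'I_d.+1 -> 'rV[R]_d -> R) :=
  (forall r, affine_poly (phi r)) /\
  (forall p, affine_poly p ->
     exists! c : 'rV[R]_d.+1, forall y, p y = \sum_r c 0 r * phi r y).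

(* With indices starting at 0, s = k (d + 1) + r. *)
Definition vbasis_fun (phi : 'I_d.+1 -> 'rV[R]_d -> R) (s : 'I_(d * d.+1))
  (y : 'rV[R]_d) : 'rV[R]_d :=
  \row_k (if k == (s %/ d.+1)%N :> nat then phi (inord (s %% d.+1)%N) y else 0).

Definition kappa (eps rho : R) : R := (Num.max 0 (1 - rho / eps)) ^+ 4.

Context (Omega : set 'rV[R]_d) (M : pd_mesh R d).
Context (eps : R) (phi : 'I_d.+1 -> 'rV[R]_d -> R).
Implicit Types (i j k : 'I_(npts M)) (S : set 'rV[R]_d) (x nu : 'rV[R]_d).

(* A discrete field in U^h_gamma; its values at the points of gamma are never
   used. *)
Implicit Types uh : 'I_(npts M) -> 'rV[R]_d.

(* Prescribed values on gamma. *)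
Implicit Types ug : 'rV[R]_d -> 'rV[R]_d.

Definition gmls_face S :=
  (exists i j, adj i j /\ S = dface i j) \/
  (exists2 j, j \in bdry M :\: gam M & S = bface Omega j).

Definition unisolvent :=
  forall S, gmls_face S -> forall p, affine_poly p ->
    (forall k, k \notin gam M -> enorm (pt k - centroid S) < eps ->
       p (pt k) = 0) ->
    forall y, p y = 0.

Definition is_gmls := [/\ 0 < eps, P1_basis phi & unisolvent].

Definition field_of (b : 'rV[R]_(d * d.+1)) (y : 'rV[R]_d) : 'rV[R]_d :=
  \sum_s b 0 s *: vbasis_fun phi s y.

Definition ls_functional S uh (b : 'rV[R]_(d * d.+1)) : R :=
  2^-1 * \sum_(k | k \notin gam M)
    kappa eps (enorm (centroid S - pt k)) *
    enorm (field_of b (pt k) - uh k) ^+ 2.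

Definition gmls_coef S uh : 'rV[R]_(d * d.+1) :=
  xget 0 [set b | forall b', ls_functional S uh b <= ls_functional S uh b'].

Definition face_moment S nu : 'rV[R]_(d * d.+1) :=
  \row_s \int[surf R d]_(y in S) dotv (vbasis_fun phi s y) nu.

Definition gmls_flux S nu uh : R := dotv (gmls_coef S uh) (face_moment S nu).

Definition div_gmls ug uh i : R :=
  (vol i)^-1 *
  (\sum_(j | adj i j) gmls_flux (dface i j) (dnormal i j) uh
   + (if i \in bdry M :\: gam M
      then gmls_flux (bface Omega i) (bnormal i) uh else 0)
   + (if i \in gam M
      then \int[surf R d]_(y in bface Omega i)
             dotv (ug y) (normal_field Omega y)
      else 0)).

Definition mls_stable (stab : R) :=
  forall S, gmls_face S -> forall uh,
    enorm (field_of (gmls_coef S uh) (centroid S)) <=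
    stab * \big[Num.max/0]_(k | (k \notin gam M) &&
                                (enorm (pt k - centroid S) < eps)) enorm (uh k).

End gmls.

Record uniformity_constants (R : realType) := UniformityConstants {
  c_qu : R ;
  vol_lower : R ;
  vol_upper : R ;
  eps_ratio : R ;
  nb_faces : nat ;
  dface_area : R ;
  bface_area : R ;
  dface_dist : R ;
  bface_dist : R ;
  stability : R
}.

Section uniformity.
Context (R : realType) (d : nat) (Omega : set 'rV[R]_d) (M : pd_mesh R d).
Context (eps : R) (phi : 'I_d.+1 -> 'rV[R]_d -> R).
Context (K : uniformity_constants R).

Let h := fill_distance Omega M.

(* The constants are bounds for the corresponding ratios and maxima. *)
Definition uniform_mesh :=
  quasi_uniform Omega M (c_qu K) /\
  (0 < vol_lower K /\
   forall i : 'I_(npts M),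
     vol_lower K <= vol i / h ^+ d <= vol_upper K) /\
  eps / h <= eps_ratio K /\
  (forall i : 'I_(npts M), (#|[set j | adj i j]| <= nb_faces K)%N) /\
  (forall i j : 'I_(npts M), adj i j ->
     area (dface i j) / h ^+ d.-1 <= dface_area K /\
     enorm (pt i - centroid (dface i j)) / h <= dface_dist K) /\
  (forall i : 'I_(npts M), i \in bdry M ->
     area (bface Omega i) / h ^+ d.-1 <= bface_area K /\
     forall y, bface Omega i y -> enorm (y - pt i) / h <= bface_dist K) /\
  mls_stable Omega M eps phi (stability K).

End uniformity.

(* Main.v *)
Require Import Defs.
From HB Require Import structures.
From mathcomp Require Import all_boot all_order all_algebra.
From mathcomp Require Import all_classical all_reals all_analysis.
From mathcomp Require Import measurable_realfun ring lra zify.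

(** Conservation is bookkeeping.  The moments of a dual face seen from its two
    cells are opposite and the coefficients agree, so the fluxes through a
    common face cancel in pairs (flux_antisym) and a sum over cells keeps only
    the fluxes that leave the set.  For the global statement the boundary faces
    cover the boundary and overlap in null sets, on which the outward normal of
    the region and that of the face may differ freely.

    Accuracy compares the field u with its Taylor polynomial T of degree one at
    the point x_i of a cell.
    - The fluxes of T through the faces of the cell add up to div T times the
      volume of the cell, without error.  This is the divergence theorem for
      affine fields on a flat-faced cell (flat_divergence, cell_divergence).
      No smoothness of the cell is needed: a coordinate direction is singled
      out, the volume is sliced into lines (leb_slice), each face is the graph
      over its shadow when it is not parallel to the direction (surf_lift_to),
      and on almost every line the identity reduces to the fundamental theorem
      of calculus for a finite union of intervals whose end points carry the
      signs of the normals (crossing_sums).  That the normals have the right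
      sign is checked cell by cell (dface_overlap, bface_overlap,
      bface_cell_normal).
    - Moving least squares reproduces affine fields (gmls_coef_shift), and the
      flux of an affine field through a flat face is the area times the normal
      value at the centroid (gmls_flux_centroid).  Hence the numerical flux of u
      differs from the flux of T by at most the area times the stability
      constant times the largest value of u - T at nearby points
      (gmls_flux_error).
    - u - T is of order h^2 at distance of order h from x_i.  The segment
      between two points may leave the region, so Taylor's formula is applied
      along polygonal lines (chain_taylor, field_taylor); a region with
      Lipschitz boundary is quasiconvex (quasiconvex), so these have length of
      order h as well.
    Each cell has boundedly many faces of area of order h^(d-1) and a volume of
    order h^d, so that the flux errors, of order h^(d+1) in total, leave an
    error of order h after division by the volume (local_truncation_error). *)

Set Implicit Arguments.
Unset Strict Implicit.
Unset Printing Implicit Defensive.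

Import Order.TTheory GRing.Theory Num.Theory.
Import numFieldNormedType.Exports.

Local Open Scope classical_set_scope.
Local Open Scope ring_scope.

(** * Null sets, Borel sets and slices *)

Section measure_tools.
Context {d} {T : measurableType d} {R : realType}.
Variable mu : {measure set T -> \bar R}.

Import HBNNSimple.

Lemma ge0_le_integral_null (N : set T) (f g : T -> \bar R) :
  measurable N -> mu N = 0%E ->
  (forall x, 0 <= f x)%E -> (forall x, 0 <= g x)%E ->
  (forall x, ~ N x -> f x = g x) ->
  (\int[mu]_x f x <= \int[mu]_x g x)%E.
Proof.
move=> mN N0 f0 g0 fg; rewrite ge0_integralTE// (ge0_integralTE mu g0).
apply: ge_ereal_sup => _ [h /= hf <-]; apply: le_ereal_sup_tmp.
have mNC := measurableC mN.
exists (sintegral mu (proj_nnsfun h mNC)); last first.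
  rewrite -!integralT_nnsfun; rewrite le_eqVlt; apply/orP; left; apply/eqP/ae_eq_integral => //.
  - exact/measurable_EFinP/measurable_funP.
  - exact/measurable_EFinP/measurable_funP.
  - exists N; split=> // x /= /not_implyP[_ hx]; apply: contrapT => Nx.
    by apply: hx; rewrite /= /mindic indicE mem_set ?mulr1.
exists (proj_nnsfun h mNC) => //= x; rewrite /mindic indicE.
have [|] := boolP (x \in ~` N); last by rewrite mulr0.
by rewrite mulr1 inE => Nx; rewrite -fg.
Qed.

(** The integral of a function that need not be measurable is a difference of
    suprema over simple functions; a simple function may be set to zero on a
    null set, so these suprema do not see null sets either. *)
Lemma integral_null (D N : set T) (f g : T -> \bar R) :
  measurable N -> mu N = 0%E -> (forall x, D x -> ~ N x -> f x = g x) ->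
  (\int[mu]_(x in D) f x = \int[mu]_(x in D) g x)%E.
Proof.
move=> mN N0 fg; rewrite integral_mkcond [RHS]integral_mkcond.
have {}fg x : ~ N x -> (f \_ D) x = (g \_ D) x.
  by move=> Nx; rewrite !patchE; case: ifPn => // /[!inE] Dx; exact: fg.
have fgp x : ~ N x -> ((f \_ D)^\+ x = (g \_ D)^\+ x)%E by move=> /fg fgx; rewrite !funeposE fgx.
have fgn x : ~ N x -> ((f \_ D)^\- x = (g \_ D)^\- x)%E by move=> /fg fgx; rewrite !funenegE fgx.
by rewrite integralE [RHS]integralE; congr (_ - _)%E; apply/eqP; rewrite eq_le;
  apply/andP; split; apply: (ge0_le_integral_null mN N0) => // x Nx; rewrite ?fgp ?fgn.
Qed.

Lemma Rintegral_negligible (D N : set T) (f g : T -> R) :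
  mu.-negligible N -> (forall x, D x -> ~ N x -> f x = g x) ->
  \int[mu]_(x in D) f x = \int[mu]_(x in D) g x.
Proof.
move=> [A [mA A0 NA]] fg; congr fine; apply: (integral_null mA A0) => x Dx Ax.
by rewrite fg// => /NA.
Qed.

End measure_tools.

Section borel.
Context {R : realType} {n : nat}.

Lemma rV_ball_measurable (q : 'rV[R]_n) (e : R) :
  measurable [set y : 'rV[R]_n | forall i, `|q 0 i - y 0 i| < e].
Proof.
rewrite (_ : mkset _ = \bigcap_(i in [set: 'I_n])
   [set y : 'rV[R]_n | `|q 0 i - y 0 i| < e]); last first.
  by apply/seteqP; split => [y h i _|y h i]; [exact: h|exact: (h i)].
apply: fin_bigcap_measurable => // i _.
have := @measurable_coord R n i measurableT (ball (q 0 i) e).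
rewrite setTI; apply; exact: measurable_ball.
Qed.

(** The boxes with rational centre and radius are a countable base. *)
Lemma rV_open_measurable (A : set 'rV[R]_n) : open A -> measurable A.
Proof.
move=> oA.
pose box (p : 'rV[rat]_n * rat) : set 'rV[R]_n :=
  [set y | forall i, `|ratr (p.1 0 i) - y 0 i| < ratr p.2].
have -> : A = \bigcup_p (if pselect (box p `<=` A) then box p else set0).
  apply/seteqP; split => [y Ay|y [p _]]; last by case: pselect => // + /= yp; exact.
  have /nbhs_ballP[e /= e0 yeA] := oA _ Ay.
  have [r] := @rat_in_itvoo _ 0 (e / 2) ltac:(by rewrite divr_gt0).
  rewrite in_itv/= => /andP[r0 re].
  have /boolp.choice[q qP] : forall i : 'I_n, exists q : rat, (ratr q : R) \in `]y 0 i - ratr r, y 0 i + ratr r[.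
    move=> i; apply: rat_in_itvoo.
    by rewrite ltrBlDr -addrA ltrDl addr_gt0.
  pose p := ((\row_i q i) : 'rV[rat]_n, r).
  have yp : box p y.
    by move=> i; rewrite mxE; have := qP i; rewrite in_itv/= -ltr_distl.
  exists p => //; case: pselect => //; case => z zp; apply: yeA.
  split=> // i j; rewrite ord1 /ball /=.
  have := zp j; have := yp j; rewrite mxE => yj zj.
  rewrite (le_lt_trans (ler_distD (ratr (q j)) _ _))// distrC.
  by rewrite [e]splitr ltrD// (lt_trans _ re).
apply: countable_bigcupT_measurable => [|p].
  exact: countableP.
case: (pselect (box p `<=` A)) => pA /=; last exact: measurable0.
rewrite (_ : box p = [set y | forall i, `|(map_mx ratr p.1 : 'rV[R]_n) 0 i - y 0 i| < ratr p.2]).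
  exact: rV_ball_measurable.
by apply/seteqP; split=> y h i; have := h i; rewrite mxE.
Qed.

Lemma rV_closed_measurable (A : set 'rV[R]_n) : closed A -> measurable A.
Proof. by move/closed_openC/rV_open_measurable/measurableC; rewrite setCK. Qed.

End borel.

Section insertion.
Context {R : realType}.

(** A coordinate may be inserted at any position, so that every axis can play the
    part of the first one, along which [leb] is built. *)
Definition ins n (m : 'I_n.+1) (t : R) (y : 'rV[R]_n) : 'rV[R]_n.+1 :=
  \row_i (if unlift m i is Some j then y 0 j else t).

Lemma ins_at n (m : 'I_n.+1) t y : ins m t y 0 m = t.
Proof. by rewrite mxE unlift_none. Qed.

Lemma ins_lift n (m : 'I_n.+1) t y j : ins m t y 0 (lift m j) = y 0 j.
Proof. by rewrite mxE liftK. Qed.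

Lemma insK n (m : 'I_n.+1) (x : 'rV[R]_n.+1) :
  ins m (x 0 m) (\row_j x 0 (lift m j)) = x.
Proof.
by apply/rowP => i; rewrite mxE; case: (unliftP m i) => [j|] ->; rewrite ?mxE.
Qed.

Lemma ins_swap n (k m : 'I_n.+2) : k != m ->
  exists k1 m1, [/\ lift k m1 = m, lift m k1 = k &
    forall x s (y : 'rV[R]_n), ins k x (ins m1 s y) = ins m s (ins k1 x y)].
Proof.
move=> km; have [m1 mE _] := unlift_some km.
have [k1 kE _] : {j | k = lift m j & unlift m k = Some j}.
  by apply: unlift_some; rewrite eq_sym.
exists k1, m1; split => // x s y; apply/rowP => i.
have [->|ik] := eqVneq i k; first by rewrite ins_at {1}kE ins_lift ins_at.
have [->|im] := eqVneq i m; first by rewrite ins_at {1}mE ins_lift ins_at.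
have [j iE _] : {j | i = lift k j & unlift k i = Some j}.
  by apply: unlift_some; rewrite eq_sym.
have jm1 : m1 != j by apply: contraNN im => /eqP jm1; rewrite iE -jm1 -mE.
have [l jE _] := unlift_some jm1.
have iE' : i = lift m (lift k1 l).
  apply/val_inj; rewrite iE jE/=.
  have := congr1 val mE; have := congr1 val kE; rewrite /= /bump; lia.
by rewrite {1}iE jE 2!ins_lift iE' 2!ins_lift.
Qed.

Lemma measurable_ins n (m : 'I_n.+1) :
  measurable_fun setT (fun p : measurableTypeR R * 'rV[R]_n => ins m p.1 p.2).
Proof.
apply: measurable_fun_rV => i; rewrite /ins.
case: (unliftP m i) => [j|] ->; under eq_fun do rewrite mxE ?liftK ?unlift_none.
- exact: (measurableT_comp (measurable_coord _) measurable_snd).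
- exact: measurable_fst.
Qed.

Lemma measurable_ins_preimage n (m : 'I_n.+1) (A : set 'rV[R]_n.+1) :
  measurable A -> measurable ((fun p : measurableTypeR R * 'rV[R]_n => ins m p.1 p.2) @^-1` A).
Proof. by move=> mA; rewrite -[X in measurable X]setTI; exact: measurable_ins. Qed.

Lemma measurable_slice n (m : 'I_n.+1) (A : set 'rV[R]_n.+1) y :
  measurable A -> measurable [set t : measurableTypeR R | A (ins m t y)].
Proof.
move=> /(@measurable_ins_preimage _ m _)/(@measurable_ysection _ _ _ _ _ y).
by congr (measurable _); apply/seteqP; split=> t /=; rewrite /ysection/= ?inE.
Qed.

Definition slice n (m : 'I_n.+1) (A : set 'rV[R]_n.+1) (y : 'rV[R]_n) : \bar R :=
  @lebesgue_measure R [set t | A (ins m t y)].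

Lemma slice_ysection n (m : 'I_n.+1) (A : set 'rV[R]_n.+1) (y : 'rV[R]_n) :
  slice m A y = lebesgue_measure (ysection
    ((fun p : measurableTypeR R * 'rV[R]_n => ins m p.1 p.2) @^-1` A) y).
Proof.
by congr lebesgue_measure; apply/seteqP; split=> t /=; rewrite /ysection/= ?inE.
Qed.

Lemma measurable_slice_fun n (m : 'I_n.+1) (A : set 'rV[R]_n.+1) :
  measurable A -> measurable_fun setT (slice m A).
Proof.
move=> /(@measurable_ins_preimage _ m _)/(measurable_fun_ysection lebesgue_measure).
by apply: eq_measurable_fun => y _; rewrite slice_ysection.
Qed.

Lemma slice_ge0 n (m : 'I_n.+1) A y : (0 <= slice m A y)%E.
Proof. exact: measure_ge0. Qed.

Lemma leb_slice0 n (A : set 'rV[R]_n.+1) : measurable A ->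
  leb R n.+1 A = (\int[leb R n]_y slice ord0 A y)%E.
Proof.
move=> mA; have mA' := @measurable_ins_preimage _ ord0 _ mA.
transitivity ((@lebesgue_measure R \x leb R n)%E
  ((fun p : measurableTypeR R * 'rV[R]_n => ins ord0 p.1 p.2) @^-1` A)) => //.
rewrite (@product_measure_unique _ _ _ _ _ lebesgue_measure (leb R n)
  (product_measure2 lebesgue_measure (leb R n)))//; last first.
  by move=> B C mB mC /=; rewrite product_measure2E.
by apply: eq_integral => y _; rewrite slice_ysection.
Qed.

(** Cavalieri's principle: the axis is moved to the front by exchanging it with
    the first one, which Tonelli's theorem allows. *)
Lemma leb_slice n (m : 'I_n.+1) (A : set 'rV[R]_n.+1) : measurable A ->
  leb R n.+1 A = (\int[leb R n]_y slice m A y)%E.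
Proof.
elim: n m A => [|n IH] m A mA; first by rewrite (ord1 m) leb_slice0.
have [->|m0] := eqVneq m ord0; first exact: leb_slice0.
have [k1 [m1 [m1E k1E swap]]] := @ins_swap n ord0 m ltac:(by rewrite eq_sym).
have k10 : k1 = ord0.
  by apply/val_inj; have := congr1 val k1E; rewrite /= /bump; lia.
have mA0 := @measurable_ins_preimage _ ord0 _ mA.
have slA y : slice m A y = slice m1 ((ins ord0 (y 0 ord0)) @^-1` A) (\row_j y 0 (lift ord0 j)).
  rewrite /slice; congr lebesgue_measure; apply/seteqP; split=> t/=;
  by rewrite swap k10 insK.
transitivity (\int[lebesgue_measure]_x leb R n.+1 ((ins ord0 x) @^-1` A))%E.
  rewrite [LHS]/=/leb_step/pushforward/product_measure1; apply: eq_integral => x _ /=.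
  by congr (leb_step _ _); apply/seteqP; split=> y; rewrite /xsection/= inE.
transitivity (\int[lebesgue_measure]_x \int[leb R n]_y slice m A (ins ord0 x y))%E.
  apply: eq_integral => x _; rewrite (IH m1); last first.
    have := @measurable_xsection _ _ _ _ _ x mA0.
    by congr (measurable _); apply/seteqP; split=> t /=; rewrite /xsection/= ?inE.
  apply: eq_integral => y _; rewrite slA ins_at; congr slice.
  by apply/rowP => j; rewrite mxE ins_lift.
have mS := @measurable_slice_fun _ m _ mA.
rewrite -(@fubini_tonelli1 _ _ _ _ _ lebesgue_measure (leb R n)
  (fun p => slice m A (ins ord0 p.1 p.2)))//.
- rewrite [in RHS]/=/leb_step.
  by rewrite (@ge0_integral_pushforward _ _ _ _ _ (@consrV R n)).
- exact: (measurableT_comp mS (measurable_ins ord0)).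
Qed.

End insertion.

(** * Hyperplanes and surface measure *)

Section hyperplanes.
Context {R : realType}.

Lemma lebesgue_measure_affine (a b : R) (B : set R) :
  a != 0 -> measurable (B : set (measurableTypeR R)) ->
  (@lebesgue_measure R B = `|a|%:E * @lebesgue_measure R [set s | B (a * s + b)%R])%E.
Proof.
move=> a0 mB.
pose f (s : measurableTypeR R) : measurableTypeR R := (a * s + b)%R.
have mf : measurable_fun setT f by exact: measurable_funD.
pose mu : {measure set (measurableTypeR R) -> \bar R} :=
  mscale (NngNum (normr_ge0 a)) (pushforward lebesgue_measure f).
rewrite (@lebesgue_measure_unique _ (mu mf))// => _ [[u v]] _ <-.
transitivity (`|a|%:E * @lebesgue_measure R [set s : R | (a * s + b)%R \in `]u, v]])%E; last by [].
have [alt|agt|/eqP] := ltgtP a 0; last by rewrite (negbTE a0).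
- rewrite [X in (_ * lebesgue_measure X)%E](_ : _ = `[((v - b) / a)%R, ((u - b) / a)%R[%classic); last first.
    apply/seteqP; split=> s /=; rewrite !in_itv/= ler_ndivrMr// ltr_ndivlMr// lerBrDr ltrBlDr.
    1,2: by rewrite mulrC andbC.
  rewrite !lebesgue_measure_itv/= !lte_fin ltr_nM2r ?invr_lt0// ltrD2r.
  case: ifPn => _; last by rewrite mule0.
  rewrite -EFinB -EFinM; congr EFin; rewrite ltr0_norm//.
  by field.
- rewrite [X in (_ * lebesgue_measure X)%E](_ : _ = `]((u - b) / a)%R, ((v - b) / a)%R]%classic); last first.
    apply/seteqP; split=> s /=; rewrite !in_itv/= ler_pdivlMr// ltr_pdivrMr// lerBrDr ltrBlDr.
    1,2: by rewrite mulrC.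
  rewrite !lebesgue_measure_itv/= !lte_fin ltr_pM2r ?invr_gt0// ltrD2r.
  case: ifPn => _; last by rewrite mule0.
  rewrite -EFinB -EFinM; congr EFin; rewrite gtr0_norm//.
  by field; rewrite gt_eqF.
Qed.

Lemma dotv_ins n (m : 'I_n.+1) (a : 'rV[R]_n.+1) t y :
  dotv a (ins m t y) = a 0 m * t + \sum_j a 0 (lift m j) * y 0 j.
Proof.
rewrite /dotv (bigD1_ord m)//= ins_at; congr (_ + _).
by apply: eq_bigr => j _; rewrite ins_lift.
Qed.

Lemma measurable_dotv n (a : 'rV[R]_n) :
  measurable_fun [set: 'rV[R]_n] (fun y => dotv a y : measurableTypeR R).
Proof.
by apply: measurable_sum => j; apply: measurable_funM => //; exact: measurable_coord.
Qed.

Lemma measurable_hyperplane n (a : 'rV[R]_n) (c : R) :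
  measurable [set y | dotv a y = c].
Proof.
by have := @measurable_dotv n a measurableT [set c] (measurable_set1 c); rewrite setTI.
Qed.

(** The slices along an axis occurring in the equation are single points. *)
Lemma leb_hyperplane0 n (a : 'rV[R]_n) (c : R) : a != 0 \/ c != 0 ->
  leb R n [set y | dotv a y = c] = 0%E.
Proof.
have [->|a0 _] := eqVneq a 0.
  case=> [/eqP//|c0]; rewrite [X in leb R n X](_ : _ = set0) ?measure0//.
  apply/seteqP; split=> // y /=; rewrite /dotv big1 => [c0'|i _].
    by move: c0; rewrite -c0' eqxx.
  by rewrite mxE mul0r.
case: n => [|n] in a a0 *; first by move: a0; rewrite thinmx0 eqxx.
have /existsP[m am] : [exists m, a 0 m != 0].
  apply: contraNT a0 => /existsPn a0; apply/eqP/rowP => i.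
  by rewrite mxE; apply/eqP; have := a0 i; rewrite negbK.
rewrite (leb_slice m); last exact: measurable_hyperplane.
apply: integral0_eq => y _; rewrite /slice.
have -> : [set t | [set y0 | dotv a y0 = c] (ins m t y)] =
    [set ((c - \sum_j a 0 (lift m j) * y 0 j) / a 0 m)].
  apply/seteqP; split=> t /=; rewrite dotv_ins.
    - by move=> <-; field.
  - by move=> ->; field.
exact: lebesgue_measure_set1.
Qed.

(** The hyperplane [dotv nu y = c], parametrized by its projection along the axis
    [m]. *)
Definition lift_to n (nu : 'rV[R]_n.+1) (c : R) (m : 'I_n.+1) (y : 'rV[R]_n) :=
  ins m ((c - \sum_j nu 0 (lift m j) * y 0 j) / nu 0 m) y.

Lemma lift_toE n (nu : 'rV[R]_n.+1) c m y t : nu 0 m != 0 ->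
  dotv nu (ins m t y) = c <-> ins m t y = lift_to nu c m y.
Proof.
move=> num; rewrite dotv_ins; split => [<-|].
  by congr ins; field.
move=> /(congr1 (fun v : 'rV[R]_n.+1 => v 0 m)); rewrite !ins_at => ->.
by field.
Qed.

Lemma measurable_lift_to n (nu : 'rV[R]_n.+1) c m :
  measurable_fun setT (lift_to nu c m).
Proof.
pose g (y : 'rV[R]_n) : measurableTypeR R * 'rV[R]_n :=
  ((c - \sum_j nu 0 (lift m j) * y 0 j) / nu 0 m, y).
have mg : measurable_fun setT g.
  apply/measurable_fun_pairP; split; last exact: measurable_id.
  apply: measurable_funM => //; apply: measurable_funB => //.
  by apply: measurable_sum => j; apply: measurable_funM => //; exact: measurable_coord.
exact: (measurableT_comp (measurable_ins m) mg).
Qed.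

Lemma measurable_lift_to_preimage n (nu : 'rV[R]_n.+1) c m A : measurable A ->
  measurable (lift_to nu c m @^-1` A).
Proof. by move=> mA; rewrite -[X in measurable X]setTI; exact: measurable_lift_to. Qed.

(** Two projections of a hyperplane along coordinate axes differ by an affine
    map that changes a single coordinate, so the slices in that coordinate are
    scaled by a constant factor. *)
Lemma leb_lift_to n (nu : 'rV[R]_n.+1) c (k m : 'I_n.+1) A : measurable A ->
  nu 0 k != 0 -> nu 0 m != 0 ->
  (`|nu 0 k|%:E * leb R n (lift_to nu c m @^-1` A) =
   `|nu 0 m|%:E * leb R n (lift_to nu c k @^-1` A))%E.
Proof.
move=> mA nuk num; have [->//|km] := eqVneq k m.
case: n => [|n] in nu k m A mA nuk num km *; first by rewrite (ord1 k) (ord1 m) eqxx in km.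
have [k1 [m1 [m1E k1E swap]]] := @ins_swap R _ _ _ km.
have mAm := measurable_lift_to_preimage nu c m mA.
have mAk := measurable_lift_to_preimage nu c k mA.
rewrite (leb_slice k1 mAm) (leb_slice m1 mAk).
rewrite -!ge0_integralZl//; try exact: measurable_slice_fun; try by move=> *; exact: slice_ge0.
apply: eq_integral => y _.
pose b := (c - \sum_j nu 0 (lift k (lift m1 j)) * y 0 j) / nu 0 m.
rewrite /slice (@lebesgue_measure_affine (- nu 0 k / nu 0 m) b
  [set t | (lift_to nu c k @^-1` A) (ins m1 t y)]); last 2 first.
- by rewrite mulf_neq0 ?oppr_eq0 ?invr_eq0.
- exact: measurable_slice.
rewrite muleA -EFinM normrM normrN normfV mulrCA divff ?normr_eq0// mulr1.
congr (_ * lebesgue_measure _)%E; apply/seteqP; split => s /=.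
all: set s' := (- nu 0 k / nu 0 m * s + b)%R.
all: have nuP : dotv nu (ins k s (ins m1 s' y)) = c.
all: try by rewrite dotv_ins (eq_bigr (fun j => (\row_j nu 0 (lift k j)) 0 j *
  ins m1 s' y 0 j)) => [|j _]; rewrite ?mxE// -/(dotv _ _) dotv_ins mxE m1E /s' /b;
  under [X in _ + (_ + X)]eq_bigr do rewrite mxE; field.
all: have /(lift_toE _ _ _ nuk) <- := nuP.
all: by move: nuP; rewrite swap => /(lift_toE _ _ _ num) <-.
Qed.

Lemma graph_pt_lift_to n (nu : 'rV[R]_n.+1) c (k : 'I_n.+1) y :
  graph_pt (k, \row_j (- nu 0 (lift k j) / nu 0 k), c / nu 0 k) y = lift_to nu c k y.
Proof.
apply/rowP => i; rewrite !mxE /=; case: (unliftP k i) => // _.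
rewrite mulrBl addrC; congr (_ + _); rewrite /dotv mulr_suml -sumrN.
by apply: eq_bigr => j _; rewrite mxE mulNr mulNr mulrAC.
Qed.

Lemma graph_ptE n (p : hyperplane R n.+1) (y : 'rV[R]_n) :
  graph_pt p y = ins p.1.1 (dotv p.1.2 y + p.2) y.
Proof. by []. Qed.

(** Every other hyperplane meets the given one in the zero set of a nontrivial
    affine equation, which is null; a hyperplane is not counted twice because its
    reduced representation solves for its first nonzero coordinate. *)
Lemma graph_measure_transverse n (nu : 'rV[R]_n.+1) c (k : 'I_n.+1) (A : set 'rV[R]_n.+1)
    (q : hyperplane R n.+1) :
  measurable A -> A `<=` [set y | dotv nu y = c] ->
  nu 0 k != 0 -> (forall j : 'I_n.+1, (j < k)%N -> nu 0 j = 0) ->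
  reduced q -> q <> (k, \row_j (- nu 0 (lift k j) / nu 0 k), c / nu 0 k) ->
  graph_measure q A = 0%E.
Proof.
move=> mA AH nuk nu0 qred qp; case: q => [[l a] b] in qred qp *.
pose a' : 'rV[R]_n := \row_j (nu 0 (lift l j) + nu 0 l * a 0 j).
have : leb R n [set y | dotv a' y = c - nu 0 l * b] = 0%E.
  apply: leb_hyperplane0; apply/orP; rewrite -negb_and; apply/negP => /andP[/eqP a'0].
  rewrite subr_eq0 => /eqP cE; apply: qp.
  have nuE j : nu 0 (lift l j) = - nu 0 l * a 0 j.
    have := congr1 (fun v : 'rV[R]_n => v 0 j) a'0; rewrite !mxE => /eqP.
    by rewrite addr_eq0 mulNr => /eqP.
  have nul : nu 0 l != 0.
    apply: contra nuk => /eqP nul; case: (unliftP l k) => [j|] ->; last exact/eqP.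
    by rewrite nuE nul oppr0 mul0r.
  have lk : l = k.
    apply: ord_inj; apply/eqP; rewrite eqn_leq (leqNgt l) (leqNgt k); apply/andP; split; apply/negP.
      move=> kl; move: nuk; case: (unliftP l k) kl => [j|] ->; last by rewrite ltnn.
      move=> jl; rewrite nuE (qred j) ?mulr0 ?eqxx//=.
      by move: jl; rewrite /= /bump; lia.
    by move=> lk; move: nul; rewrite nu0 ?eqxx.
  rewrite -lk; congr (_, _, _); last by rewrite cE mulrAC divff ?mul1r.
  by apply/rowP => j; rewrite mxE nuE; field.
move=> H0; apply/eqP; rewrite eq_le measure_ge0 andbT -H0.
rewrite /graph_measure /pushforward; apply: (@le_measure _ _ _ (leb R n)); rewrite ?inE.
- by have := @measurable_graph_pt R n.+1 (l, a, b) measurableT _ mA; rewrite setTI.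
- exact: measurable_hyperplane.
move=> y /= /AH /=; rewrite graph_ptE /= dotv_ins => <-.
transitivity (\sum_j nu 0 (lift l j) * y 0 j + nu 0 l * dotv a y); last by ring.
rewrite /dotv mulr_sumr -big_split/=.
by apply: eq_bigr => j _; rewrite mxE; ring.
Qed.

(** Of the sum defining [surf] a single term is left on [A]. It has density
    [1 / |nu_k|] over the projection along the first axis [k] with [nu_k != 0], and
    [leb_lift_to] replaces this axis by [m]. *)
Lemma surf_lift_to n (nu : 'rV[R]_n.+1) c (m : 'I_n.+1) (A : set 'rV[R]_n.+1) :
  measurable A -> A `<=` [set y | dotv nu y = c] -> dotv nu nu = 1 -> nu 0 m != 0 ->
  (`|nu 0 m|%:E * surf R n.+1 A = leb R n (lift_to nu c m @^-1` A))%E.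
Proof.
move=> mA AH nu1 num.
(* [k] is the axis for which the representation is reduced *)
case: (@arg_minnP _ m (fun i => nu 0 i != 0) (fun i => i : nat) num) => k nuk kmin.
have nu0 (j : 'I_n.+1) : (j < k)%N -> nu 0 j = 0.
  by move=> jk; apply/eqP; apply: contraLR jk => /kmin; rewrite -leqNgt.
pose p : hyperplane R n.+1 := (k, \row_j (- nu 0 (lift k j) / nu 0 k), c / nu 0 k).
have pred : reduced p.
  move=> j /= jk; rewrite mxE nu0 ?oppr0 ?mul0r//=.
  by move: jk; rewrite /bump; lia.
have surfE : surf R n.+1 A = hyperplane_measure p A.
  rewrite [LHS]/=/mesum (esumID [set p]); last by move=> *; exact: measure_ge0.
  rewrite (_ : _ `&` [set p] = [set p]); last first.
    by apply/seteqP; split=> [i []//|i ->].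
  rewrite esum_set1; last exact: measure_ge0.
  rewrite esum1 ?adde0// => q [qred qp].
  by rewrite /= /mscale/= (graph_measure_transverse mA AH nuk nu0 qred) ?mule0.
have pE : (`|nu 0 k|%:E * surf R n.+1 A = leb R n (lift_to nu c k @^-1` A))%E.
  rewrite surfE /= /mscale/= muleA -EFinM.
  rewrite (_ : _ * _ = 1)%R ?mul1e.
    rewrite /graph_measure /pushforward; congr (leb R n _); apply/seteqP.
    by split=> y /=; rewrite graph_pt_lift_to.
  have nuk0 : `|nu 0 k| != 0 by rewrite normr_eq0.
  rewrite -[`|nu 0 k|]sqrtr_sqr -sqrtrM ?sqr_ge0// -[RHS]sqrtr1; congr Num.sqrt.
  rewrite mulrDr mulr1 -[RHS]nu1 /dotv (bigD1_ord k)//= -expr2; congr (_ + _).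
  rewrite mulr_sumr; apply: eq_bigr => j _; rewrite mxE mulf_div.
  by rewrite -expr2 sqrrN mulrC divfK// -expr2 sqrf_eq0.
have /(congr1 (fun x => ((`|nu 0 k|^-1)%:E * x)%E)) := leb_lift_to c mA nuk num.
have nuk0 : `|nu 0 k| != 0 by rewrite normr_eq0.
rewrite -pE !muleA -!EFinM mulVf// mul1e => ->; congr (_%:E * _)%E.
by rewrite mulrAC mulVf// mul1r.
Qed.

End hyperplanes.

(** * Euclidean geometry of row vectors *)

Section euclidean_facts.
Context {R : realType} {n : nat}.
Implicit Types v w x y : 'rV[R]_n.

Lemma dotvC v w : dotv v w = dotv w v.
Proof. by apply: eq_bigr => i _; rewrite mulrC. Qed.

Lemma dotvDl v w x : dotv (v + w) x = dotv v x + dotv w x.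
Proof. by rewrite /dotv -big_split; apply: eq_bigr => i _; rewrite mxE mulrDl. Qed.

Lemma dotvZl a v w : dotv (a *: v) w = a * dotv v w.
Proof. by rewrite /dotv mulr_sumr; apply: eq_bigr => i _; rewrite mxE mulrA. Qed.

Lemma dotvNl v w : dotv (- v) w = - dotv v w.
Proof. by rewrite -scaleN1r dotvZl mulN1r. Qed.

Lemma dotvBl v w x : dotv (v - w) x = dotv v x - dotv w x.
Proof. by rewrite dotvDl dotvNl. Qed.

Lemma dotvDr v w x : dotv x (v + w) = dotv x v + dotv x w.
Proof. by rewrite !(dotvC x) dotvDl. Qed.

Lemma dotvZr a v w : dotv w (a *: v) = a * dotv w v.
Proof. by rewrite !(dotvC w) dotvZl. Qed.

Lemma dotvNr v w : dotv w (- v) = - dotv w v.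
Proof. by rewrite !(dotvC w) dotvNl. Qed.

Lemma dotvBr v w x : dotv x (v - w) = dotv x v - dotv x w.
Proof. by rewrite dotvDr dotvNr. Qed.

Lemma dotv0l v : dotv 0 v = 0.
Proof. by rewrite -(scale0r v) dotvZl mul0r. Qed.

Lemma dotvv_ge0 v : 0 <= dotv v v.
Proof. by apply: sumr_ge0 => i _; rewrite -expr2 sqr_ge0. Qed.

Lemma dotvv_eq0 v : dotv v v = 0 -> v = 0.
Proof.
move=> /eqP; rewrite psumr_eq0 => [|i _]; last by rewrite -expr2 sqr_ge0.
move=> /allP v0; apply/rowP => i; rewrite mxE; apply/eqP.
by have := v0 i (mem_index_enum _); rewrite mulf_eq0 orbb.
Qed.

Lemma enorm_ge0 v : 0 <= enorm v. Proof. exact: sqrtr_ge0. Qed.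

Lemma enorm_sqr v : enorm v ^+ 2 = dotv v v.
Proof. by rewrite sqr_sqrtr ?dotvv_ge0. Qed.

Lemma enorm1_dotv v : enorm v = 1 -> dotv v v = 1.
Proof. by move=> v1; rewrite -enorm_sqr v1 expr1n. Qed.

Lemma enorm0 : enorm (0 : 'rV[R]_n) = 0.
Proof. by rewrite /enorm dotv0l sqrtr0. Qed.

Lemma enormZ a v : enorm (a *: v) = `|a| * enorm v.
Proof. by rewrite /enorm dotvZl dotvZr mulrA -expr2 sqrtrM ?sqr_ge0// sqrtr_sqr. Qed.

Lemma enormN v : enorm (- v) = enorm v.
Proof. by rewrite -scaleN1r enormZ normrN1 mul1r. Qed.

Lemma enormBC v w : enorm (v - w) = enorm (w - v).
Proof. by rewrite -opprB enormN. Qed.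

Lemma ler_dotv v w : `|dotv v w| <= enorm v * enorm w.
Proof.
rewrite -(ler_pXn2r (n := 2))// ?nnegrE ?mulr_ge0 ?enorm_ge0//.
rewrite exprMn !enorm_sqr real_normK ?num_real//.
have [w0|w0] := eqVneq (dotv w w) 0.
  by rewrite (dotvv_eq0 w0) dotvC !dotv0l mulr0 expr0n.
have wp : 0 < dotv w w by rewrite lt_def w0 dotvv_ge0.
have := dotvv_ge0 (dotv w w *: v - dotv v w *: w).
rewrite !(dotvBl, dotvBr, dotvZl, dotvZr) (dotvC w v).
set a := dotv v v; set b := dotv v w; set c := dotv w w => h.
suff : 0 <= c * (a * c - b ^+ 2) by rewrite pmulr_rge0// subr_ge0.
by rewrite (le_trans h)// le_eqVlt; apply/orP; left; apply/eqP; ring.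
Qed.

Lemma enormD v w : enorm (v + w) <= enorm v + enorm w.
Proof.
rewrite -(ler_pXn2r (n := 2))// ?nnegrE ?addr_ge0 ?enorm_ge0//.
rewrite sqrrD !enorm_sqr dotvDl !dotvDr (dotvC w v).
have := le_trans (ler_norm _) (ler_dotv v w); lra.
Qed.

Lemma enorm_triangle x y z : enorm (x - z) <= enorm (x - y) + enorm (y - z).
Proof. by rewrite (le_trans _ (enormD _ _))// addrA subrK. Qed.

Lemma coord_enorm v i : `|v 0 i| <= enorm v.
Proof.
rewrite -sqrtr_sqr ler_wsqrtr// /dotv (bigD1 i)//= -expr2 lerDl.
by apply: sumr_ge0 => j _; rewrite -expr2 sqr_ge0.
Qed.

Lemma rV_norm_leP v (e : R) : 0 <= e -> reflect (forall i, `|v 0 i| <= e) (`|v| <= e).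
Proof.
move=> e0; have -> : `|v| = mx_norm v by []; rewrite mx_normrE; apply: (iffP idP) => [h i|h].
  by apply: le_trans h; apply: (le_bigmax _ (fun ij : 'I_1 * 'I_n => `|v ij.1 ij.2|) (0, i)).
by apply/bigmax_leP; split=> // -[i j] _ /=; rewrite ord1.
Qed.

Lemma rV_norm_le_enorm v : `|v| <= enorm v.
Proof. by apply/rV_norm_leP; [exact: enorm_ge0|exact: coord_enorm]. Qed.

Lemma coord_le_norm v i : `|v 0 i| <= `|v|.
Proof. exact: (rV_norm_leP v (normr_ge0 v)). Qed.

Lemma enorm_delta i : enorm (delta_mx 0 i : 'rV[R]_n) = 1.
Proof.
rewrite /enorm /dotv (bigD1 i)//= mxE !eqxx mulr1 big1 ?addr0 ?sqrtr1// => j ji.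
by rewrite mxE (negbTE ji) andbF mul0r.
Qed.

Lemma enorm_sum (I : Type) (r : seq I) (P : pred I) (F : I -> 'rV[R]_n) :
  enorm (\sum_(i <- r | P i) F i) <= \sum_(i <- r | P i) enorm (F i).
Proof.
elim/big_ind2 : _ => // [|x a y b xa yb]; first by rewrite enorm0.
by rewrite (le_trans (enormD _ _))// lerD.
Qed.

Lemma enorm_le_sum v : enorm v <= \sum_i `|v 0 i|.
Proof.
rewrite [v in leLHS]row_sum_delta (le_trans (enorm_sum _ _ _))//.
by apply: ler_sum => i _; rewrite enormZ enorm_delta mulr1.
Qed.

Lemma enorm_le_norm v : enorm v <= n%:R * `|v|.
Proof.
apply: (le_trans (enorm_le_sum v)).
apply: (@le_trans _ _ (\sum_(i < n) `|v|)); first by apply: ler_sum => i _; exact: coord_le_norm.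
by rewrite sumr_const card_ord mulr_natl.
Qed.

End euclidean_facts.

(** * Signed crossings of a bounded set on a line *)

Section one_dimensional.
Context {R : realType}.

(** Otherwise the parameters of the points of [A] would be a nonempty clopen proper
    subset of [[0, 1]]. *)
Lemma seg_boundary n (A : set 'rV[R]_n) x y : A x -> ~ A y ->
  exists2 t : R, 0 <= t <= 1 & boundary A (x + t *: (y - x)).
Proof.
move=> Ax Ay; apply: contrapT => noB.
pose f (t : R) := x + t *: (y - x).
have cf : continuous f.
  by move=> t; apply: cvgD; [exact: cvg_cst|apply: cvgZl; exact: cvg_id].
have AB t : 0 <= t <= 1 -> closure A (f t) -> interior A (f t).
  by move=> t01 cA; apply: contrapT => iA; apply: noB; exists t.
have := @segment_connected R 0 1 [set t | 0 <= t <= 1 /\ A (f t)].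
have f1 : f 1 = y by rewrite /f scale1r addrC subrK.
move=> /(_ _ _ _) E; apply: Ay; rewrite -f1.
suff [//] : [set t | 0 <= t <= 1 /\ A (f t)] 1.
rewrite {}E/= ?in_itv/= ?lexx ?ler01//.
- by exists 0; rewrite /= lexx ler01 /f scale0r addr0.
- exists (f @^-1` interior A); first by apply: open_comp => [t _|]; [exact: cf|exact: open_interior].
  apply/seteqP; split=> t /=; rewrite in_itv/=.
    by move=> [t01 At]; split=> //; apply: AB => //; exact: subset_closure.
  by move=> [t01 /interior_subset].
- exists (f @^-1` closure A); first by apply: closed_comp => [t _|]; [exact: cf|exact: closed_closure].
  apply/seteqP; split=> t /=; rewrite in_itv/=.
    by move=> [t01 At]; split=> //; exact: subset_closure.
  by move=> [t01 /(AB _ t01)/interior_subset].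
Qed.

Let half_min (r s : R) : 0 < r -> 0 < s ->
  0 < Num.min r s / 2 /\ (Num.min r s / 2 < r /\ Num.min r s / 2 < s).
Proof.
move=> r0 s0; have m0 : 0 < Num.min r s by rewrite lt_min r0.
have : Num.min r s <= r by rewrite ge_min lexx.
have : Num.min r s <= s by rewrite ge_min lexx orbT.
by move: (Num.min r s) m0 => x; repeat split; lra.
Qed.

Section crossings.
Context (I : finType) (P : pred I) (tau sg : I -> R) (U : set R).
Hypothesis mU : measurable (U : set (measurableTypeR R)).
Hypothesis tau_inj : forall i j, P i -> P j -> tau i = tau j -> i = j.
Hypothesis cross : forall a b : R, a < b -> ~ (U a <-> U b) ->
  exists2 i, P i & a <= tau i <= b.
Hypothesis sides : forall i, P i -> (sg i = 1 \/ sg i = -1) /\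
  exists2 r : R, 0 < r & forall s : R, 0 < s < r ->
    U (tau i - sg i * s) /\ ~ U (tau i + sg i * s).

Let N s := \sum_(i | P i && (s < tau i)) sg i.
Let M s := \sum_(i | P i && (s < tau i)) sg i * (tau i - s).

Let no_cross s t : (forall i, P i -> s < tau i -> t <= tau i) ->
  forall x y, s < x < t -> s < y < t -> U x -> U y.
Proof.
move=> st; suff key x y : s < x -> y < t -> x < y -> (U x <-> U y).
  move=> x y /andP[sx xt] /andP[sy yt] Ux; have [xy|yx|<-//] := ltgtP x y.
    by apply/(key x y).
  by apply/(key y x).
move=> sx yt xy; apply: contrapT => /(cross xy)[i Pi /andP[xi iy]].
have := st i Pi (lt_le_trans sx xi); lra.
Qed.

Let step s j : P j -> s < tau j ->
  (forall i, P i -> s < tau i -> tau j <= tau i) ->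
  N s = sg j + N (tau j) /\
  M s = sg j * (tau j - s) + M (tau j) + N (tau j) * (tau j - s).
Proof.
move=> Pj sj jmin.
have E i : (P i && (s < tau i) && (i != j)) = (P i && (tau j < tau i)).
  apply/idP/idP => [/andP[/andP[Pi si] ij]|/andP[Pi ji]].
    rewrite Pi lt_neqAle jmin//= andbT; apply: contra ij => /eqP ji.
    by apply/eqP/tau_inj.
  rewrite Pi (lt_trans sj ji)/=; apply: contraTneq ji => ->.
  by rewrite ltxx.
rewrite /N /M; split; rewrite (bigD1 j) ?Pj//= (eq_bigl _ _ E)//.
rewrite -addrA; congr (_ + _); rewrite mulr_suml -big_split/=.
by apply: eq_bigr => i _; ring.
Qed.

Let state s := (exists2 r : R, 0 < r & forall x : R, s < x < s + r -> U x) /\ N s = 1 \/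
  (exists2 r : R, 0 < r & forall x : R, s < x < s + r -> ~ U x) /\ N s = 0.

(** Induction on the number of crossings above [s]: between consecutive crossings
    the set is everything or nothing, and passing a crossing toggles both this
    alternative and the signed number of crossings above. *)
Let descent s : (exists b : R, forall x : R, U x -> x < b) ->
  state s /\ @lebesgue_measure R (U `&` `]s, +oo[%classic) = (M s)%:E.
Proof.
move=> [b Ub].
have [k] := ubnP #|[pred i | P i && (s < tau i)]|.
elim: k s => // k IH s ks.
have [[j Pj sj]|noj] := pselect (exists2 j, P j & s < tau j); last first.
  have PF i : P i && (s < tau i) = false.
    by apply/negP => /andP[Pi si]; apply: noj; exists i.
  have nU x : s < x -> ~ U x.
    move=> sx Ux; have [i Pi /andP[xi _]] : exists2 i, P i & x <= tau i <= b.
      apply: cross; first exact: Ub.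
      by move=> -[/(_ Ux)/Ub]; rewrite ltxx.
    by have := PF i; rewrite Pi (lt_le_trans sx xi).
  rewrite /state /M /N !big_pred0//; split.
    by right; split=> //; exists 1 => // x /andP[+ _]; exact: nU.
  rewrite [X in lebesgue_measure X](_ : _ = set0) ?measure0//.
  by apply/seteqP; split=> // x [Ux] /=; rewrite in_itv/= andbT => /nU.
have Qj : P j && (s < tau j) by rewrite Pj.
case: (@arg_minP _ _ _ j (fun i => P i && (s < tau i)) tau Qj) => {Qj Pj sj}j.
move=> /andP[Pj sj] jmin.
have {}jmin i : P i -> s < tau i -> tau j <= tau i.
  by move=> Pi si; apply: jmin; rewrite Pi.
have [NE ME] := step Pj sj jmin.
have [stj lj] : state (tau j) /\ lebesgue_measure (U `&` `]tau j, +oo[%classic) = (M (tau j))%:E.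
  apply: IH; rewrite -ltnS (leq_trans _ ks)// ltnS; apply: proper_card.
  apply/properP; split.
    by apply/fintype.subsetP => i; rewrite !inE => /andP[-> /=]; exact: lt_trans.
  by exists j; rewrite !inE ?Pj//= ltxx.
have [sgj [r r0 rP]] := sides Pj.
have UE : U `&` `]s, +oo[%classic =
    (U `&` `]s, tau j]%classic) `|` (U `&` `]tau j, +oo[%classic).
  rewrite -setIUr; congr (_ `&` _); apply/seteqP; split=> x /=.
    by rewrite !in_itv/= !andbT => ->; case: (leP x (tau j)); [left|right].
  rewrite !in_itv/= !andbT => -[/andP[]//|].
  exact: (lt_trans sj).
have lE : lebesgue_measure (U `&` `]s, +oo[%classic) =
    (lebesgue_measure (U `&` `]s, tau j]%classic) + (M (tau j))%:E)%E.
  rewrite UE measureU//.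
  - by congr (_ + _)%E.
  - exact: measurableI.
  - exact: measurableI.
  - apply/seteqP; split=> // x [[_ /=]]; rewrite in_itv/= => /andP[_ xj] [_ /=].
    by rewrite in_itv/= andbT ltNge xj.
have [] := @half_min r (tau j - s) r0 ltac:(by rewrite subr_gt0).
set e := _ / 2 => e0 [er es].
have [Um Up] := rP e ltac:(by apply/andP; split).
have mid x : s < x < tau j -> (U x <-> U (tau j - e)).
  have he : s < tau j - e < tau j by apply/andP; split; lra.
  by move=> hx; split; exact: (no_cross jmin).
case: sgj => sgj; rewrite sgj ?mul1r ?mulN1r ?opprK in Um Up NE ME.
- have Nj : N (tau j) = 0.
    case: stj => [[[r' r'0 r'P] _]|[]//]; exfalso.
    have [x0 [x1 x2]] := half_min r0 r'0.
    have [_] := rP (Num.min r r' / 2) ltac:(by apply/andP; split).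
    by rewrite sgj mul1r; apply; apply: r'P; rewrite ltrDl ltrD2l; apply/andP.
  rewrite Nj !(addr0, mul0r) in NE ME; split.
    left; split=> //; exists (tau j - s); first by rewrite subr_gt0.
    by move=> x hx; apply/mid => //; rewrite addrC subrK in hx.
  rewrite lE ME EFinD; congr (_ + _)%E; apply/eqP; rewrite eq_le.
  have itvE o : @lebesgue_measure R [set` Interval (BRight s) (BSide o (tau j))] = (tau j - s)%:E.
    by rewrite lebesgue_measure_itv/= lte_fin sj -EFinB.
  rewrite -{1}(itvE false) -(itvE true); apply/andP; split; apply: le_measure;
    rewrite ?inE//; try exact: measurableI.
  move=> x /=; rewrite in_itv/= => /andP[sx xj]; split.
    by apply/mid => //; rewrite sx.
  by rewrite in_itv/= sx ltW.
- have Nj : N (tau j) = 1.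
    case: stj => [[]//|[[r' r'0 r'P] _]]; exfalso.
    have [x0 [x1 x2]] := half_min r0 r'0.
    have [+ _] := rP (Num.min r r' / 2) ltac:(by apply/andP; split).
    by rewrite sgj mulN1r opprK; apply: r'P; rewrite ltrDl ltrD2l; apply/andP.
  rewrite Nj addNr in NE; split.
    right; split=> //; exists (tau j - s); first by rewrite subr_gt0.
    by move=> x hx; rewrite mid//; rewrite addrC subrK in hx.
  rewrite lE ME Nj mul1r addrAC addNr add0r.
  rewrite (_ : lebesgue_measure _ = 0%E) ?add0e; first by congr EFin; ring.
  apply/eqP; rewrite eq_le measure_ge0 andbT -(lebesgue_measure_set1 (tau j)).
  apply: le_measure; rewrite ?inE//; first exact: measurableI.
  move=> x /= [Ux]; rewrite in_itv/= le_eqVlt => /andP[sx /orP[/eqP//|xj]].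
  by exfalso; apply: Up; apply/(mid x) => //; rewrite sx.
Qed.

(** The boundary of [U] consists of the points [tau i], at which [U] is left
    ([sg i = 1]) or entered ([sg i = -1]). The signs cancel because [U] is bounded,
    and each maximal interval of [U] contributes the difference of its ends. *)
Lemma crossing_sums : (exists b : R, forall x : R, U x -> `|x| < b) ->
  \sum_(i | P i) sg i = 0 /\
  @lebesgue_measure R U = (\sum_(i | P i) sg i * tau i)%:E.
Proof.
move=> [b Ub].
have [st l] : state (- b - 1) /\ lebesgue_measure (U `&` `]- b - 1, +oo[%classic) = (M (- b - 1))%:E.
  by apply: descent; exists b => x /Ub; rewrite ltr_norml => /andP[].
have taub i : P i -> - b - 1 < tau i.
  move=> Pi; have [sgi [r r0 rP]] := sides Pi.
  have [x0 [x1 x2]] := half_min r0 (@ltr01 R).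
  have [/Ub + _] := rP (Num.min r 1 / 2) ltac:(by apply/andP; split).
  by rewrite ltr_norml => /andP[+ _]; case: sgi => ->; lra.
have E i : P i && (- b - 1 < tau i) = P i.
  by apply/andP/idP => [[]//|Pi]; rewrite Pi taub.
have UE : U `&` `]- b - 1, +oo[%classic = U.
  apply/seteqP; split=> [x []//|x Ux]; split=> //=; rewrite in_itv/= andbT.
  by have := Ub x Ux; rewrite ltr_norml => /andP[]; lra.
rewrite UE /M (eq_bigl _ _ E) in l; rewrite /state /N (eq_bigl _ _ E) in st.
have N0 : \sum_(i | P i) sg i = 0.
  case: st => [[[r r0 rP] _]|[]//]; exfalso.
  have [x0 [x1 x2]] := half_min r0 (@ltr01 R).
  have /Ub : U (- b - 1 + Num.min r 1 / 2) by apply: rP; rewrite ltrDl ltrD2l; apply/andP.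
  by rewrite ltr_norml => /andP[+ _]; lra.
split=> //; rewrite l; congr EFin.
under eq_bigr do rewrite mulrBr.
by rewrite big_split/= sumrN -mulr_suml N0 mul0r subr0.
Qed.

End crossings.
End one_dimensional.

(** * Surface integrals as integrals over a projection *)

Section integral_tools.
Context {d} {T : measurableType d} {R : realType}.
Variable mu : {measure set T -> \bar R}.

Lemma negligible_bigcup_countType (I : countType) (F : I -> set T) :
  (forall i, mu.-negligible (F i)) -> mu.-negligible (\bigcup_i F i).
Proof.
move=> F0; pose G n := if unpickle n is Some i then F i else set0.
apply: (@negligibleS _ _ _ _ (\bigcup_n G n)).
  by move=> x [i _ Fx]; exists (pickle i) => //; rewrite /G pickleK.
by apply: negligible_bigcup => n; rewrite /G; case: unpickle => // ; exact: negligible_set0.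
Qed.

Lemma Rintegral_sum (I : Type) (r : seq I) (P : pred I) (D : set T) (f : I -> T -> R) :
  measurable D -> (forall i, P i -> mu.-integrable D (EFin \o f i)) ->
  \int[mu]_(x in D) (\sum_(i <- r | P i) f i x) = \sum_(i <- r | P i) \int[mu]_(x in D) f i x.
Proof.
move=> mD fi; elim: r => [|i r IH].
  rewrite big_nil -[RHS](mul0r (fine (mu D))) -Rintegral_cst//.
  by apply: eq_Rintegral => x _; rewrite big_nil.
rewrite big_cons; case: ifPn => Pi; last first.
  by rewrite -IH; apply: eq_Rintegral => x _; rewrite big_cons (negbTE Pi).
rewrite -IH -RintegralD//; last 2 first.
- exact: fi.
- apply: (eq_integrable mD (fun x => \sum_(i <- r | P i) (f i x)%:E)%E).
    by move=> x _; rewrite /= sumEFin.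
  exact: integrable_sum.
by apply: eq_Rintegral => x _; rewrite big_cons Pi.
Qed.

Lemma bounded_integrable (D : set T) (f : T -> R) (B : R) : measurable D ->
  (mu D < +oo)%E -> measurable_fun D f -> (forall x, D x -> `|f x| <= B) ->
  mu.-integrable D (EFin \o f).
Proof.
move=> mD Doo mf fB; apply: measurable_bounded_integrable => //.
exists B; split; first exact: num_real.
by move=> x Bx y Dy; exact: (le_trans (fB _ Dy) (ltW Bx)).
Qed.

End integral_tools.

Section change_of_graph.
Context {R : realType} {n : nat}.
Variables (nu : 'rV[R]_n.+1) (c : R) (m : 'I_n.+1) (S : set 'rV[R]_n.+1).
Hypotheses (mS : measurable S) (SH : S `<=` [set y | dotv nu y = c]).
Hypotheses (nu1 : dotv nu nu = 1) (num : nu 0 m != 0).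

Let L := lift_to nu c m.
Let mL : measurable_fun setT L. Proof. exact: measurable_lift_to. Qed.
Let mT : measurable (L @^-1` S). Proof. exact: measurable_lift_to_preimage. Qed.

Lemma ge0_integral_lift_to (f : 'rV[R]_n.+1 -> \bar R) : measurable_fun setT f ->
  (forall y, 0 <= f y)%E ->
  (`|nu 0 m|%:E * \int[surf R n.+1]_(y in S) f y = \int[leb R n]_(y in L @^-1` S) f (L y))%E.
Proof.
move=> mf f0.
rewrite -(@ge0_integral_mscale _ _ _ (surf R n.+1) S mS (NngNum (normr_ge0 (nu 0 m))) f)//;
  last exact: measurable_funTS.
rewrite -(@ge0_integral_pushforward _ _ _ _ _ L mL (leb R n) S f)//; last exact: measurable_funTS.
apply: eq_measure_integral => A mA AS.
by apply: (surf_lift_to mA _ nu1 num) => y /AS/SH.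
Qed.

Lemma integrable_lift_to (f : 'rV[R]_n.+1 -> R) : measurable_fun setT f ->
  (surf R n.+1).-integrable S (EFin \o f) ->
  (leb R n).-integrable (L @^-1` S) (EFin \o f \o L).
Proof.
move=> mf /integrableP[_ foo]; apply/integrableP; split.
  by apply: measurable_funTS; apply: measurableT_comp => //; exact/measurable_EFinP.
rewrite -(@ge0_integral_lift_to (fun y => `|(f y)%:E|%E))//.
- by apply: lte_mul_pinfty => //; rewrite ?lee_fin.
- by apply: measurableT_comp => //; exact/measurable_EFinP.
Qed.

Let integral_lift_to (h : 'rV[R]_n.+1 -> \bar R) : measurable_fun setT h ->
  (surf R n.+1).-integrable S h ->
  (`|nu 0 m|%:E * \int[surf R n.+1]_(y in S) h y = \int[leb R n]_(y in L @^-1` S) (h \o L) y)%E.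
Proof.
move=> mh hi; rewrite integralE [RHS]integralE muleBr//; last first.
  by apply: fin_num_adde_defr; exact: integrable_pos_fin_num.
rewrite (funepos_comp h L) (funeneg_comp h L) !ge0_integral_lift_to//.
- exact: measurable_funeneg.
- exact: measurable_funepos.
Qed.

Lemma Rintegral_lift_to (f : 'rV[R]_n.+1 -> R) : measurable_fun setT f ->
  (surf R n.+1).-integrable S (EFin \o f) ->
  `|nu 0 m| * \int[surf R n.+1]_(y in S) f y = \int[leb R n]_(y in L @^-1` S) f (L y).
Proof.
move=> mf fi; rewrite /Rintegral -[`|nu 0 m|]/(fine `|nu 0 m|%:E) -fineM//; last first.
  exact: integrable_fin_num.
by rewrite (@integral_lift_to (EFin \o f))//; exact/measurable_EFinP.
Qed.

End change_of_graph.

(** * The divergence theorem on a set with flat faces *)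

Section flat_divergence.
Context {R : realType} {n : nat}.
Variables (w : set 'rV[R]_n.+1) (I : finType) (P : pred I).
Variables (S : I -> set 'rV[R]_n.+1) (nu : I -> 'rV[R]_n.+1) (c : I -> R).
Variable B : R.
Hypotheses (mw : measurable w) (wB : forall y, w y -> forall j, `|y 0 j| < B).
Hypothesis bdw : boundary w = \bigcup_(i in [set i | P i]) S i.
Hypothesis mS : forall i, P i -> measurable (S i).
Hypothesis Sfin : forall i, P i -> (surf R n.+1 (S i) < +oo)%E.
Hypothesis SB : forall i, P i -> forall y, S i y -> forall j, `|y 0 j| <= B.
Hypothesis SH : forall i, P i -> forall y, S i y -> dotv (nu i) y = c i.
Hypothesis nu1 : forall i, P i -> dotv (nu i) (nu i) = 1.
Hypothesis normal : forall i, P i ->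
  (surf R n.+1).-negligible [set y | S i y /\ ~ outward_unit_normal w y (nu i)].
Hypothesis overlap : forall i j, P i -> P j -> i != j ->
  (surf R n.+1).-negligible (S i `&` S j).
Variable m : 'I_n.+1.

Let Q i := P i && (nu i 0 m != 0).
Let L i := lift_to (nu i) (c i) m.
Let tau i (y : 'rV[R]_n) := (c i - \sum_j nu i 0 (lift m j) * y 0 j) / nu i 0 m.
Let sg i : R := Num.sg (nu i 0 m).

Let LE i y : L i y = ins m (tau i y) y. Proof. by []. Qed.

Let onL i y t : Q i -> S i (ins m t y) -> t = tau i y.
Proof.
move=> /andP[Pi nui] /(SH Pi)/(lift_toE _ _ _ nui).
by move=> /(congr1 (fun v : 'rV[R]_n.+1 => v 0 m)); rewrite !ins_at.
Qed.

Let shadow_negligible i N : Q i -> N `<=` S i -> (surf R n.+1).-negligible N ->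
  (leb R n).-negligible (L i @^-1` N).
Proof.
move=> /andP[Pi nui] NS [A [mA A0 NA]].
exists (L i @^-1` (A `&` S i)); split.
- by apply: measurable_lift_to_preimage; apply: measurableI => //; exact: mS.
- rewrite -(surf_lift_to (c := c i) _ _ (nu1 Pi) nui).
  + rewrite (_ : surf _ _ _ = 0%E) ?mule0//; apply/eqP; rewrite eq_le measure_ge0 andbT.
    rewrite -A0; apply: le_measure; rewrite ?inE//.
    by apply: measurableI => //; exact: mS.
  + by apply: measurableI => //; exact: mS.
  + by move=> y [_ /(SH Pi)].
- by move=> y Ny; split; [exact: NA|exact: NS].
Qed.

Let bad := \bigcup_(ij in [set: I * I]) ([set y | P ij.1 /\ nu ij.1 0 m = 0 /\
    exists t, S ij.1 (ins m t y)] `|`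
  [set y | Q ij.1 /\ S ij.1 (L ij.1 y) /\ ~ outward_unit_normal w (L ij.1 y) (nu ij.1)] `|`
  [set y | Q ij.1 /\ Q ij.2 /\ ij.1 != ij.2 /\ S ij.1 (L ij.1 y) /\ S ij.2 (L ij.1 y)]).

Let bad_negligible : (leb R n).-negligible bad.
Proof.
apply: negligible_bigcup_countType => -[i j] /=.
apply: negligibleU; first apply: negligibleU.
- have [[Pi nui]|h] := pselect (P i /\ nu i 0 m = 0); last first.
    by apply: negligibleS (negligible_set0 _) => y [Pi [nui _]]; apply: h.
  pose nu' : 'rV[R]_n := \row_j nu i 0 (lift m j).
  exists [set y | dotv nu' y = c i]; split.
  + exact: measurable_hyperplane.
  + apply: leb_hyperplane0; left; apply/eqP => nu0.
    have := nu1 Pi; rewrite /dotv (bigD1_ord m)//= nui mul0r add0r big1.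
      by move/eqP; rewrite eq_sym oner_eq0.
    move=> j' _; have := congr1 (fun v : 'rV[R]_n => v 0 j') nu0.
    by rewrite !mxE => ->; rewrite mul0r.
  + move=> y [_ [_ [t /(SH Pi)]]] /=; rewrite dotv_ins nui mul0r add0r => <-.
    by apply: eq_bigr => k _; rewrite mxE.
- have [Qi|h] := pselect (Q i); last first.
    by apply: negligibleS (negligible_set0 _) => y [Qi _]; apply: h.
  apply: negligibleS (shadow_negligible Qi _ (normal (proj1 (andP Qi)))).
    by move=> y [_ []]. by move=> y [].
- have [[Qi [Qj ij]]|h] := pselect (Q i /\ Q j /\ i != j); last first.
    by apply: negligibleS (negligible_set0 _) => y [Qi [Qj [ij _]]]; apply: h.
  apply: negligibleS (shadow_negligible Qi _
    (overlap (proj1 (andP Qi)) (proj1 (andP Qj)) ij)).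
    by move=> y [_ [_ []]]. by move=> y [].
Qed.

Let dotv_ins_shift i (y : 'rV[R]_n) (s t : R) : dotv (ins m s y - ins m t y) (nu i) = (s - t) * nu i 0 m.
Proof. by rewrite dotvBl !(dotvC _ (nu i)) !dotv_ins; ring. Qed.

Let enorm_ins_shift (y : 'rV[R]_n) (s t : R) : enorm (ins m s y - ins m t y) = `|s - t|.
Proof.
rewrite (_ : _ - _ = (s - t) *: delta_mx 0 m) ?enormZ ?enorm_delta ?mulr1//.
apply/rowP => j; rewrite !mxE eqxx /=; have [->|jm] := eqVneq j m.
  by rewrite unlift_none mulr1.
by case: (unliftP m j) jm => [k|] ->; rewrite ?eqxx// subrr mulr0.
Qed.

(** The remaining lines in direction [m] cross the boundary transversally at
    finitely many points, each regular and on exactly one face. *)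
Let line_sums y : ~ bad y ->
  \sum_(i | Q i && (L i y \in S i)) sg i = 0 /\
  slice m w y = (\sum_(i | Q i && (L i y \in S i)) sg i * tau i y)%:E.
Proof.
move=> nbad; apply: crossing_sums.
- exact: measurable_slice.
- move=> i j /andP[Qi /set_mem Si] /andP[Qj /set_mem Sj] tij; apply/eqP/negPn/negP => ij.
  apply: nbad; exists (i, j) => //; right; split=> //; split=> //; split=> //; split=> //=.
  by rewrite LE tij.
- move=> a b ab ncross.
  have [t tab [i /= Pi Si]] : exists2 t, a <= t <= b & (\bigcup_(i in [set i | P i]) S i) (ins m t y).
    rewrite -bdw.
    have seg (u v : R) : w (ins m u y) -> ~ w (ins m v y) ->
        exists2 t, 0 <= t <= 1 & boundary w (ins m (u + t * (v - u)) y).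
      move=> wu wv; have [t t01 bt] := seg_boundary wu wv.
      exists t => //; congr (boundary w _): bt; apply/rowP => j; rewrite !mxE.
      by case: unlift => [k|//]; ring.
    have [wa|nwa] := pselect (w (ins m a y)).
      have nwb : ~ w (ins m b y) by move=> wb; apply: ncross.
      have [t /andP[t0 t1] bt] := seg _ _ wa nwb; exists (a + t * (b - a)) => //.
      by apply/andP; split; nra.
    have wb : w (ins m b y) by apply: contrapT => nwb; apply: ncross.
    have [t /andP[t0 t1] bt] := seg _ _ wb nwa; exists (b + t * (a - b)) => //.
    by apply/andP; split; nra.
  have nui : nu i 0 m != 0.
    by apply/eqP => nui; apply: nbad; exists (i, i) => //; left; left; split=> //=; split=> //; exists t.
  have Qi : Q i by rewrite /Q Pi.
  have tE := onL Qi Si; exists i; last by rewrite -tE.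
  by rewrite Qi/= inE LE -tE.
- move=> i /andP[Qi /set_mem Si]; have /andP[Pi nui] := Qi.
  split; first by rewrite /sg; case: (sgrP (nu i 0 m)) nui; rewrite ?eqxx; [|left|right].
  have [_ out] : outward_unit_normal w (L i y) (nu i).
    by apply: contrapT => no; apply: nbad; exists (i, i) => //; left; right.
  have eta0 : 0 < `|nu i 0 m| / 2 by rewrite divr_gt0 ?normr_gt0.
  have [r r0 rP] := out _ eta0; exists r => // s /andP[s0 sr].
  have sgnu : sg i * nu i 0 m = `|nu i 0 m| by rewrite -normrEsg.
  have sg1 : `|sg i| = 1 by rewrite normr_sg nui.
  have dE (e : R) : `|e| = 1 -> enorm (ins m (tau i y + e * s) y - L i y) = s.
    by move=> e1; rewrite LE enorm_ins_shift addrAC subrr add0r normrM e1 mul1r gtr0_norm.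
  have nup : 0 < `|nu i 0 m| by rewrite normr_gt0.
  split.
    have [+ _] := rP (ins m (tau i y - sg i * s) y) ltac:(by rewrite -mulNr dE ?normrN).
    apply; rewrite -mulNr dE ?normrN// LE dotv_ins_shift addrAC subrr add0r mulrAC mulNr sgnu.
    by rewrite ltr_pM2r//; lra.
  have [_ +] := rP (ins m (tau i y + sg i * s) y) ltac:(by rewrite dE).
  apply; rewrite dE// LE dotv_ins_shift addrAC subrr add0r [ltRHS]mulrAC sgnu.
  by rewrite ltr_pM2r//; lra.
- by exists B => t /= wt; have := wB wt m; rewrite ins_at.
Qed.

(** Since [|nu_m| dS = dy'], the left-hand side is an integral over the lines in
    direction [m]; on almost each of them [crossing_sums] gives [l_m] times the
    length of the slice, and by Cavalieri's principle the slices add up to the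
    volume. *)
Lemma flat_divergence (a : R) (l : 'rV[R]_n.+1) :
  \sum_(i | P i) \int[surf R n.+1]_(y in S i) ((a + dotv l y) * nu i 0 m) =
  l 0 m * fine (leb R n.+1 w).
Proof.
pose g y := a + dotv l y.
have mg : measurable_fun setT g by apply: measurable_funD => //; exact: measurable_dotv.
have intS i (f : 'rV[R]_n.+1 -> R) (C : R) : P i -> measurable_fun setT f ->
    (forall y : 'rV[R]_n.+1, (forall j, `|y 0 j| <= B) -> `|f y| <= C) -> (surf R n.+1).-integrable (S i) (EFin \o f).
  move=> Pi mf fB; apply: (@bounded_integrable _ _ _ _ _ _ C) => //.
  - exact: mS.
  - exact: Sfin.
  - exact: measurable_funTS.
  - by move=> y /(SB Pi); exact: fB.
have gB (y : 'rV[R]_n.+1) : (forall j, `|y 0 j| <= B) -> `|g y| <= `|a| + \sum_j `|l 0 j| * B.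
  move=> yB; rewrite (le_trans (ler_normD _ _))// lerD2l (le_trans (ler_norm_sum _ _ _))//.
  by apply: ler_sum => j _; rewrite normrM ler_wpM2l.
pose G i y := sg i * g (L i y) * \1_(L i @^-1` S i) y.
have intG i : Q i -> (leb R n).-integrable setT (EFin \o G i).
  move=> /andP[Pi nui]; pose f y := sg i * g y.
  have mT : measurable (L i @^-1` S i) by apply: measurable_lift_to_preimage; exact: mS.
  have mf : measurable_fun setT f by exact: measurable_funM.
  apply: (eq_integrable measurableT ((EFin \o f \o L i) \_ (L i @^-1` S i))).
    move=> y _; rewrite patchE /G /= indicE; case: ifPn => _; first by rewrite mulr1.
    by rewrite mulr0.
  apply/(integrable_mkcond _ mT); apply: integrable_lift_to => //.
  - exact: mS.
  - by move=> y /(SH Pi).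
  - exact: nu1.
  - apply: (intS _ _ (`|a| + \sum_j `|l 0 j| * B)) => // y yB; rewrite /f normrM normr_sg nui mul1r.
    exact: gB.
transitivity (\sum_(i | Q i) \int[leb R n]_y G i y).
  rewrite (bigID (fun i => nu i 0 m != 0))/= [X in _ + X]big1 ?addr0; last first.
    move=> i /andP[Pi]; rewrite negbK => /eqP nui.
    rewrite -[RHS](mul0r (fine (surf R n.+1 (S i)))) -Rintegral_cst; last exact: mS.
    by apply: eq_Rintegral => y _; rewrite nui mulr0.
  apply: eq_bigr => i /andP[Pi nui]; pose f y := sg i * g y.
  have mT : measurable (L i @^-1` S i) by apply: measurable_lift_to_preimage; exact: mS.
  have mf : measurable_fun setT f by exact: measurable_funM.
  have fi : (surf R n.+1).-integrable (S i) (EFin \o f).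
    apply: (intS _ _ (`|a| + \sum_j `|l 0 j| * B)) => // y yB; rewrite /f normrM normr_sg nui mul1r.
    exact: gB.
  transitivity (`|nu i 0 m| * \int[surf R n.+1]_(y in S i) f y).
    rewrite -RintegralZl//; last exact: mS.
    by apply: eq_Rintegral => y _; rewrite /f mulrA [_ * sg i]mulrC -numEsg mulrC.
  rewrite (@Rintegral_lift_to _ _ _ (c i) _ _ (mS Pi) _ (nu1 Pi) nui f mf fi); last by move=> y /(SH Pi).
  rewrite Rintegral_mkcond; apply: eq_Rintegral => y _.
  by rewrite patchE /G indicE; case: ifPn => _; rewrite ?mulr1 ?mulr0.
rewrite -Rintegral_sum//.
pose F y := \sum_(i | Q i) G i y.
have FE y : ~ bad y -> F y = l 0 m * fine (slice m w y).
  move=> /line_sums[s0 ->] /=; rewrite /F (bigID (fun i => L i y \in S i))/= [X in _ + X]big1 ?addr0.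
    transitivity (\sum_(i | Q i && (L i y \in S i))
        (sg i * (a + \sum_j l 0 (lift m j) * y 0 j) + l 0 m * (sg i * tau i y))).
      apply: eq_bigr => i /andP[_ Si]; rewrite /G indicE (_ : y \in _) ?mulr1; last first.
        by move: Si; rewrite !inE.
      by rewrite /g LE dotv_ins; ring.
    by rewrite big_split/= -mulr_suml s0 mul0r add0r -mulr_sumr.
  move=> i /andP[_ Si]; rewrite /G indicE (_ : y \in _ = false) ?mulr0//.
  by apply: contraNF Si; rewrite !inE.
have [l0|l0] := eqVneq (l 0 m) 0.
  rewrite l0 mul0r -[RHS](mul0r (fine (leb R n setT))) -Rintegral_cst//.
  by apply: (Rintegral_negligible bad_negligible) => y _ /FE; rewrite l0 mul0r.
have [N [mN N0 badN]] := bad_negligible.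
have iF : (leb R n).-integrable setT (EFin \o F).
  apply: (eq_integrable measurableT (fun x => \sum_(i | Q i) (G i x)%:E)%E).
    by move=> y _; rewrite /= sumEFin.
  exact: integrable_sum.
rewrite (leb_slice m mw) (integral_null (g := fun y => ((l 0 m)^-1 * F y)%:E) mN N0); last first.
  move=> y _ yN; rewrite FE ?mulKf//; last by move=> /badN.
  rewrite fineK// ge0_fin_numE ?slice_ge0//.
  by have [_ ->] := line_sums (contra_not (@badN y) yN); rewrite ltry.
by rewrite -/(Rintegral _ _ _) RintegralZl// mulrA divff// mul1r.
Qed.

End flat_divergence.

(** * Outward normals *)

Section normals.
Context {R : realType} {n : nat}.
Implicit Types (A : set 'rV[R]_n) (x y v nu : 'rV[R]_n).

(** Rays transversal to the tangent hyperplane enter one of the two cones in which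
    membership is known; normals of different sets at a point are compared by
    following a common ray. *)
Lemma normal_ray A y nu v : outward_unit_normal A y nu ->
  (dotv v nu < 0 -> \forall t \near (0:R)^'+, A (y + t *: v)) /\
  (0 < dotv v nu -> \forall t \near (0:R)^'+, ~ A (y + t *: v)).
Proof.
move=> [nu1 out].
have v1 : 0 < enorm v + 1 by rewrite ltr_wpDl ?enorm_ge0.
suff key : dotv v nu != 0 -> \forall t \near (0:R)^'+,
    (t * dotv v nu < 0 -> A (y + t *: v)) /\ (0 < t * dotv v nu -> ~ A (y + t *: v)).
  split=> vnu.
    have /key kn : dotv v nu != 0 by rewrite lt_eqF.
    apply: filterS2 kn (nbhs_right_gt 0) => t [h _] t0.
    by apply: h; rewrite pmulr_rlt0.
  have /key kn : dotv v nu != 0 by rewrite gt_eqF.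
  apply: filterS2 kn (nbhs_right_gt 0) => t [_ h] t0.
  by apply: h; rewrite pmulr_rgt0.
move=> vnu; pose e := `|dotv v nu| / (enorm v + 1).
have e0 : 0 < e by rewrite divr_gt0 ?normr_gt0.
have [r r0 rP] := out (e / 2) ltac:(by rewrite divr_gt0).
have r1 : 0 < r / (enorm v + 1) by rewrite divr_gt0.
near=> t.
have t0 : 0 < t by near: t; exact: nbhs_right_gt.
have tr : t < r / (enorm v + 1) by near: t; exact: nbhs_right_lt.
have := rP (y + t *: v).
rewrite (addrAC y) subrr add0r dotvZl enormZ (gtr0_norm t0) => h.
have {}tr : t * enorm v < r.
  have : t * (enorm v + 1) < r by rewrite -ltr_pdivlMr.
  by rewrite mulrDr mulr1; lra.
have small : e / 2 * (t * enorm v) < `|t * dotv v nu|.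
  rewrite normrM gtr0_norm// mulrCA ltr_pM2l//.
  have -> : `|dotv v nu| = e * (enorm v + 1) by rewrite /e divfK// gt_eqF.
  rewrite -mulrA ltr_pM2l//; have := enorm_ge0 v; lra.
have [h1 h2] := h tr; split=> tv.
  by apply: h1; rewrite ltr0_norm// in small; lra.
by apply: h2; rewrite gtr0_norm// in small.
Unshelve. all: by end_near. Qed.

Lemma outward_unit_normal_uniq A y nu nu' :
  outward_unit_normal A y nu -> outward_unit_normal A y nu' -> nu = nu'.
Proof.
move=> h h'; apply/eqP/negPn/negP => nunu'.
have n1 := enorm1_dotv (proj1 h); have n1' := enorm1_dotv (proj1 h').
have : 0 < dotv (nu' - nu) (nu' - nu).
  rewrite lt_def dotvv_ge0 andbT; apply: contraNN nunu' => /eqP/dotvv_eq0/eqP.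
  by rewrite subr_eq0 eq_sym.
rewrite !(dotvBl, dotvBr) n1 n1' (dotvC nu nu') => d0.
have [A1 _] := normal_ray (nu' - nu) h; have [_ A2] := normal_ray (nu' - nu) h'.
have /A1 {}A1 : dotv (nu' - nu) nu < 0 by rewrite dotvBl n1; lra.
have /A2 {}A2 : 0 < dotv (nu' - nu) nu' by rewrite dotvBl n1' (dotvC nu nu'); lra.
by have [t []] := filter_ex (filterI A1 A2).
Qed.

Lemma normal_fieldE A y nu : outward_unit_normal A y nu -> normal_field A y = nu.
Proof.
move=> h; apply: (@outward_unit_normal_uniq A y) => //.
exact: (@xgetPex _ 0 [set nu | outward_unit_normal A y nu] (ex_intro _ nu h)).
Qed.

Lemma boundary_closed A : closed (boundary A).
Proof.
rewrite /boundary setDE; apply: closedI; first exact: closed_closure.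
by rewrite closedC; exact: open_interior.
Qed.

Lemma boundary_closure A : boundary A `<=` closure A.
Proof. by move=> x []. Qed.

Lemma boundary_measurable A : measurable (boundary A).
Proof. by apply: rV_closed_measurable; exact: boundary_closed. Qed.

Lemma openball_enorm (U : set 'rV[R]_n) y : open U -> U y ->
  exists2 r : R, 0 < r & forall z, enorm (z - y) < r -> U z.
Proof.
move=> oU Uy; have /nbhs_ballP[r /= r0 rU] := oU _ Uy.
exists r => // z zr; apply: rU; rewrite -ball_normE /ball_/=.
by rewrite distrC (le_lt_trans (rV_norm_le_enorm _)).
Qed.

Lemma closure_bounded A : bounded_set A -> exists2 B : R, 0 < B &
  forall y, closure A y -> `|y| <= B.
Proof.
move=> [B0 [_ /(_ (Num.max B0 0 + 1))]].
rewrite (le_lt_trans (y := Num.max B0 0)) ?le_max ?lexx// ?ltrDl// => /(_ isT) OB.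
exists (Num.max B0 0 + 1); first by rewrite ltr_wpDl// le_max lexx orbT.
have /closure_id cB : closed [set z : 'rV[R]_n | `|z| <= Num.max B0 0 + 1].
  apply: (@closed_comp _ _ (fun z : 'rV[R]_n => `|z|) [set x | x <= Num.max B0 0 + 1]).
    by move=> z _; exact: norm_continuous.
  exact: closed_le.
move=> y Oy; suff : closure [set z : 'rV[R]_n | `|z| <= Num.max B0 0 + 1] y by rewrite -cB.
exact: closureS OB _ Oy.
Qed.

(** The tangent hyperplane cuts a small ball into two halves without boundary
    points of [w], each of which is inside or outside [w]. The outer half contains
    points outside [Om], hence is outside [w]; as [y] is in the closure of [w], the
    inner half is inside. *)
Lemma cell_normal (w Om : set 'rV[R]_n) y nu (r : R) : open w -> w `<=` Om ->
  outward_unit_normal Om y nu -> closure w y -> 0 < r ->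
  (forall z, enorm (z - y) < r -> boundary w z -> dotv nu z = dotv nu y) ->
  outward_unit_normal w y nu.
Proof.
move=> ow wOm nuOm cwy r0 bd.
have n1 := enorm1_dotv (proj1 nuOm).
have side z z' : enorm (z - y) < r -> enorm (z' - y) < r ->
    0 < dotv (z - y) nu * dotv (z' - y) nu -> w z -> w z'.
  move=> zr z'r zz' wz; apply: contrapT => nwz'.
  have [t /andP[t0 t1] bt] := seg_boundary wz nwz'.
  have : dotv nu (z + t *: (z' - z)) = dotv nu y.
    apply: bd bt; rewrite (_ : _ - y = (1 - t) *: (z - y) + t *: (z' - y)); last first.
      by apply/rowP => j; rewrite !mxE; ring.
    rewrite (le_lt_trans (enormD _ _))// !enormZ !ger0_norm ?subr_ge0//.
    have [->|t0'] := eqVneq t 0; first by rewrite mul0r addr0 subr0 mul1r.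
    have tp : 0 < t by rewrite lt_def t0'.
    have : (1 - t) * enorm (z - y) <= (1 - t) * r by rewrite ler_wpM2l ?subr_ge0// ltW.
    have : t * enorm (z' - y) < t * r by rewrite ltr_pM2l.
    lra.
  rewrite dotvDr dotvZr dotvBr; move: zz'; rewrite !dotvBl !(dotvC _ nu).
  set a := dotv nu z; set b := dotv nu z'; set e := dotv nu y => zz' te.
  have : (1 - t) * ((a - e) * (a - e)) + t * ((a - e) * (b - e)) = 0.
    rewrite (_ : _ + _ = (a - e) * (a + t * (b - a) - e)); last by ring.
    by rewrite te subrr mulr0.
  have ae : 0 < (a - e) * (a - e).
    by rewrite -expr2 lt_def sqr_ge0 sqrf_eq0 andbT; apply: contraTneq zz' => ->; rewrite mul0r ltxx.
  have : 0 <= (1 - t) * ((a - e) * (a - e)) by rewrite mulr_ge0 ?subr_ge0// ltW.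
  have : 0 <= t * ((a - e) * (b - e)) by rewrite mulr_ge0// ltW.
  have [->|t0'] := eqVneq t 0; first by lra.
  have : 0 < t * ((a - e) * (b - e)) by rewrite mulr_gt0// lt_def t0'.
  lra.
have upper z : enorm (z - y) < r -> 0 < dotv (z - y) nu -> ~ w z.
  move=> zr znu wz.
  have [_ /(_ ltac:(by rewrite n1 ltr01)) out] := normal_ray nu nuOm.
  have [t [[t0 tr] /=]] := filter_ex (filterI (filterI (@nbhs_right_gt R 0) (nbhs_right_lt r0)) out).
  apply; apply: wOm; apply: (side z) => //.
    by rewrite addrAC subrr add0r enormZ (proj1 nuOm) mulr1 gtr0_norm.
  by rewrite addrAC subrr add0r dotvZl n1 mulr1 mulr_gt0.
have [z0 [wz0 z0r z0nu]] : exists z, [/\ w z, enorm (z - y) < r & dotv (z - y) nu < 0].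
  have [z [wz zr]] : w `&` [set z | enorm (z - y) < r] !=set0.
    apply: cwy; apply/nbhs_ballP; exists (r / (n%:R + 1)) => /=.
      by rewrite divr_gt0// ltr_wpDl.
    move=> z; rewrite -ball_normE /ball_/= => zr; rewrite enormBC.
    rewrite (le_lt_trans (enorm_le_norm _))//.
    rewrite ltr_pdivlMr ?ltr_wpDl// in zr; rewrite (le_lt_trans _ zr)// mulrC ler_wpM2l//.
    by rewrite lerDl.
  have [zlt|zgt|zeq] := ltgtP (dotv (z - y) nu) 0.
  - by exists z.
  - by have := upper z zr zgt.
  have [s s0 sw] := openball_enorm ow wz.
  pose t := Num.min s (r - enorm (z - y)) / 2.
  have t0 : 0 < t by rewrite divr_gt0// lt_min s0 subr_gt0.
  have ts : t < s.
    by rewrite /t ltr_pdivrMr// (le_lt_trans (y := s)) ?ge_min ?lexx//; lra.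
  have tr : t < r - enorm (z - y).
    rewrite /t ltr_pdivrMr// (le_lt_trans (y := r - enorm (z - y))) ?ge_min ?lexx ?orbT//.
    by move: zr => /=; lra.
  exists (z - t *: nu); split.
  - by apply: sw; rewrite addrAC subrr add0r enormN enormZ (proj1 nuOm) mulr1 gtr0_norm.
  - rewrite addrAC (le_lt_trans (enormD _ _))// enormN enormZ (proj1 nuOm) mulr1 gtr0_norm//; lra.
  - by rewrite addrAC dotvBl zeq dotvZl n1 mulr1 sub0r oppr_lt0.
split; first exact: (proj1 nuOm).
move=> e e0; exists r => // z zr; split=> ze.
  have zneg : dotv (z - y) nu < 0.
    by rewrite (lt_le_trans ze)// mulNr oppr_le0 mulr_ge0 ?enorm_ge0// ltW.
  by apply: (side z0) => //; rewrite nmulr_rgt0.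
apply: upper => //; apply: le_lt_trans ze.
by rewrite mulr_ge0 ?enorm_ge0// ltW.
Qed.

End normals.

(** * The faces of a dual cell *)

Section faces.
Context {R : realType} {n : nat} (Omega : set 'rV[R]_n.+1) (M : pd_mesh R n.+1).
Hypothesis bOmega : bounded_set Omega.
Hypothesis hM : is_mesh Omega M.
Implicit Types i j k : 'I_(npts M).

Lemma cell_open i : open (cell i).
Proof. by have [_ _ [/(_ i)[]]] := hM. Qed.

Lemma cell_sub i : cell i `<=` Omega.
Proof. by have [_ _ [/(_ i)[]]] := hM. Qed.

Lemma dfaceC i j : dface i j = dface j i.
Proof. by rewrite /dface setIC. Qed.

Lemma adj_sym i j : adj i j = adj j i.
Proof. by have [_ _ _ [/(_ i j)]] := hM. Qed.

Lemma dnormalC i j : adj i j -> dnormal i j = - dnormal j i.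
Proof. by move=> ij; have [_ _ _ [_ _ /(_ i j ij)[]]] := hM. Qed.

Lemma dface_flat i j : adj i j -> flat_face (cell i) (dface i j) (dnormal i j).
Proof. by move=> ij; have [_ _ _ [_ _ /(_ i j ij)[]]] := hM. Qed.

Lemma bface_flat i : i \in bdry M -> flat_face Omega (bface Omega i) (bnormal i).
Proof. by move=> ib; have [_ [_ _ /(_ i ib)]] := hM. Qed.

Lemma dface_closed i j : closed (dface i j).
Proof. by apply: closedI; exact: boundary_closed. Qed.

Lemma bface_closed i : closed (bface Omega i).
Proof. by apply: closedI; exact: boundary_closed. Qed.

Lemma closure_cell i : closure (cell i) `<=` closure Omega.
Proof. by apply: closureS; exact: cell_sub. Qed.

Lemma dface_sub i j : dface i j `<=` closure Omega.
Proof. by move=> y [/boundary_closure + _]; exact: closure_cell. Qed.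

Lemma bface_sub i : bface Omega i `<=` closure Omega.
Proof. by move=> y [/boundary_closure + _]; exact: closure_cell. Qed.

Lemma flat_face_fin (A S : set 'rV[R]_n.+1) nu : flat_face A S nu -> (surf R n.+1 S < +oo)%E.
Proof.
move=> [S0 _ _]; rewrite ltey; apply: contraTneq S0 => ->.
by rewrite /= ltxx.
Qed.

Lemma flat_face_unit (A S : set 'rV[R]_n.+1) nu : measurable S -> flat_face A S nu -> enorm nu = 1.
Proof.
move=> mS [S0 _ neg]; apply: contrapT => nu1.
have : (surf R n.+1).-negligible S.
  by apply: negligibleS neg => y Sy; split=> // -[].
by move=> /(measure_negligible mS) SE; rewrite SE ltxx in S0.
Qed.

(** At a common regular point both neighbours would lie on the same side of the
    same hyperplane, although cells are disjoint. *)
Lemma dface_overlap i j k : adj i j -> adj i k -> j != k ->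
  (surf R n.+1).-negligible (dface i j `&` dface i k).
Proof.
move=> ij ik jk.
have [_ _ nij] := dface_flat ij; have [_ _ nik] := dface_flat ik.
have ji : adj j i by rewrite adj_sym. have ki : adj k i by rewrite adj_sym.
have [_ _ nji] := dface_flat ji; have [_ _ nki] := dface_flat ki.
apply: negligibleS (negligibleU (negligibleU nij nik) (negligibleU nji nki)) => y [yj yk].
apply: contrapT => /not_orP[/not_orP[h1 h2] /not_orP[h3 h4]].
have {}h1 : outward_unit_normal (cell i) y (dnormal i j) by apply: contrapT => h; apply: h1.
have {}h2 : outward_unit_normal (cell i) y (dnormal i k) by apply: contrapT => h; apply: h2.
have {}h3 : outward_unit_normal (cell j) y (dnormal j i).
  by apply: contrapT => h; apply: h3; split=> //; rewrite dfaceC.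
have {}h4 : outward_unit_normal (cell k) y (dnormal k i).
  by apply: contrapT => h; apply: h4; split=> //; rewrite dfaceC.
have E : dnormal j i = dnormal k i.
  by rewrite (dnormalC ji) (dnormalC ki) (outward_unit_normal_uniq h1 h2).
have lt0 : dotv (- dnormal j i) (dnormal j i) < 0.
  by rewrite dotvNl (enorm1_dotv (proj1 h3)) oppr_lt0.
have [/(_ lt0) nj _] := normal_ray (- dnormal j i) h3.
have [+ _] := normal_ray (- dnormal j i) h4; rewrite -E => /(_ lt0) nk.
have [t [cj ck]] := filter_ex (filterI nj nk).
have [_ _ [_ _ /(_ j k jk) + _] _] := hM.
by move=> /seteqP[/(_ (y + t *: - dnormal j i)) + _]; apply.
Qed.

(** At a common regular point the two cells would fill both sides of a hyperplane,
    whereas one side of the tangent hyperplane of the domain is outside. *)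
Lemma bface_overlap i j : adj i j -> i \in bdry M ->
  (surf R n.+1).-negligible (dface i j `&` bface Omega i).
Proof.
move=> ij ib.
have [_ _ nij] := dface_flat ij; have [_ _ nb] := bface_flat ib.
have ji : adj j i by rewrite adj_sym.
have [_ _ nji] := dface_flat ji.
apply: negligibleS (negligibleU (negligibleU nij nji) nb) => y [yj yb].
apply: contrapT => /not_orP[/not_orP[h1 h2] h3].
have {}h1 : outward_unit_normal (cell i) y (dnormal i j) by apply: contrapT => h; apply: h1.
have {}h2 : outward_unit_normal (cell j) y (dnormal j i).
  by apply: contrapT => h; apply: h2; split=> //; rewrite dfaceC.
have {}h3 : outward_unit_normal Omega y (bnormal i) by apply: contrapT => h; apply: h3.
have n1 := enorm1_dotv (proj1 h1); have b1 := enorm1_dotv (proj1 h3).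
have [v [vb vn]] : exists v, 0 < dotv v (bnormal i) /\ dotv v (dnormal i j) != 0.
  have [b0|b0] := eqVneq (dotv (bnormal i) (dnormal i j)) 0.
    exists (bnormal i + dnormal i j); rewrite !dotvDl b1 n1 b0 add0r.
    by rewrite (dotvC (dnormal i j)) b0 addr0 ltr01 oner_eq0.
  by exists (bnormal i); rewrite b1 ltr01.
have [_ /(_ vb) out] := normal_ray v h3.
have [vlt|vgt|/eqP] := ltgtP (dotv v (dnormal i j)) 0; last by rewrite (negbTE vn).
  have [/(_ vlt) ci _] := normal_ray v h1.
  by have [t [no /(@cell_sub i)]] := filter_ex (filterI out ci).
have [cj _] := normal_ray v h2.
rewrite (dnormalC ji) dotvNr oppr_lt0 in cj; have {}cj := cj vgt.
by have [t [no /(@cell_sub j)]] := filter_ex (filterI out cj).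
Qed.

(** The normal is only given for the domain. Off the dual faces, however, the
    boundary of the cell is locally a part of the supporting hyperplane of the
    boundary face, so that [cell_normal] transfers the normal to the cell. *)
Lemma bface_cell_normal i : i \in bdry M -> (surf R n.+1).-negligible
  [set y | bface Omega i y /\ ~ outward_unit_normal (cell i) y (bnormal i)].
Proof.
move=> ib; have [_ [c bc] nb] := bface_flat ib.
have ov : (surf R n.+1).-negligible (\bigcup_j [set y | adj i j /\ (dface i j `&` bface Omega i) y]).
  apply: negligible_bigcup_countType => j.
  have [ij|ij] := boolP (adj i j); last by apply: negligibleS (negligible_set0 _) => y [].
  by apply: negligibleS (bface_overlap ij ib) => y [].
apply: negligibleS (negligibleU nb ov) => y [yb nny].
have [ny|ny] := pselect (outward_unit_normal Omega y (bnormal i)); last by left.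
right; apply: contrapT => ynov.
have noface j : adj i j -> ~ dface i j y by move=> ij yj; apply: ynov; exists j.
pose F := \bigcup_(j in [set j | adj i j]) dface i j.
have cF : closed F.
  by apply: closed_bigcup => [|j _]; [exact: finite_finset|exact: dface_closed].
have yF : (~` F) y by move=> [j ij]; exact: noface.
have [r r0 rP] := openball_enorm (closed_openC cF) yF.
apply: nny; apply: (@cell_normal _ _ (cell i) Omega y (bnormal i) r) => //; first exact: cell_open.
- exact: cell_sub.
- by have [/boundary_closure] := yb.
move=> z zr bz; rewrite (bc y yb); apply: bc.
have [_ _ _ [_ _ _ /(_ i)]] := hM; rewrite ib => bE; move: bz; rewrite bE => -[|//].
by move=> /(rP _ zr).
Qed.

(** The dual faces and the possible boundary face satisfy the hypotheses of
    [flat_divergence], which is summed over the axes. *)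
Lemma cell_divergence i (a : 'I_n.+1 -> R) (l : 'I_n.+1 -> 'rV[R]_n.+1)
    (p := fun y => \row_m (a m + dotv (l m) y)) :
  \sum_(j | adj i j) \int[surf R n.+1]_(y in dface i j) dotv (p y) (dnormal i j)
  + (if i \in bdry M then \int[surf R n.+1]_(y in bface Omega i) dotv (p y) (bnormal i) else 0)
  = (\sum_m l m 0 m) * vol i.
Proof.
(* [inr tt] stands for the boundary face *)
pose I : finType := ('I_(npts M) + unit)%type.
pose P (o : I) := match o with inl j => adj i j | inr _ => i \in bdry M end.
pose S (o : I) := match o with inl j => dface i j | inr _ => bface Omega i end.
pose nu (o : I) := match o with inl j => dnormal i j | inr _ => bnormal i end.
have [B B0 BP] := closure_bounded bOmega.
have mS o : measurable (S o).
  by case: o => [j|[]]; apply: rV_closed_measurable; [exact: dface_closed|exact: bface_closed].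
have Sfin o : P o -> (surf R n.+1 (S o) < +oo)%E.
  by case: o => [j|[]] /= Po; [exact: flat_face_fin (dface_flat Po)|exact: flat_face_fin (bface_flat Po)].
have SB o : P o -> forall y, S o y -> forall q : 'I_n.+1, `|y 0 q| <= B.
  move=> _ y Sy j; apply: le_trans (coord_le_norm y j) (BP _ _).
  by case: o Sy => [k|[]]; [exact: dface_sub|exact: bface_sub].
have /boolp.choice[c SH] : forall o, exists c : R, P o -> forall y, S o y -> dotv (nu o) y = c.
  move=> o; have [Po|nPo] := boolP (P o); last by exists 0.
  by case: o Po => [j|[]] /= Po; [have [_ [c]] := dface_flat Po|have [_ [c]] := bface_flat Po]; exists c.
have nu1 o : P o -> dotv (nu o) (nu o) = 1.
  move=> Po; apply: enorm1_dotv; case: o Po (mS o) => [j|[]] /= Po mSo.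
    exact: flat_face_unit (dface_flat Po).
  exact: flat_face_unit (bface_flat Po).
have normal o : P o -> (surf R n.+1).-negligible
    [set y | S o y /\ ~ outward_unit_normal (cell i) y (nu o)].
  by case: o => [j|[]] /= Po; [have [] := dface_flat Po|exact: bface_cell_normal].
have overlap o o' : P o -> P o' -> o != o' -> (surf R n.+1).-negligible (S o `&` S o').
  case: o o' => [j|[]] [k|[]] //= Po Po' oo'.
  - exact: dface_overlap.
  - exact: bface_overlap.
  - by rewrite setIC; exact: bface_overlap.
have bdw : boundary (cell i) = \bigcup_(o in [set o | P o]) S o.
  have [_ _ _ [_ _ _ ->]] := hM; apply/seteqP; split=> [y [[j ij yj]|]|y [[j|[]] /= Po yo]].
  - by exists (inl j).
  - by case: ifPn => // ib yb; exists (inr tt).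
  - by left; exists j.
  - by right; rewrite Po.
have wB y : cell i y -> forall q : 'I_n.+1, `|y 0 q| < B + 1.
  move=> wy j; rewrite ltr_pwDr// (le_trans (coord_le_norm y j))// BP//.
  by apply: subset_closure; exact: cell_sub wy.
have div m : \sum_(o | P o) \int[surf R n.+1]_(y in S o) ((a m + dotv (l m) y) * nu o 0 m)
    = l m 0 m * vol i.
  apply: (flat_divergence (B := B + 1) (c := c)) => //.
  - by apply: rV_open_measurable; exact: cell_open.
  - by move=> o Po y Sy j; rewrite (le_trans (SB o Po y Sy j))// lerDl.
transitivity (\sum_(o | P o) \int[surf R n.+1]_(y in S o) dotv (p y) (nu o)).
  rewrite big_sumType/=; congr (_ + _); rewrite [RHS]big_mkcond/= (big_pred1 tt)//; by case.
rewrite mulr_suml -(eq_bigr _ (fun m _ => div m)) exchange_big/=.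
apply: eq_bigr => o Po; rewrite -Rintegral_sum//; last first.
  move=> m _; apply: (@bounded_integrable _ _ _ _ _ _ ((`|a m| + \sum_q `|l m 0 q| * B) * `|nu o 0 m|)) => //.
  - exact: Sfin.
  - apply: measurable_funTS; apply: measurable_funM => //; apply: measurable_funD => //.
    exact: measurable_dotv.
  - move=> y /(SB _ Po) yB; rewrite normrM ler_wpM2r// (le_trans (ler_normD _ _))// lerD2l.
    rewrite (le_trans (ler_norm_sum _ _ _))//.
    by apply: ler_sum => j _; rewrite normrM ler_wpM2l.
by apply: eq_Rintegral => y _; apply: eq_bigr => m _; rewrite mxE.
Qed.

End faces.

(** * Moving least squares *)

Lemma dotv_sumr (R : realType) (d : nat) (I : Type) (r : seq I) (P : pred I)
    (v : 'rV[R]_d) (F : I -> 'rV[R]_d) :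
  dotv v (\sum_(i <- r | P i) F i) = \sum_(i <- r | P i) dotv v (F i).
Proof.
apply: (big_morph (dotv v)) => [x y|]; first exact: dotvDr.
by rewrite dotvC dotv0l.
Qed.

Section affine_integrals.
Context {R : realType} {d : nat}.
Implicit Types (f g : 'rV[R]_d -> R) (S : set 'rV[R]_d).

Lemma affine_polyD f g : affine_poly f -> affine_poly g -> affine_poly (fun y => f y + g y).
Proof.
move=> [a [l fE]] [a' [l' gE]]; exists (a + a'), (l + l') => y.
by rewrite fE gE dotvDl; ring.
Qed.

Lemma affine_polyZ c f : affine_poly f -> affine_poly (fun y => c * f y).
Proof. by move=> [a [l fE]]; exists (c * a), (c *: l) => y; rewrite fE dotvZl mulrDr. Qed.

Lemma affine_poly0 : affine_poly (fun _ : 'rV[R]_d => 0).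
Proof. by exists 0, 0 => y; rewrite dotv0l addr0. Qed.

Lemma affine_poly_sum (I : Type) (r : seq I) (P : pred I) (F : I -> 'rV[R]_d -> R) :
  (forall i, affine_poly (F i)) -> affine_poly (fun y => \sum_(i <- r | P i) F i y).
Proof.
move=> FA; elim: r => [|i r [a [l IH]]].
  by have [a [l E]] := affine_poly0; exists a, l => y; rewrite big_nil.
have [Pi|Pi] := boolP (P i); last by exists a, l => y; rewrite big_cons (negbTE Pi).
have [b [m E]] := affine_polyD (FA i) (ex_intro _ a (ex_intro _ l IH)).
by exists b, m => y; rewrite big_cons Pi.
Qed.

Lemma integral_affine_poly S f (B : R) : measurable S -> 0 < area S ->
  (forall y, S y -> `|y| <= B) -> affine_poly f ->
  \int[surf R d]_(y in S) f y = area S * f (centroid S).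
Proof.
move=> mS S0 SB [a [l fE]].
have Sfin : (surf R d S < +oo)%E.
  by rewrite ltey; apply: contraTneq S0 => SE; rewrite /area SE /= ltxx.
have ic i : (surf R d).-integrable S (EFin \o (fun y : 'rV[R]_d => y 0 i)).
  apply: (@bounded_integrable _ _ _ _ _ _ B) => //.
    by apply: measurable_funTS; exact: measurable_coord.
  by move=> y /SB; apply: le_trans; exact: coord_le_norm.
have il i : (surf R d).-integrable S (EFin \o (fun y : 'rV[R]_d => l 0 i * y 0 i)).
  apply: (@bounded_integrable _ _ _ _ _ _ (`|l 0 i| * B)) => //.
    by apply: measurable_funTS; apply: measurable_funM => //; exact: measurable_coord.
  by move=> y /SB yB; rewrite normrM ler_wpM2l// (le_trans (coord_le_norm y i)).
have ia : (surf R d).-integrable S (EFin \o (fun=> a)).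
  by apply: (@bounded_integrable _ _ _ _ _ _ `|a|).
have isum : (surf R d).-integrable S (EFin \o (fun y : 'rV[R]_d => \sum_i l 0 i * y 0 i)).
  apply: (eq_integrable mS (fun y : 'rV[R]_d => \sum_i (l 0 i * y 0 i)%:E)%E).
    by move=> y _; rewrite /= sumEFin.
  by apply: integrable_sum => // i _; exact: il.
transitivity (\int[surf R d]_(y in S) (a + \sum_i l 0 i * y 0 i)).
  by apply: eq_Rintegral => y _; rewrite fE.
rewrite RintegralD// Rintegral_cst// Rintegral_sum// fE mulrDr [a * _]mulrC; congr (_ + _).
rewrite /dotv mulr_sumr; apply: eq_bigr => i _; rewrite RintegralZl// mxE.
by rewrite -/(area S) mulrCA [area S * _]mulrA divff ?mul1r// gt_eqF.
Qed.

End affine_integrals.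

Section vector_basis.
Context {R : realType} {d : nat} (phi : 'I_d.+1 -> 'rV[R]_d -> R).
Implicit Types (b : 'rV[R]_(d * d.+1)) (y : 'rV[R]_d).

Let lt_quo (s : 'I_(d * d.+1)) : (s %/ d.+1 < d)%N.
Proof. by rewrite ltn_divLR. Qed.

Let lt_idx (k : 'I_d) (r : 'I_d.+1) : (k * d.+1 + r < d * d.+1)%N.
Proof.
have := ltn_ord k; have := ltn_ord r => rd kd.
by rewrite (leq_trans (n := k.+1 * d.+1))// ?leq_mul2r ?kd ?orbT// mulSn addnC ltn_add2r.
Qed.

Let quo (s : 'I_(d * d.+1)) : 'I_d := Ordinal (lt_quo s).
Let rem (s : 'I_(d * d.+1)) : 'I_d.+1 := inord (s %% d.+1).
Let idx k r : 'I_(d * d.+1) := Ordinal (lt_idx k r).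

Let quo_idx k r : quo (idx k r) = k.
Proof. by apply/ord_inj; rewrite /= divnMDl// divn_small ?addn0. Qed.

Let rem_idx k r : rem (idx k r) = r.
Proof. by apply/ord_inj; rewrite /= inordK ?ltn_mod// modnMDl modn_small. Qed.

Let idx_quo s : idx (quo s) (rem s) = s.
Proof. by apply/ord_inj; rewrite /= inordK ?ltn_mod// -divn_eq. Qed.

Lemma vbasis_funE s y k : vbasis_fun phi s y 0 k = if k == quo s then phi (rem s) y else 0.
Proof. by rewrite mxE. Qed.

Lemma field_ofE b y k : field_of phi b y 0 k = \sum_r b 0 (idx k r) * phi r y.
Proof.
rewrite /field_of summxE (bigID (fun s => k == quo s))/= [X in _ + X]big1 ?addr0; last first.
  by move=> s ks; rewrite mxE vbasis_funE (negbTE ks) mulr0.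
rewrite (reindex_onto (idx k) rem) /=; last by move=> s /eqP ->; exact: idx_quo.
apply: eq_big => [r|r _]; first by rewrite quo_idx rem_idx !eqxx.
by rewrite mxE vbasis_funE quo_idx eqxx rem_idx.
Qed.

Lemma field_ofB b b' y : field_of phi (b - b') y = field_of phi b y - field_of phi b' y.
Proof.
apply/rowP => k; rewrite !mxE !field_ofE -sumrB; apply: eq_bigr => r _.
by rewrite !mxE mulrBl.
Qed.

Hypothesis phiP : P1_basis phi.

Lemma vbasis_affine s k : affine_poly (fun y => vbasis_fun phi s y 0 k).
Proof.
have [phiA _] := phiP; have [a [l E]] : affine_poly (fun y => if k == quo s then phi (rem s) y else 0).
  by case: eqP => _; [exact: phiA|exact: affine_poly0].
by exists a, l => y; rewrite vbasis_funE.
Qed.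

Lemma field_of_affine b k : affine_poly (fun y => field_of phi b y 0 k).
Proof.
have [phiA _] := phiP.
have [a [l E]] := @affine_poly_sum R d _ (index_enum 'I_d.+1) xpredT
  (fun r y => b 0 (idx k r) * phi r y) (fun r => affine_polyZ _ (phiA r)).
by exists a, l => y; rewrite field_ofE.
Qed.

Lemma field_of_eq0 b : (forall y, field_of phi b y = 0) -> b = 0.
Proof.
move=> b0; apply/rowP => s; rewrite mxE -(idx_quo s).
have [_ /(_ _ (@affine_poly0 R d))[c [_ cU]]] := phiP.
have cE (k : 'I_d) : c = \row_r b 0 (idx k r).
  apply: cU => y; transitivity (field_of phi b y 0 k); first by rewrite b0 mxE.
  by rewrite field_ofE; apply: eq_bigr => r _; rewrite mxE.
have c0 : c = 0 by apply: cU => y; rewrite big1// => r _; rewrite mxE mul0r.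
have := congr1 (fun v : 'rV[R]_d.+1 => v 0 (rem s)) (cE (quo s)).
by rewrite c0 !mxE => <-.
Qed.

Lemma field_of_surj (p : 'rV[R]_d -> 'rV[R]_d) :
  (forall k, affine_poly (fun y => p y 0 k)) -> exists b, forall y, field_of phi b y = p y.
Proof.
move=> pA.
have /boolp.choice[c cP] : forall k, exists c : 'rV[R]_d.+1, forall y, p y 0 k = \sum_r c 0 r * phi r y.
  by move=> k; have [_ /(_ _ (pA k))[c [cE _]]] := phiP; exists c.
exists (\row_s c (quo s) 0 (rem s)) => y; apply/rowP => k; rewrite field_ofE cP.
by apply: eq_bigr => r _; rewrite mxE quo_idx rem_idx.
Qed.

End vector_basis.

Section least_squares.
Context {R : realType} {d : nat} (Omega : set 'rV[R]_d) (M : pd_mesh R d).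
Variables (eps : R) (phi : 'I_d.+1 -> 'rV[R]_d -> R).
Hypothesis hg : is_gmls Omega M eps phi.
Variable S : set 'rV[R]_d.
Hypothesis hS : gmls_face Omega M S.
Implicit Types (k : 'I_(npts M)) (b q : 'rV[R]_(d * d.+1)) (uh : 'I_(npts M) -> 'rV[R]_d).

Let weight k := kappa eps (enorm (centroid S - pt k)).
Let sample k : 'M[R]_(d * d.+1, d) := \matrix_(s, m) vbasis_fun phi s (pt k) 0 m.

Let field_sample b k : field_of phi b (pt k) = b *m sample k.
Proof.
apply/rowP => m; rewrite /field_of summxE mxE; apply: eq_bigr => s _.
by rewrite !mxE.
Qed.

Let gram : 'M[R]_(d * d.+1) := \sum_(k | k \notin gam M) weight k *: (sample k *m (sample k)^T).
Let rhs uh : 'rV[R]_(d * d.+1) := \sum_(k | k \notin gam M) weight k *: (uh k *m (sample k)^T).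

Let weight_ge0 k : 0 <= weight k.
Proof. by rewrite /weight /kappa exprn_ge0// le_max lexx. Qed.

Let weight_gt0 k : enorm (pt k - centroid S) < eps -> 0 < weight k.
Proof.
have [eps0 _ _] := hg; rewrite enormBC => ke.
by rewrite /weight /kappa exprn_gt0// lt_max subr_gt0 ltr_pdivrMr// mul1r ke orbT.
Qed.

Let dotv_mx m (v w : 'rV[R]_m) : dotv v w = (v *m w^T) 0 0.
Proof. by rewrite mxE; apply: eq_bigr => i _; rewrite mxE. Qed.

Let energy b := \sum_(k | k \notin gam M) weight k * enorm (b *m sample k) ^+ 2.

Let energy_ge0 b : 0 <= energy b.
Proof. by apply: sumr_ge0 => k _; rewrite mulr_ge0// exprn_ge0// enorm_ge0. Qed.

(** The weights are positive within distance [eps], so a field without energy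
    vanishes at the points there, hence everywhere by unisolvency. *)
Let energy_eq0 b : energy b <= 0 -> b = 0.
Proof.
move=> b0; have [eps0 phiP uni] := hg.
apply: (field_of_eq0 phiP) => y; apply/rowP => m; rewrite [RHS]mxE.
apply: (uni S hS _ (field_of_affine phiP b m)) => k kg ke.
have /eqP : energy b = 0 by apply/eqP; rewrite eq_le b0 energy_ge0.
rewrite psumr_eq0; last by move=> i _; rewrite mulr_ge0// exprn_ge0// enorm_ge0.
move=> /allP/(_ k (mem_index_enum _)); rewrite kg /= mulf_eq0 gt_eqF ?weight_gt0//=.
rewrite enorm_sqr => /eqP/dotvv_eq0; rewrite -field_sample => ->.
by rewrite mxE.
Qed.

Let dotv_adjoint m p (v : 'rV[R]_m) (w : 'rV[R]_p) (A : 'M[R]_(m, p)) :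
  dotv (v *m A) w = dotv v (w *m A^T).
Proof. by rewrite !dotv_mx trmx_mul trmxK mulmxA. Qed.

Let energyE b : energy b = dotv b (b *m gram).
Proof.
rewrite /energy /gram mulmx_sumr dotv_sumr; apply: eq_bigr => k _.
by rewrite enorm_sqr dotv_adjoint -scalemxAr dotvZr mulmxA.
Qed.

Let gram_unit : gram \in unitmx.
Proof.
rewrite unitmxE unitfE; apply/det0P => -[v v0 vG].
by move: v0; rewrite (energy_eq0 (b := v)) ?eqxx// energyE vG dotvC dotv0l.
Qed.

Let ls_shift uh b e : b *m gram = rhs uh ->
  ls_functional eps phi S uh (b + e) = ls_functional eps phi S uh b + 2^-1 * energy e.
Proof.
move=> bE; rewrite /ls_functional -mulrDr; congr (_ * _).
transitivity (\sum_(k | k \notin gam M) (weight k * enorm (field_of phi b (pt k) - uh k) ^+ 2 +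
    weight k * enorm (e *m sample k) ^+ 2 +
    2 * (weight k * dotv (e *m sample k) (b *m sample k - uh k)))).
  apply: eq_bigr => k _; rewrite !field_sample mulmxDl addrAC -/(weight k) !enorm_sqr.
  move: (b *m _ - _) (e *m _) => x z.
  by rewrite dotvDl !dotvDr (dotvC x z); ring.
rewrite !big_split/= -[RHS]addr0; congr (_ + _); rewrite -mulr_sumr.
transitivity (2 * dotv e (b *m gram - rhs uh)); last by rewrite bE subrr dotvC dotv0l mulr0.
congr (_ * _); rewrite /gram /rhs mulmx_sumr -sumrB dotv_sumr; apply: eq_bigr => k _.
by rewrite dotv_adjoint -scalemxAr -scalerBr dotvZr mulmxBl mulmxA.
Qed.

(** The normal equations, which are uniquely solvable by unisolvency, determine
    the minimizer. *)
Lemma gmls_coef_normal uh : gmls_coef eps phi S uh *m gram = rhs uh.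
Proof.
pose b0 := rhs uh *m invmx gram.
have b0E : b0 *m gram = rhs uh by rewrite mulmxKV.
suff -> : gmls_coef eps phi S uh = b0 by [].
have min0 b' : ls_functional eps phi S uh b0 <= ls_functional eps phi S uh b'.
  by rewrite -[b' in leRHS](subrK b0) addrC (ls_shift _ b0E) lerDl mulr_ge0// ?invr_ge0.
have : forall b', ls_functional eps phi S uh (gmls_coef eps phi S uh) <= ls_functional eps phi S uh b'.
  exact: (@xgetPex _ 0 [set b | forall b', ls_functional eps phi S uh b <= ls_functional eps phi S uh b'] (ex_intro _ b0 min0)).
move: (gmls_coef _ _ _ _) => b /(_ b0).
rewrite -[b in leLHS](subrK b0) addrC (ls_shift _ b0E) gerDl pmulr_rle0 ?invr_gt0//.
by move=> /energy_eq0/eqP; rewrite subr_eq0 => /eqP.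
Qed.

(** The normal equations are linear in the data, and the coefficients of a field in
    the span of the basis solve them for its own samples. *)
Lemma gmls_coef_shift uh q :
  gmls_coef eps phi S (fun k => uh k - field_of phi q (pt k)) = gmls_coef eps phi S uh - q.
Proof.
apply: (can_inj (mulmxK gram_unit)); rewrite mulmxBl !gmls_coef_normal /rhs /gram mulmx_sumr -sumrB.
apply: eq_bigr => k _; rewrite -scalemxAr -scalerBr mulmxBl; congr (_ *: (_ - _)).
by rewrite field_sample mulmxA.
Qed.

End least_squares.

(** An affine function has as its mean over a face the value at the centroid, so the
    flux only sees the reconstruction there, where it is controlled by the stability
    constant. *)
Lemma gmls_flux_centroid (R : realType) (d : nat) (M : pd_mesh R d) (eps B : R)
    (phi : 'I_d.+1 -> 'rV[R]_d -> R) (S : set 'rV[R]_d) (nu : 'rV[R]_d)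
    (uh : 'I_(npts M) -> 'rV[R]_d) :
  P1_basis phi -> measurable S -> 0 < area S -> (forall y, S y -> `|y| <= B) ->
  gmls_flux eps phi S nu uh =
  area S * dotv (field_of phi (gmls_coef eps phi S uh) (centroid S)) nu.
Proof.
move=> phiP mS S0 SB; rewrite /gmls_flux /face_moment.
move: (gmls_coef _ _ _ _) => b.
transitivity (\sum_s b 0 s * (area S * dotv (vbasis_fun phi s (centroid S)) nu)).
  apply: eq_bigr => s _; rewrite mxE; congr (_ * _).
  apply: (integral_affine_poly mS S0 SB (f := fun y => dotv (vbasis_fun phi s y) nu)).
  have [a [l E]] := @affine_poly_sum R d _ (index_enum 'I_d) xpredT
    (fun m y => nu 0 m * vbasis_fun phi s y 0 m) (fun m => affine_polyZ _ (vbasis_affine phiP s m)).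
  by exists a, l => y; rewrite -E; apply: eq_bigr => m _; rewrite mulrC.
rewrite /dotv /field_of; under eq_bigr do rewrite mulrCA mulr_sumr.
rewrite -mulr_sumr; congr (_ * _); rewrite exchange_big; apply: eq_bigr => m _ /=.
rewrite summxE mulr_suml; apply: eq_bigr => s _.
by rewrite [in RHS]mxE mulrA.
Qed.

(** * Quasiconvexity of Lipschitz regions *)

Section chains.
Context {R : realType} {d : nat}.
Implicit Types (Om : set 'rV[R]_d) (x y z : 'rV[R]_d).

(** Polygonal lines are enough as paths, and the mean value theorem applies to each
    of their segments. *)
Inductive chain Om : R -> 'rV[R]_d -> 'rV[R]_d -> Prop :=
| chain_nil x : chain Om 0 x x
| chain_cons l x y z : (forall t : R, 0 <= t <= 1 -> Om (x + t *: (y - x))) ->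
    chain Om l y z -> chain Om (enorm (y - x) + l) x z.

Lemma chain_ge0 Om l x y : chain Om l x y -> 0 <= l.
Proof. by elim=> [//|l' *]; rewrite addr_ge0 ?enorm_ge0. Qed.

Lemma chain_cat Om l l' x y z : chain Om l x y -> chain Om l' y z -> chain Om (l + l') x z.
Proof.
elim=> [x'|l1 x1 y1 z1 seg _ IH] yz; first by rewrite add0r.
by rewrite -addrA; apply: chain_cons => //; exact: IH.
Qed.

Lemma chain_seg Om x y : (forall t : R, 0 <= t <= 1 -> Om (x + t *: (y - x))) ->
  chain Om (enorm (y - x)) x y.
Proof. by move=> seg; rewrite -[enorm _]addr0; apply: chain_cons => //; exact: chain_nil. Qed.

Definition linked Om (L : R) x y := exists2 l, l <= L & chain Om l x y.

Lemma linkedW Om L L' x y : L <= L' -> linked Om L x y -> linked Om L' x y.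
Proof. by move=> LL' [l lL c]; exists l => //; exact: le_trans LL'. Qed.

Lemma linked_cat Om L L' x y z : linked Om L x y -> linked Om L' y z -> linked Om (L + L') x z.
Proof. by move=> [l lL c] [l' lL' c']; exists (l + l'); [exact: lerD|exact: chain_cat c c']. Qed.

Lemma enorm_convex x y z (r t : R) : 0 <= t <= 1 -> enorm (y - x) < r -> enorm (z - x) < r ->
  enorm (y + t *: (z - y) - x) < r.
Proof.
move=> /andP[t0 t1] yr zr.
rewrite (_ : _ - x = (1 - t) *: (y - x) + t *: (z - x)); last first.
  by apply/rowP => j; rewrite !mxE; ring.
rewrite (le_lt_trans (enormD _ _))// !enormZ !ger0_norm ?subr_ge0//.
have [->|t0'] := eqVneq t 0; first by rewrite mul0r addr0 subr0 mul1r.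
have tp : 0 < t by rewrite lt_def t0'.
have : (1 - t) * enorm (y - x) <= (1 - t) * r by rewrite ler_wpM2l ?subr_ge0// ltW.
have : t * enorm (z - x) < t * r by rewrite ltr_pM2l.
lra.
Qed.

Lemma nbhs_enorm x (r : R) : 0 < r -> nbhs x [set z | enorm (z - x) < r].
Proof.
move=> r0; apply/nbhs_ballP; exists (r / (d%:R + 1)) => /=.
  by rewrite divr_gt0// ltr_wpDl.
move=> z; rewrite -ball_normE /ball_/= => zr; rewrite enormBC.
rewrite (le_lt_trans (enorm_le_norm _))//.
rewrite ltr_pdivlMr ?ltr_wpDl// in zr; rewrite (le_lt_trans _ zr)// mulrC ler_wpM2l//.
by rewrite lerDl.
Qed.

(** Local quasiconvexity: two points above a graph are joined by moving up from
    each, far enough for the segment between the raised points to clear the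
    graph. *)
Lemma chart_chain Om x : (exists (r : R) (Q : 'M[R]_d) (k : 'I_d) (g : 'rV[R]_d.-1 -> R),
    [/\ 0 < r, Q *m Q^T = 1%:M, [lipschitz g t | t in [set: 'rV[R]_d.-1]] &
        forall y, enorm (y - x) < r ->
          (Om y <-> g (col' k (y *m Q)) < (y *m Q) 0 k)]) ->
  exists L r : R, [/\ 0 <= L, 0 < r & forall y z, Om y -> Om z ->
    enorm (y - x) < r -> enorm (z - x) < r -> linked Om (L * enorm (z - y)) y z].
Proof.
move=> [r [Q [k [g [r0 QQ lipg Omg]]]]].
have [K K0 gK] : exists2 K : R, 0 < K & forall s t, `|g s - g t| <= K * `|s - t|.
  have [K K0 hK] := @pinfty_ex_gt0 R _ lipg; exists K => // s t.
  by have /= := hK (s, t); apply.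
have QQ' : Q^T *m Q = 1%:M by exact: mulmx1C.
have enormQ (v : 'rV[R]_d) : enorm (v *m Q) = enorm v.
  rewrite /enorm; congr Num.sqrt.
  have E (a b : 'rV[R]_d) : dotv a b = (a *m b^T) 0 0.
    by rewrite mxE; apply: eq_bigr => i _; rewrite mxE.
  by rewrite !E trmx_mul mulmxA -(mulmxA v) QQ mulmx1.
pose e : 'rV[R]_d := delta_mx 0 k *m Q^T.
have eQ : e *m Q = delta_mx 0 k by rewrite -mulmxA QQ' mulmx1.
have e1 : enorm e = 1 by rewrite -enormQ eQ enorm_delta.
pose H y := (y *m Q) 0 k - g (col' k (y *m Q)).
have OmH y : enorm (y - x) < r -> Om y <-> 0 < H y.
  by move=> /Omg ->; rewrite subr_gt0.
have HD y t : H (y + t *: e) = H y + t.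
  rewrite /H mulmxDl -scalemxAl eQ (_ : col' k _ = col' k (y *m Q)); last first.
    by apply/rowP => j; rewrite !mxE [lift _ _ == _]eq_sym (negbTE (neq_lift _ _)) andbF mulr0 addr0.
  by rewrite !mxE !eqxx mulr1 addrAC.
have Hconv y z t : 0 <= t <= 1 ->
    (1 - t) * H y + t * H z - K * enorm (z - y) <= H (y + t *: (z - y)).
  move=> /andP[t0 t1]; rewrite /H mulmxDl -scalemxAl mulmxBl.
  set Y := y *m Q; set Z := z *m Q.
  have dE : `|col' k Z - col' k Y| <= enorm (z - y).
    rewrite -enormQ mulmxBl; apply/rV_norm_leP => [|j]; first exact: enorm_ge0.
    by rewrite !mxE; have := coord_enorm (Z - Y) (lift k j); rewrite !mxE.
  have colE : col' k (Y + t *: (Z - Y)) = col' k Y + t *: (col' k Z - col' k Y).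
    by apply/rowP => j; rewrite !mxE.
  rewrite colE [X in _ <= X - _]mxE [X in _ <= _ + X - _]mxE [X in _ <= _ + _ * X - _]mxE [X in _ <= _ + _ * (_ + X) - _]mxE.
  set p := col' k Y; set q := col' k Z in dE *; set D := enorm _ in dE *.
  have D0 : 0 <= D by exact: enorm_ge0.
  have gp : g (p + t *: (q - p)) - g p <= K * (t * D).
    rewrite (le_trans (ler_norm _))// (le_trans (gK _ _))// ler_wpM2l ?(ltW K0)//.
    by rewrite addrAC subrr add0r normrZ ger0_norm// ler_wpM2l.
  have gq : g (p + t *: (q - p)) - g q <= K * ((1 - t) * D).
    rewrite (le_trans (ler_norm _))// (le_trans (gK _ _))// ler_wpM2l ?(ltW K0)//.
    rewrite (_ : _ - q = (1 - t) *: (p - q)); last by apply/rowP => j; rewrite !mxE; ring.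
    by rewrite normrZ ger0_norm ?subr_ge0// ler_wpM2l ?subr_ge0// distrC.
  have : (1 - t) * (g (p + t *: (q - p)) - g p) <= (1 - t) * (K * (t * D)) by rewrite ler_wpM2l ?subr_ge0.
  have : t * (g (p + t *: (q - p)) - g q) <= t * (K * ((1 - t) * D)) by rewrite ler_wpM2l.
  have : 0 <= K * D * (1 - 2 * t * (1 - t)).
    by rewrite mulr_ge0 ?mulr_ge0 ?(ltW K0)//; nra.
  move: (g _) (g p) (g q) (Y 0 k) (Z 0 k) => G a b u v; nra.
(* points within [rho] are raised by at most [2 * K * rho] and stay in the chart *)
pose rho := r / (1 + 2 * K).
have K1 : 0 < 1 + 2 * K by rewrite ltr_pwDl// mulr_ge0// ltW.
exists (1 + 2 * K), rho; split; first exact: ltW.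
  by rewrite divr_gt0.
have rhoE : rho * (1 + 2 * K) = r by rewrite divfK// gt_eqF.
move=> y z Oy Oz yr zr.
have rho_r : rho <= r by rewrite -rhoE ler_peMr// ?lerDl; nra.
have Hy : 0 < H y by apply/OmH => //; exact: lt_le_trans rho_r.
have Hz : 0 < H z by apply/OmH => //; exact: lt_le_trans rho_r.
pose del := enorm (z - y); have del0 : 0 <= del by exact: enorm_ge0.
have del2 : del < 2 * rho.
  rewrite /del (le_lt_trans (enorm_triangle _ x _))// enormBC -enormBC (enormBC x).
  lra.
have up v t : enorm (v - x) < rho -> 0 <= t <= K * del -> 0 < H v + t -> Om (v + t *: e).
  move=> vr /andP[t0 tK] Hv; apply/OmH; last by rewrite HD.
  rewrite addrAC (le_lt_trans (enormD _ _))// enormZ e1 mulr1 ger0_norm// -rhoE.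
  nra.
pose T := K * del; have T0 : 0 <= T by rewrite mulr_ge0// ltW.
exists (enorm (y + T *: e - y) + (enorm (z + T *: e - (y + T *: e)) + (enorm (z - (z + T *: e)) + 0))).
  rewrite addrAC subrr add0r enormZ e1 mulr1 ger0_norm//.
  rewrite (_ : z + T *: e - _ = z - y); last by apply/rowP => j; rewrite !mxE; ring.
  rewrite (_ : z - (z + _) = - (T *: e)); last by apply/rowP => j; rewrite !mxE; ring.
  rewrite -/del enormN enormZ e1 mulr1 ger0_norm//.
  by rewrite /T; lra.
apply: chain_cons => [t /andP[t0 t1]|].
  rewrite addrAC subrr add0r scalerA; apply: up => //; last by rewrite ltr_pwDl// mulr_ge0.
  by rewrite mulr_ge0//= ler_piMl.
apply: chain_cons => [t t01|].
  rewrite (_ : _ + _ = (y + t *: (z - y)) + T *: e); last first.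
    by apply/rowP => j; rewrite !mxE; ring.
  apply: up; [exact: enorm_convex|by rewrite T0 lexx|].
  have := Hconv y z t t01; case/andP: t01 => t0 t1; rewrite -/del -/T.
  have [t0e|t0'] := eqVneq t 0.
    rewrite {1 2}t0e subr0 mul1r mul0r addr0 => h; lra.
  have : 0 <= (1 - t) * H y by apply: mulr_ge0; [rewrite subr_ge0|exact: ltW].
  have : 0 < t * H z by apply: mulr_gt0 => //; rewrite lt_def t0'.
  lra.
apply: chain_cons => [t /andP[t0 t1]|]; last exact: chain_nil.
rewrite (_ : _ + _ = z + ((1 - t) * T) *: e); last first.
  by apply/rowP => j; rewrite !mxE; ring.
have t1' : 0 <= 1 - t by rewrite subr_ge0.
apply: up => //; last by rewrite ltr_pwDl// mulr_ge0.
by rewrite mulr_ge0//= ler_piMl//; lra.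
Qed.

Lemma ball_chain Om x : open Om -> Om x ->
  exists L r : R, [/\ 0 <= L, 0 < r & forall y z, Om y -> Om z ->
    enorm (y - x) < r -> enorm (z - x) < r -> linked Om (L * enorm (z - y)) y z].
Proof.
move=> oO Ox; have [r r0 rO] := openball_enorm oO Ox.
exists 1, r; split=> // y z _ _ yr zr; exists (enorm (z - y)); first by rewrite mul1r.
by apply: chain_seg => t t01; apply: rO; exact: enorm_convex.
Qed.

Section quasiconvexity.
Variable Om : set 'rV[R]_d.
Hypothesis hO : lipschitz_region Om.

Let local_chain x : closure Om x ->
  exists L r : R, [/\ 0 <= L, 0 < r & forall y z, Om y -> Om z ->
    enorm (y - x) < r -> enorm (z - x) < r -> linked Om (L * enorm (z - y)) y z].
Proof.
have [oO _ _ _ lip] := hO; move=> cx.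
have [Ox|nOx] := pselect (Om x); first exact: ball_chain.
by apply: chart_chain; apply: lip; split=> // /interior_subset.
Qed.

(** The points that can be reached from [y] form a clopen subset. *)
Let reachable y z : Om y -> Om z -> exists l, chain Om l y z.
Proof.
have [oO _ _ cO _] := hO; move=> Oy Oz.
pose B := [set x | Om x /\ exists l, chain Om l y x].
suff BE : B = Om by have [] : B z by rewrite BE.
have nearby x : Om x -> exists2 r : R, 0 < r & forall x', enorm (x' - x) < r ->
    Om x' /\ (exists l, chain Om l x x') /\ (exists l, chain Om l x' x).
  move=> Ox; have [r r0 rO] := openball_enorm oO Ox; exists r => // x' x'r.
  have xr : enorm (x - x) < r by rewrite subrr enorm0.
  split; first exact: rO.
  by split; eexists; apply: chain_seg => t t01; apply: rO; exact: enorm_convex.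
apply: cO.
- by exists y; split=> //; exists 0; exact: chain_nil.
- exists B; last by apply/seteqP; split=> [x Bx|x []//]; split=> //; case: Bx.
  rewrite openE => x [Ox [l c]]; have [r r0 rP] := nearby x Ox.
  apply: filterS (nbhs_enorm x r0) => x' /rP[Ox' [[l' c'] _]]; split=> //.
  by exists (l + l'); exact: chain_cat c c'.
- exists (~` [set x | Om x /\ ~ B x]); last first.
    apply/seteqP; split=> [x Bx|x [Ox]]; first by split; [case: Bx|case].
    by move=> /not_andP[//|/contrapT].
  rewrite closedC openE => x [Ox nBx]; have [r r0 rP] := nearby x Ox.
  apply: filterS (nbhs_enorm x r0) => x' /rP[Ox' [_ [l' c']]]; split=> // -[_ [l c]].
  by apply: nBx; split=> //; exists (l + l'); exact: chain_cat c c'.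
Qed.

(** A bound holds near every pair of points of the closure. Near the diagonal it is
    [local_chain]. Near a pair of distinct points the distance is bounded below,
    while fixed points near each of them are joined by some polygonal line and the
    nearby points are joined to these by short ones. The bound is uniform because
    the closure is compact. *)
Lemma quasiconvex : exists2 L : R, 0 <= L &
  forall y z, Om y -> Om z -> linked Om (L * enorm (z - y)) y z.
Proof.
have [oO _ bO _ _] := hO.
have cptO : compact (closure Om).
  have [B B0 OB] := closure_bounded bO.
  apply: bounded_closed_compact; last exact: closed_closure.
  by exists B; split=> [|x Bx y /OB /le_trans]; [exact: num_real|apply; exact: ltW].
pose P (L : R) (p : 'rV[R]_d * 'rV[R]_d) :=
  Om p.1 -> Om p.2 -> linked Om (L * enorm (p.2 - p.1)) p.1 p.2.
have : \forall L \near +oo, closure Om `*` closure Om `<=` P L.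
  apply: (iffLR (compact_near_coveringP _) (compact_setX cptO cptO)) => -[y0 z0] [/= cy cz].
  have [Ly [ry [Ly0 ry0 Py]]] := local_chain cy.
  have [yz|yz] := eqVneq y0 z0.
    exists ([set y | enorm (y - y0) < ry] `*` [set z | enorm (z - z0) < ry], [set L | Ly < L]).
      split; last by exists Ly; split=> //; exact: num_real.
      by exists ([set y | enorm (y - y0) < ry], [set z | enorm (z - z0) < ry]); [split; exact: nbhs_enorm|].
    move=> [[y z] L] [[/= yr zr] /= LL] Oy Oz.
    rewrite -yz in zr; apply: linkedW (Py y z Oy Oz yr zr).
    by rewrite ler_wpM2r ?enorm_ge0// ltW.
  have [Lz [rz [Lz0 rz0 Pz]]] := local_chain cz.
  pose del := enorm (z0 - y0) / 4.
  have del0 : 0 < del.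
    rewrite divr_gt0// lt_def enorm_ge0 andbT; apply: contra yz => /eqP e0.
    have : z0 - y0 = 0 by apply: dotvv_eq0; rewrite -enorm_sqr e0 expr0n.
    by move/eqP; rewrite subr_eq0 eq_sym.
  have [wy [Owy wyr]] : Om `&` [set y | enorm (y - y0) < ry] !=set0 by apply: cy; exact: nbhs_enorm.
  have [wz [Owz wzr]] : Om `&` [set z | enorm (z - z0) < rz] !=set0 by apply: cz; exact: nbhs_enorm.
  have [l c] := reachable Owy Owz; have l0 := chain_ge0 c.
  pose D := Ly * (2 * ry) + l + Lz * (2 * rz).
  have D0 : 0 <= D by rewrite !addr_ge0// mulr_ge0// mulr_ge0// ltW.
  pose sy := Num.min ry del; pose sz := Num.min rz del.
  have sy0 : 0 < sy by rewrite lt_min ry0. have sz0 : 0 < sz by rewrite lt_min rz0.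
  exists ([set y | enorm (y - y0) < sy] `*` [set z | enorm (z - z0) < sz], [set L | D / del < L]).
    split; last by exists (D / del); split=> //; exact: num_real.
    by exists ([set y | enorm (y - y0) < sy], [set z | enorm (z - z0) < sz]); [split; exact: nbhs_enorm|].
  move=> [[y z] L] [[/= + +] /= LL] Oy Oz; rewrite !lt_min => /andP[yr yd] /andP[zr zd].
  have dist : del <= enorm (z - y).
    have := enorm_triangle z0 z y0; have := enorm_triangle z y y0.
    rewrite (enormBC z0 z); have -> : enorm (z0 - y0) = 4 * del by rewrite /del mulrC divfK.
    lra.
  apply: (linkedW (L := D)).
    apply: (le_trans (y := D / del * enorm (z - y))).
      by rewrite -mulrA ler_peMr// ler_pdivlMl// mulr1.
    by rewrite ler_wpM2r ?enorm_ge0// ltW.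
  apply: (linked_cat (y := wz)); first apply: (linked_cat (y := wy)).
  - apply: linkedW (Py y wy Oy Owy yr wyr); rewrite ler_wpM2l//.
    have := enorm_triangle wy y0 y; rewrite (enormBC y0 y) => /le_trans; apply.
    by rewrite mulr_natl mulr2n lerD// ltW.
  - by exists l; rewrite ?lexx.
  - apply: linkedW (Pz wz z Owz Oz wzr zr); rewrite ler_wpM2l//.
    have := enorm_triangle z z0 wz; rewrite (enormBC z0 wz) => /le_trans; apply.
    by rewrite mulr_natl mulr2n lerD// ltW.
move=> /(@pinfty_ex_gt0 R)[L L0 LP]; exists L; first exact: ltW.
move=> y z Oy Oz; apply: (LP (y, z)) => //=.
by split; exact: subset_closure.
Qed.

End quasiconvexity.
End chains.

(** * Mean value and Taylor estimates along polygonal lines *)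

Section calculus.
Context {R : realType} {d : nat}.
Implicit Types (Om : set 'rV[R]_d) (f : 'rV[R]_d -> R) (p v w x y z : 'rV[R]_d).

Local Notation e_ i := (delta_mx 0 i : 'rV[R]_d).

Definition C1_on Om f := forall x, Om x ->
  (forall i, derivable f x (e_ i)) /\ (forall i, {for x, continuous (partial i f)}).

Lemma is_derive_line f p v (s : R) : derivable f (p + s *: v) v ->
  is_derive s 1 (fun s : R => f (p + s *: v)) ('D_v f (p + s *: v)).
Proof.
move=> df; have E : (fun h : R => h^-1 *: (((fun s => f (p + s *: v)) \o shift s) (h *: 1) - f (p + s *: v)))
    = (fun h => h^-1 *: ((f \o shift (p + s *: v)) (h *: v) - f (p + s *: v))).
  apply/funext => h /=; congr (_ *: (f _ - _)).
  by apply/rowP => j; rewrite !mxE /= [h *: 1]mulr1; ring.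
by apply: DeriveDef; rewrite /derivable /derive E.
Qed.

Lemma coord_MVT f p k (a b D eps : R) :
  (forall s, a <= s <= b \/ b <= s <= a -> derivable f (p + s *: e_ k) (e_ k) /\
     `|partial k f (p + s *: e_ k) - D| <= eps) ->
  `|f (p + b *: e_ k) - f (p + a *: e_ k) - D * (b - a)| <= eps * `|b - a|.
Proof.
wlog ab : a b / a <= b => [hw|] h.
  have [ab|/ltW ba] := leP a b; first exact: hw.
  have H := hw b a ba (fun s hs => h s (iffLR (or_comm _ _) hs)).
  rewrite (distrC a b) in H; rewrite -normrN; apply: le_trans H.
  by rewrite (_ : - (f (p + b *: e_ k) - f (p + a *: e_ k) - D * (b - a)) = f (p + a *: e_ k) - f (p + b *: e_ k) - D * (a - b))//; ring.
pose g (s : R) := f (p + s *: e_ k).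
have dl (s : R) : s \in `[a, b] -> is_derive s 1 g (partial k f (p + s *: e_ k)).
  by rewrite in_itv/= => hs; apply: is_derive_line; have [] := h s (or_introl hs).
have dl' s : s \in `]a, b[ -> is_derive s 1 g (partial k f (p + s *: e_ k)).
  by move=> sab; apply: dl; apply: subset_itv_oo_cc sab.
have cg : {within `[a, b], continuous g}.
  by apply: derivable_within_continuous => s /dl[].
have [s sab fE] := MVT_segment ab dl' cg.
rewrite -/(g a) -/(g b).
rewrite fE -mulrBl normrM ler_wpM2r//.
by have [] := h s; first by left; rewrite in_itv in sab.
Qed.

(** The increment is split into moves along the axes, whose intermediate points stay
    in the ball because it is a box; continuity of the partial derivatives makes the
    estimate uniform in both points. *)
Lemma C1_strict Om f w (eps : R) : open Om -> C1_on Om f -> Om w -> 0 < eps ->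
  exists2 del : R, 0 < del & forall x y, `|x - w| < del -> `|y - w| < del ->
    `|f y - f x - \sum_i partial i f w * (y 0 i - x 0 i)| <= eps * \sum_i `|y 0 i - x 0 i|.
Proof.
move=> oO fC1 Ow eps0.
have [del del0 delP] : exists2 del : R, 0 < del & forall z, `|z - w| < del ->
    Om z /\ forall i, `|partial i f z - partial i f w| <= eps.
  have : \forall z \near w, Om z /\ forall i, `|partial i f z - partial i f w| <= eps.
    have nO : \forall z \near w, Om z by exact: (open_nbhs_nbhs (conj oO Ow)).
    have nP : \forall z \near w, forall i, `|partial i f z - partial i f w| <= eps.
      refine (@filter_forall _ 'I_d (fun (i : 'I_d) (z : 'rV[R]_d) => `|partial i f z - partial i f w| <= eps) (nbhs w) _ _) => i.
      have [_ /(_ i)/cvgrPdist_le/(_ _ eps0)] := fC1 w Ow.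
      by apply: filterS => z; rewrite distrC.
    by apply: filterS2 nO nP.
  move=> /nbhs_ballP[del /= del0 delP]; exists del => // z zw.
  by apply: delP; rewrite -ball_normE /ball_/= distrC.
exists del => // x y xw yw.
pose q (k : nat) (s : R) : 'rV[R]_d :=
  \row_i (if (i < k)%N then y 0 i else if i == k :> nat then s else x 0 i).
pose pth (k : nat) : 'rV[R]_d := \row_i (if (i < k)%N then y 0 i else x 0 i).
have qE (k : 'I_d) s : q k s = q k 0 + s *: e_ k.
  apply/rowP => i; rewrite !mxE eqxx /=; case: ltngtP => [ik|ik|/ord_inj ->].
  - by rewrite (_ : i == k = false) ?mulr0 ?addr0//; apply/eqP => ik'; rewrite ik' ltnn in ik.
  - by rewrite (_ : i == k = false) ?mulr0 ?addr0//; apply/eqP => ik'; rewrite ik' ltnn in ik.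
  - by rewrite eqxx mulr1 add0r.
have qx (k : 'I_d) : q k (x 0 k) = pth k.
  by apply/rowP => i; rewrite !mxE; case: ltngtP => [//|//|/ord_inj ->].
have qy (k : 'I_d) : q k (y 0 k) = pth k.+1.
  by apply/rowP => i; rewrite !mxE ltnS (leq_eqVlt i k); case: ltngtP => [//|//|/ord_inj ->].
have step (k : 'I_d) : `|f (pth k.+1) - f (pth k) - partial k f w * (y 0 k - x 0 k)| <= eps * `|y 0 k - x 0 k|.
  rewrite -qx -qy (qE _ (y 0 k)) (qE _ (x 0 k)); apply: coord_MVT => s hs.
  rewrite -qE; have [Oq hq] : Om (q k s) /\ forall i, `|partial i f (q k s) - partial i f w| <= eps.
    apply: delP; have m0 : 0 <= Num.max `|x - w| `|y - w| by rewrite le_max normr_ge0.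
    apply: (@le_lt_trans _ _ (Num.max `|x - w| `|y - w|)); last by rewrite gt_max xw.
    apply/rV_norm_leP => // i; rewrite !mxE le_max.
    have xi := coord_le_norm (x - w) i; have yi := coord_le_norm (y - w) i.
    rewrite !mxE in xi yi; case: ltngtP => [_|_|/ord_inj ik]; [by rewrite yi orbT|by rewrite xi|].
    move: hs; rewrite -ik; move: xi yi; rewrite !ler_norml => /andP[x1 x2] /andP[y1 y2].
    have [xy|xy] := leP `|x - w| `|y - w|.
      by case=> /andP[s1 s2]; apply/orP; right; apply/andP; split; lra.
    by case=> /andP[s1 s2]; apply/orP; left; apply/andP; split; lra.
  by split; [have [+ _] := fC1 _ Oq; exact|exact: hq].
have p0 : pth 0%N = x by apply/rowP => i; rewrite mxE.
have pd : pth d = y by apply/rowP => i; rewrite mxE ltn_ord.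
have -> : f y - f x = \sum_(k < d) (f (pth k.+1) - f (pth k)).
  by rewrite -pd -[in f x]p0 -(big_mkord xpredT (fun k => f (pth k.+1) - f (pth k))) telescope_sumr.
rewrite -sumrB mulr_sumr (le_trans (ler_norm_sum _ _ _))//.
by apply: ler_sum => k _; exact: step.
Qed.

Lemma is_derive_seg Om f x v (t : R) : open Om -> C1_on Om f -> Om (x + t *: v) ->
  is_derive t 1 (fun t : R => f (x + t *: v)) (\sum_i partial i f (x + t *: v) * v 0 i).
Proof.
move=> oO fC1 Ot; set D := \sum_i _.
suff cD : (fun h : R => h^-1 *: (((fun s => f (x + s *: v)) \o shift t) (h *: 1) - f (x + t *: v))) @ 0^' --> D.
  by apply: DeriveDef; [apply/cvg_ex; exists D|exact: cvg_lim].
apply/cvgrPdist_le => eps eps0.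
pose V := \sum_i `|v 0 i|; have V0 : 0 <= V by apply: sumr_ge0.
have e1 : 0 < eps / (V + 1) by rewrite divr_gt0// ltr_wpDl.
have [del del0 delP] := C1_strict oO fC1 Ot e1.
have n1 : 0 < del / (`|v| + 1) by rewrite divr_gt0// ltr_wpDl.
near=> h.
have h0 : h != 0 by near: h; exact: nbhs_dnbhs_neq.
have hd : `|h| < del / (`|v| + 1).
  near: h; apply: dnbhs0_lt => //.
have := delP (x + t *: v) (x + (t + h) *: v).
rewrite subrr normr0 => /(_ del0) H.
have v1 : 0 < `|v| + 1 by rewrite ltr_wpDl.
have hv : x + (t + h) *: v - (x + t *: v) = h *: v by apply/rowP => j; rewrite !mxE; ring.
have {}H := H ltac:(by rewrite hv normrZ; move: hd; rewrite ltr_pdivlMr// mulrDr mulr1; apply: le_lt_trans; rewrite lerDl).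
have S1 : \sum_i partial i f (x + t *: v) * ((x + (t + h) *: v) 0 i - (x + t *: v) 0 i) = h * D.
  by rewrite mulr_sumr; apply: eq_bigr => i _; rewrite !mxE; ring.
have S2 : \sum_i `|(x + (t + h) *: v) 0 i - (x + t *: v) 0 i| = `|h| * V.
  rewrite mulr_sumr; apply: eq_bigr => i _; rewrite -normrM !mxE; congr (`| _ |); ring.
rewrite S1 S2 in H.
rewrite distrC /= [h *: 1]mulr1 (addrC h).
rewrite (_ : _ - D = h^-1 * (f (x + (t + h) *: v) - f (x + t *: v) - h * D)); last first.
  by rewrite /GRing.scale/=; field.
rewrite normrM normfV ler_pdivrMl ?normr_gt0// (le_trans H)// mulrCA ler_pM2l ?normr_gt0//.
by rewrite mulrAC ler_pdivrMr ?ltr_wpDl// ler_pM2l// lerDl.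
Unshelve. all: by end_near. Qed.

Lemma seg_MVT Om f x y (a : 'rV[R]_d) (B : R) : open Om -> C1_on Om f ->
  (forall t : R, 0 <= t <= 1 -> Om (x + t *: (y - x))) ->
  (forall t : R, 0 <= t <= 1 -> forall i, `|partial i f (x + t *: (y - x)) - a 0 i| <= B) ->
  `|f y - f x - dotv a (y - x)| <= d%:R * B * enorm (y - x).
Proof.
move=> oO fC1 seg pB; pose v := y - x.
pose phi (t : R) := f (x + t *: v).
have dphi (t : R) : t \in `[0, 1] -> is_derive t 1 phi (\sum_i partial i f (x + t *: v) * v 0 i).
  by rewrite in_itv/= => /seg; exact: is_derive_seg.
have dphi' (t : R) : t \in `]0, 1[ -> is_derive t 1 phi (\sum_i partial i f (x + t *: v) * v 0 i).
  by move=> t01; apply: dphi; apply: subset_itv_oo_cc t01.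
have cphi : {within `[0, 1], continuous phi}.
  by apply: derivable_within_continuous => s /dphi[].
have [t t01] := MVT_segment (@ler01 R) dphi' cphi.
rewrite /phi scale1r scale0r addr0 subr0 mulr1 {1}/v (addrC x) subrK => ->.
rewrite /dotv -sumrB (le_trans (ler_norm_sum _ _ _))//.
have -> : d%:R * B * enorm (y - x) = \sum_(i < d) (B * enorm (y - x)).
  by rewrite sumr_const card_ord mulr_natl mulrnAl.
apply: ler_sum => i _; rewrite -mulrBl normrM ler_pM//; last exact: coord_enorm.
by apply: pB; rewrite in_itv in t01.
Qed.

Lemma chain_lipschitz Om f (N l : R) x y : open Om -> C1_on Om f ->
  (forall z, Om z -> forall i, `|partial i f z| <= N) ->
  chain Om l x y -> `|f y - f x| <= d%:R * N * l.
Proof.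
move=> oO fC1 fN; elim=> [z|l' {}x z {}y seg _ IH]; first by rewrite subrr normr0 mulr0.
have := seg_MVT (a := 0) oO fC1 seg (B := N).
rewrite dotv0l subr0 => /(_ _) h.
have {}h : `|f z - f x| <= d%:R * N * enorm (z - x).
  by apply: h => t t01 i; rewrite mxE subr0; apply: fN; exact: seg.
rewrite -(subrK (f z) (f y)) -addrA mulrDr [leRHS]addrC (le_trans (ler_normD _ _))//.
exact: lerD.
Qed.

(** The deviation of the gradient from [a], at most [B] at the starting point, grows
    along the line at a rate bounded by the second derivatives; at the end of the
    first segment the induction restarts with the larger deviation. *)
Lemma chain_taylor Om f (N l : R) x y : open Om -> 0 <= N -> C1_on Om f ->
  (forall i, C1_on Om (partial i f)) ->
  (forall z, Om z -> forall i j, `|partial j (partial i f) z| <= N) ->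
  chain Om l x y -> forall (a : 'rV[R]_d) (B : R), 0 <= B ->
  (forall i, `|partial i f x - a 0 i| <= B) ->
  `|f y - f x - dotv a (y - x)| <= d%:R * (B + d%:R * N * l) * l.
Proof.
move=> oO N0 fC1 fC2 fN; elim=> [z a B B0 _|l' {}x z {}y seg c IH a B B0 aB].
  by rewrite !subrr dotvC dotv0l subrr normr0 mulr0.
have l0 := chain_ge0 c.
pose B' := B + d%:R * N * enorm (z - x).
have dN : 0 <= d%:R * N by rewrite mulr_ge0.
have segB (t : R) : 0 <= t <= 1 -> forall i, `|partial i f (x + t *: (z - x)) - a 0 i| <= B'.
  move=> /andP[t0 t1] i; rewrite -(subrK (partial i f x) (partial i f (x + _))) -addrA.
  rewrite /B' [leRHS]addrC; apply: (le_trans (ler_normD _ _)); apply: lerD; last exact: aB.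
  have xE : x + t *: (z - x) - x = t *: (z - x) by rewrite addrAC subrr add0r.
  have cs : chain Om (enorm (x + t *: (z - x) - x)) x (x + t *: (z - x)).
    apply: chain_seg => s /andP[s0 s1]; rewrite xE scalerA; apply: seg.
    by rewrite mulr_ge0//= mulr_ile1.
  apply: le_trans (chain_lipschitz oO (fC2 i) (fun z Oz => fN z Oz i) cs) _.
  by rewrite ler_wpM2l// xE enormZ ger0_norm// ler_piMl// enorm_ge0.
have h1 := seg_MVT oO fC1 seg segB.
have zB i : `|partial i f z - a 0 i| <= B'.
  by have := segB 1 ltac:(by rewrite ler01 lexx) i; rewrite scale1r (addrC x) subrK.
have B'0 : 0 <= B' by rewrite addr_ge0// mulr_ge0// enorm_ge0.
have h2 := IH a B' B'0 zB.
rewrite (_ : f y - f x - dotv a (y - x) = (f y - f z - dotv a (y - z)) + (f z - f x - dotv a (z - x))); last first.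
  rewrite !dotvBr; ring.
apply: (le_trans (ler_normD _ _)); apply: (le_trans (lerD h2 h1)).
rewrite /B'; have := enorm_ge0 (z - x); move: (enorm _) => E E0.
have d0 : 0 <= d%:R :> R by [].
rewrite [leLHS](_ : _ = d%:R * ((B + d%:R * N * (E + l')) * l' + (B + d%:R * N * E) * E)); last by ring.
rewrite -[leRHS]mulrA ler_wpM2l// (_ : (B + d%:R * N * (E + l')) * (E + l') =
  (B + d%:R * N * (E + l')) * l' + (B + d%:R * N * (E + l')) * E); last by ring.
by rewrite lerD2l ler_wpM2r// lerD2l ler_wpM2l// lerDl.
Qed.

End calculus.

(** * Extension to the closure *)

Section extensions.
Context {R : realType} {d : nat} (Om : set 'rV[R]_d).
Implicit Types (f g : 'rV[R]_d -> R) (x y z : 'rV[R]_d).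

Local Notation into x := (within Om (nbhs x)).

Lemma into_proper x : closure Om x -> ProperFilter (into x).
Proof. by move=> cx; exact: within_nbhs_proper. Qed.

Lemma cvg_sumr (I : Type) (r : seq I) (T : Type) (F : set_system T) (f : I -> T -> R) (l : I -> R) :
  Filter F -> (forall i, f i z @[z --> F] --> l i) ->
  (\sum_(i <- r) f i z) @[z --> F] --> \sum_(i <- r) l i.
Proof.
move=> FF fl; elim: r => [|i r IH].
  by under eq_fun do rewrite big_nil; rewrite big_nil; exact: cvg_cst.
by under eq_fun do rewrite big_cons; rewrite big_cons; apply: cvgD.
Qed.

Lemma cvg_coord x (i : 'I_d) : (z 0 i : R) @[z --> into x] --> (x 0 i : R).
Proof.
move=> A /(@coord_continuous R 1 d 0 i x) hA.
by apply: (@filterS _ (nbhs x) _ _ _ _ hA) => z Az _.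
Qed.

Lemma into_near x (r : R) : 0 < r -> \forall z \near into x, Om z /\ enorm (z - x) < r.
Proof. by move=> r0; apply: filterS (nbhs_enorm x r0) => z zr Oz. Qed.

Lemma into_Om x : \forall z \near into x, Om z.
Proof. by apply: filterS (into_near x ltr01) => z []. Qed.

(** The values of a Lipschitz function satisfy the Cauchy criterion. *)
Lemma extension_cvg f (K : R) x : 0 <= K -> closure Om x ->
  (forall y z, Om y -> Om z -> `|f z - f y| <= K * enorm (z - y)) ->
  f z @[z --> into x] --> extension Om f x.
Proof.
move=> K0 cx fK; have PF := into_proper cx.
suff : cvg (f z @[z --> into x]) by [].
apply/cauchy_cvgP; apply: cauchy_exP => e e0.
have K1 : 0 < 2 * K + 1 by rewrite ltr_wpDl// mulr_ge0.
have del0 : 0 < e / (2 * K + 1) by rewrite divr_gt0.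
have [w [Ow wx]] := filter_ex (into_near x del0).
exists (f w); apply: filterS (into_near x del0) => z [Oz zx].
rewrite /= -ball_normE /ball_/= (le_lt_trans (fK _ _ Oz Ow))//.
have : enorm (w - z) <= 2 * (e / (2 * K + 1)).
  have := enorm_triangle w x z; rewrite (enormBC x z); lra.
move=> /(ler_wpM2l K0)/le_lt_trans; apply.
rewrite (_ : K * _ = (2 * K * e) / (2 * K + 1)); last by ring.
by rewrite ltr_pdivrMr// mulrDr mulr1 [e * _]mulrC ltrDl.
Qed.

Lemma extension_row (u : 'rV[R]_d -> 'rV[R]_d) x : closure Om x ->
  (forall k, component u k z @[z --> into x] --> extension Om (component u k) x) ->
  forall k, extension Om u x 0 k = extension Om (component u k) x.
Proof.
move=> cx uk k; have PF := into_proper cx.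
suff -> : extension Om u x = \row_k extension Om (component u k) x by rewrite mxE.
apply: cvg_lim; first exact: norm_hausdorff.
apply/cvgrPdist_le => e e0.
have : \forall z \near into x, forall k, `|extension Om (component u k) x - component u k z| <= e.
  refine (@filter_forall _ 'I_d (fun k z => `|extension Om (component u k) x - component u k z| <= e) (into x) _ _) => i.
  by have /cvgrPdist_le/(_ _ e0) := uk i.
apply: filterS => z h; apply/rV_norm_leP => [|i]; first exact: ltW.
by rewrite !mxE; exact: h.
Qed.

Lemma C2_C1 f : C2_on Om f -> C1_on Om f /\ forall i, C1_on Om (partial i f).
Proof.
move=> fC2; split=> [x Ox|i x Ox].
  have [_ h _] := fC2 x Ox; by split=> i; have [] := h i.
have [_ _ h] := fC2 x Ox; by split=> j; have [] := h i j.
Qed.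

Section bounds.
Variables (L N : R) (f : 'rV[R]_d -> R).
Hypotheses (oO : open Om) (L0 : 0 <= L) (N0 : 0 <= N).
Hypothesis OmL : forall y z, Om y -> Om z -> linked Om (L * enorm (z - y)) y z.

Lemma quasiconvex_lipschitz : C1_on Om f ->
  (forall z, Om z -> forall i, `|partial i f z| <= N) ->
  forall y z, Om y -> Om z -> `|f z - f y| <= d%:R * N * L * enorm (z - y).
Proof.
move=> fC1 fN y z Oy Oz; have [l lL c] := OmL Oy Oz.
rewrite (le_trans (chain_lipschitz oO fC1 fN c))// -[leRHS]mulrA ler_wpM2l//.
by rewrite mulr_ge0.
Qed.

Lemma quasiconvex_taylor : C1_on Om f -> (forall i, C1_on Om (partial i f)) ->
  (forall z, Om z -> forall i j, `|partial j (partial i f) z| <= N) ->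
  forall x y, Om x -> Om y ->
  `|f y - f x - \sum_i partial i f x * (y 0 i - x 0 i)| <=
    (d%:R * L) ^+ 2 * N * \sum_i (y 0 i - x 0 i) ^+ 2.
Proof.
move=> fC1 fC2 fN x y Ox Oy; have [l lL c] := OmL Ox Oy.
have l0 := chain_ge0 c.
have := chain_taylor (a := \row_i partial i f x) oO N0 fC1 fC2 fN c (lexx 0).
rewrite add0r => H; have {}H := H ltac:(by move=> i; rewrite mxE subrr normr0).
rewrite (_ : \sum_i _ = dotv (\row_i partial i f x) (y - x)); last first.
  by apply: eq_bigr => i _; rewrite !mxE.
apply: (le_trans H).
have -> : \sum_i (y 0 i - x 0 i) ^+ 2 = enorm (y - x) ^+ 2.
  by rewrite enorm_sqr; apply: eq_bigr => i _; rewrite !mxE expr2.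
have ll : l ^+ 2 <= (L * enorm (y - x)) ^+ 2.
  by rewrite ler_pXn2r// nnegrE (le_trans l0).
rewrite [leLHS](_ : _ = (d%:R ^+ 2 * N) * l ^+ 2); last by ring.
rewrite [leRHS](_ : _ = (d%:R ^+ 2 * N) * (L * enorm (y - x)) ^+ 2); last by ring.
by rewrite ler_wpM2l// mulr_ge0// exprn_ge0.
Qed.

End bounds.

(** Inequalities pass to the limit in each point successively. *)
Lemma extension_taylor f (g : 'I_d -> 'rV[R]_d -> R) (f' : 'rV[R]_d -> R) (g' : 'I_d -> 'rV[R]_d -> R) (C : R) :
  (forall x, closure Om x -> f z @[z --> into x] --> f' x) ->
  (forall x i, closure Om x -> g i z @[z --> into x] --> g' i x) ->
  (forall x y, Om x -> Om y ->
    `|f y - f x - \sum_i g i x * (y 0 i - x 0 i)| <= C * \sum_i (y 0 i - x 0 i) ^+ 2) ->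
  forall x y, closure Om x -> closure Om y ->
    `|f' y - f' x - \sum_i g' i x * (y 0 i - x 0 i)| <= C * \sum_i (y 0 i - x 0 i) ^+ 2.
Proof.
move=> cf cg T.
have T1 x y : closure Om x -> Om y ->
    `|f y - f' x - \sum_i g' i x * (y 0 i - x 0 i)| <= C * \sum_i (y 0 i - x 0 i) ^+ 2.
  move=> cx Oy; have PF := into_proper cx.
  apply: (@ler_cvg_to _ (into x) _ _
    (fun z => `|f y - f z - \sum_i g i z * (y 0 i - z 0 i)|)
    (fun z => C * \sum_i (y 0 i - z 0 i) ^+ 2)).
  - apply: cvg_norm; apply: cvgB; first by apply: cvgB; [exact: cvg_cst|exact: cf].
    apply: cvg_sumr => i; apply: cvgM; first exact: cg.
    by apply: cvgB; [exact: cvg_cst|exact: cvg_coord].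
  - apply: cvgM; first exact: cvg_cst.
    apply: cvg_sumr => i; apply: cvgM; by apply: cvgB; [exact: cvg_cst|exact: cvg_coord].
  - by apply: filterS (into_Om x) => z Oz; exact: T.
move=> x y cx cy; have PF := into_proper cy.
apply: (@ler_cvg_to _ (into y) _ _
    (fun z => `|f z - f' x - \sum_i g' i x * (z 0 i - x 0 i)|)
    (fun z => C * \sum_i (z 0 i - x 0 i) ^+ 2)).
- apply: cvg_norm; apply: cvgB; first by apply: cvgB; [exact: cf|exact: cvg_cst].
  apply: cvg_sumr => i; apply: cvgM; first exact: cvg_cst.
  by apply: cvgB; [exact: cvg_coord|exact: cvg_cst].
- apply: cvgM; first exact: cvg_cst.
  apply: cvg_sumr => i; apply: cvgM; by apply: cvgB; [exact: cvg_coord|exact: cvg_cst].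
- by apply: filterS (into_Om y) => z Oz; exact: T1.
Qed.

(** The extension is continuous on the closure, hence measurable on its closed
    subsets. *)
Lemma extension_measurable f (S : set 'rV[R]_d) (K : R) : 0 <= K -> closed S -> S `<=` closure Om ->
  (forall y z, Om y -> Om z -> `|f z - f y| <= K * enorm (z - y)) ->
  measurable_fun S (extension Om f).
Proof.
move=> K0 cS SO fK.
have ext x (e : R) : closure Om x -> 0 < e -> exists2 r : R, 0 < r &
    forall y, closure Om y -> enorm (y - x) < r -> `|extension Om f x - extension Om f y| < e.
  move=> cx e0; (* two errors below [e / 4], and [3 * K * r < e / 2] between the approximants *)
  pose r := e / (8 * (K + 1)).
  have K1 : 0 < K + 1 by rewrite ltr_wpDl.
  have r0 : 0 < r by rewrite divr_gt0// mulr_gt0.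
  have rE : r * (8 * (K + 1)) = e by rewrite /r divfK// gt_eqF// mulr_gt0.
  have e4 : 0 < e / 4 by rewrite divr_gt0.
  have apx z : closure Om z -> exists w, [/\ Om w, enorm (w - z) < r & `|extension Om f z - f w| < e / 4].
    move=> cz; have PF := into_proper cz.
    have /cvgrPdist_lt/(_ _ e4) fz := extension_cvg K0 cz fK.
    by have [w [[Ow wz] fw]] := filter_ex (filterI (into_near z r0) fz); exists w.
  exists r => // y cy yx.
  have [w [Ow wx fw]] := apx x cx; have [z [Oz zy fz]] := apx y cy.
  have zw : enorm (w - z) <= 3 * r.
    have := enorm_triangle w x z; have := enorm_triangle x y z.
    rewrite (enormBC x y) (enormBC y z); lra.
  have := ler_wpM2l K0 zw; have := fK z w Oz Ow => h1 h2.
  have {h1 h2} h : `|f w - f z| <= K * (3 * r) by exact: le_trans h2.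
  rewrite (_ : _ - _ = (extension Om f x - f w) + (f w - f z) - (extension Om f y - f z)); last by ring.
  rewrite (le_lt_trans (ler_normB _ _))// -(ltrBrDr _ _ _).
  rewrite (le_lt_trans (ler_normD _ _))//; nra.
apply: (measurability _ (RGenOInfty.measurableE R)) => //.
move=> /= _ [_ [a ->]] <-.
pose U := \bigcup_(p in [set p : 'rV[R]_d * R | S p.1 /\ 0 < p.2 /\
   forall y, closure Om y -> enorm (y - p.1) < p.2 -> a < extension Om f y])
   (interior [set y | enorm (y - p.1) < p.2]).
rewrite (_ : _ `&` _ = S `&` U).
  apply: measurableI; first exact: rV_closed_measurable.
  by apply: rV_open_measurable; apply: bigcup_open => p _; exact: open_interior.
apply/seteqP; split=> [x [Sx]|x [Sx [p [_ [_ pP]] /interior_subset xp]]]; last first.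
  by split=> //=; rewrite in_itv/= andbT; apply: pP => //; exact: SO.
rewrite /= in_itv/= andbT => ax; split=> //.
have [r r0 rP] := ext x (extension Om f x - a) (SO _ Sx) ltac:(by rewrite subr_gt0).
exists (x, r) => /=; last by apply: nbhs_enorm.
split=> //; split=> // y cy yr; have := rP y cy yr; rewrite ltr_norml => /andP[_]; lra.
Qed.

End extensions.

(** * Conservation *)

Section conservation.
Context {R : realType} {n : nat} (Omega : set 'rV[R]_n.+1) (M : pd_mesh R n.+1).
Variables (eps : R) (phi : 'I_n.+2 -> 'rV[R]_n.+1 -> R).
Hypothesis bOmega : bounded_set Omega.
Hypothesis hM : is_mesh Omega M.
Hypothesis hg : is_gmls Omega M eps phi.
Variables (ug : 'rV[R]_n.+1 -> 'rV[R]_n.+1) (uh : 'I_(npts M) -> 'rV[R]_n.+1).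
Implicit Types i j k : 'I_(npts M).

Let flux i j := gmls_flux eps phi (dface i j) (dnormal i j) uh.

Lemma dface_area_gt0 i j : adj i j -> 0 < area (dface i j).
Proof. by move=> /(dface_flat hM)[]. Qed.

Lemma bface_area_gt0 i : i \in bdry M -> 0 < area (bface Omega i).
Proof. by move=> /(bface_flat hM)[]. Qed.

Lemma dface_measurable i j : measurable (dface i j).
Proof. by apply: rV_closed_measurable; exact: dface_closed. Qed.

Lemma bface_measurable i : measurable (bface Omega i).
Proof. by apply: rV_closed_measurable; exact: bface_closed. Qed.

Lemma vol_gt0 i : 0 < vol i.
Proof. by have [_ _ [_ /(_ i)]] := hM. Qed.

(** The two cells share the reconstruction on their common face and its value at the
    centroid; only the normal changes its sign. *)
Lemma flux_antisym i j : adj i j -> flux i j = - flux j i.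
Proof.
move=> ij; have [_ phiP _] := hg; have [B _ BP] := closure_bounded bOmega.
have SB y : dface i j y -> `|y| <= B by move=> /(dface_sub hM)/BP.
have mS := dface_measurable i j; have S0 := dface_area_gt0 ij.
rewrite /flux (dnormalC hM ij) [dface j i]dfaceC.
by rewrite !(gmls_flux_centroid _ _ _ phiP mS S0 SB) dotvNr mulrN.
Qed.

Lemma bface_normal_field i : i \in bdry M ->
  \int[surf R n.+1]_(y in bface Omega i) dotv (ug y) (normal_field Omega y) =
  \int[surf R n.+1]_(y in bface Omega i) dotv (ug y) (bnormal i).
Proof.
move=> ib; have [_ _ neg] := bface_flat hM ib.
apply: (Rintegral_negligible neg) => y yb ny.
rewrite (@normal_fieldE _ _ _ y (bnormal i))//.
by apply: contrapT => nn; apply: ny.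
Qed.

Lemma gam_bdry i : i \in gam M -> i \in bdry M.
Proof. by have [[_ /fintype.subsetP + _ _] _ _ _] := hM; exact. Qed.

Lemma vol_div_gmls i : vol i * div_gmls Omega eps phi ug uh i =
  \sum_(j | adj i j) flux i j
  + (if i \in bdry M :\: gam M then gmls_flux eps phi (bface Omega i) (bnormal i) uh else 0)
  + (if i \in gam M then \int[surf R n.+1]_(y in bface Omega i) dotv (ug y) (bnormal i) else 0).
Proof.
rewrite /div_gmls mulrA divff ?mul1r ?gt_eqF ?vol_gt0//; congr (_ + _).
by case: ifPn => // /gam_bdry; exact: bface_normal_field.
Qed.

(** The fluxes through the dual faces between two cells of [C] cancel in pairs. *)
Lemma local_conservation (C : {set 'I_(npts M)}) :
  \sum_(i in C) vol i * div_gmls Omega eps phi ug uh i =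
    \sum_(i in C) \sum_(j | adj i j && (j \notin C)) flux i j
    + \sum_(k in C :&: (bdry M :\: gam M)) gmls_flux eps phi (bface Omega k) (bnormal k) uh
    + \sum_(k in C :&: gam M)
        \int[surf R n.+1]_(y in bface Omega k) dotv (ug y) (bnormal k).
Proof.
under eq_bigr do rewrite vol_div_gmls.
rewrite !big_split/= -!big_mkcondr/=; congr (_ + _ + _); last 2 first.
- by apply: eq_bigl => i; rewrite finset.in_setI.
- by apply: eq_bigl => i; rewrite finset.in_setI.
rewrite -[RHS]add0r -[X in X + _](_ : \sum_(i in C) \sum_(j | adj i j && (j \in C)) flux i j = 0).
  by rewrite -big_split/=; apply: eq_bigr => i _; rewrite (bigID (mem C)).
set X := LHS; suff : X = - X by move=> XN; lra.
rewrite {1}/X (eq_bigr (fun i => \sum_(j in C | adj i j) flux i j)); last first.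
  by move=> i _; apply: eq_bigl => j; rewrite andbC.
rewrite (exchange_big_dep (mem C))//=; last by move=> i j _ /andP[].
rewrite /X -sumrN; apply: eq_bigr => i iC.
rewrite -sumrN; apply: eq_big => [j|j /andP[_ /andP[_ ji]]].
  by rewrite iC /= (adj_sym hM) andbC.
exact: flux_antisym.
Qed.

(** No dual face is left when all cells are taken, and the boundary faces cover the
    boundary with null overlaps. *)
Lemma global_conservation :
  (forall m : 'I_n.+1, (surf R n.+1).-integrable (boundary Omega) (EFin \o component ug m)) ->
  gam M = bdry M ->
  \sum_i vol i * div_gmls Omega eps phi ug uh i =
  \int[surf R n.+1]_(y in boundary Omega) dotv (ug y) (normal_field Omega y).
Proof.
move=> ugi gb; have := local_conservation [set: 'I_(npts M)].
rewrite (eq_bigl xpredT) => [->|i]; last by rewrite inE.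
rewrite [X in X + _ + _]big1 ?add0r; last first.
  by move=> i _; rewrite big_pred0// => j; rewrite inE andbF.
rewrite gb finset.setDv finset.setI0 big_set0 add0r finset.setTI.
have [_ [bE bov bfl] _ _] := hM.
have mb := @boundary_measurable R _ Omega.
pose f k y := dotv (ug y) (bnormal k).
have fi k : (surf R n.+1).-integrable (boundary Omega) (EFin \o f k).
  apply: (eq_integrable mb (fun y => \sum_m ((bnormal k 0 m)%:E * (component ug m y)%:E))%E).
    move=> y _; rewrite /= /f /dotv -sumEFin; apply: eq_bigr => m _.
    by rewrite -EFinM mulrC.
  by apply: integrable_sum => // m _; apply: integrableZl => //; exact: ugi.
have bsub k : bface Omega k `<=` boundary Omega by move=> y [].
have ov : (surf R n.+1).-negligible (\bigcup_(ij in [set: 'I_(npts M) * 'I_(npts M)])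
    ([set y | ij.1 \in bdry M /\ ij.2 \in bdry M /\ ij.1 != ij.2 /\ (bface Omega ij.1 `&` bface Omega ij.2) y]
    `|` [set y | ij.1 \in bdry M /\ bface Omega ij.1 y /\ ~ outward_unit_normal Omega y (bnormal ij.1)])).
  apply: negligible_bigcup_countType => -[i j] /=; apply: negligibleU.
    have [[ib [jb ij]]|h] := pselect (i \in bdry M /\ j \in bdry M /\ i != j); last first.
      by apply: negligibleS (negligible_set0 _) => y [ib [jb [ij _]]]; apply: h.
    apply: (@negligibleS _ _ _ _ (bface Omega i `&` bface Omega j)) => [y [_ [_ []]]//|].
    by apply/negligibleP; [apply: measurableI; exact: bface_measurable|exact: bov].
  have [ib|h] := boolP (i \in bdry M); last by apply: negligibleS (negligible_set0 _) => y [].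
  by have [_ _] := bfl i ib; apply: negligibleS => y [].
transitivity (\int[surf R n.+1]_(y in boundary Omega) \sum_(k in bdry M) (f k \_ (bface Omega k)) y).
  rewrite Rintegral_sum//.
    by apply: eq_bigr => k _; rewrite -Rintegral_mkcondr (setIidr (bsub k)).
  move=> k kb; apply/(integrable_mkcond _ mb).
  apply: (eq_integrable measurableT ((EFin \o f k) \_ (bface Omega k))).
    move=> y _; have [yb|yb] := boolP (y \in bface Omega k).
      have yO : y \in boundary Omega by rewrite mem_set//; exact: (bsub k _ (set_mem yb)).
      by rewrite !patchE yb yO /= patchE yb.
    by rewrite !patchE (negbTE yb); case: ifPn => //= _; rewrite patchE (negbTE yb).
  apply/(integrable_mkcond _ (bface_measurable k)).
  by apply: integrableS (fi k) => //; exact: bface_measurable.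
apply: (Rintegral_negligible ov) => y; rewrite bE => -[k /= kb yk] ny.
rewrite (bigD1 k)//= patchE mem_set// big1 ?addr0.
  rewrite /f (@normal_fieldE _ _ _ y (bnormal k))//.
  by apply: contrapT => nn; apply: ny; exists (k, k) => //; right.
move=> j /andP[jb jk]; rewrite patchE memNset// => yj.
by apply: ny; exists (j, k) => //; left.
Qed.

End conservation.

(** * Accuracy *)

Section affine_fields.
Context {R : realType} {d : nat}.

Definition affine_field (a : 'I_d -> R) (l : 'I_d -> 'rV[R]_d) (y : 'rV[R]_d) : 'rV[R]_d :=
  \row_m (a m + dotv (l m) y).

Lemma affine_field_poly a l k : affine_poly (fun y => affine_field a l y 0 k).
Proof. by exists (a k), (l k) => y; rewrite mxE. Qed.

Lemma affine_field_flux_poly a l nu : affine_poly (fun y => dotv (affine_field a l y) nu).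
Proof.
have [b [m E]] := @affine_poly_sum R d _ (index_enum 'I_d) xpredT
  (fun m y => nu 0 m * affine_field a l y 0 m) (fun m => affine_polyZ _ (affine_field_poly a l m)).
by exists b, m => y; rewrite -E; apply: eq_bigr => k _; rewrite mulrC.
Qed.

Lemma enorm_le_coord (v : 'rV[R]_d) (E : R) : (forall k, `|v 0 k| <= E) -> enorm v <= d%:R * E.
Proof.
move=> vE; apply: (le_trans (enorm_le_sum v)).
apply: (@le_trans _ _ (\sum_(i < d) E)); first by apply: ler_sum => i _; exact: vE.
by rewrite sumr_const card_ord mulr_natl.
Qed.

Lemma Rintegral_bound (S : set 'rV[R]_d) (g : 'rV[R]_d -> R) (E : R) :
  measurable S -> 0 < area S -> measurable_fun S g -> (forall y, S y -> `|g y| <= E) ->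
  (surf R d).-integrable S (EFin \o g) /\ `|\int[surf R d]_(y in S) g y| <= area S * E.
Proof.
move=> mS S0 mg gE.
have Sfin : (surf R d S < +oo)%E.
  by rewrite ltey; apply: contraTneq S0 => SE; rewrite /area SE /= ltxx.
have gi : (surf R d).-integrable S (EFin \o g) by exact: (bounded_integrable mS Sfin mg gE).
split=> //; apply: (le_trans (le_normr_Rintegral mS gi)).
rewrite /area mulrC -Rintegral_cst//; apply: le_Rintegral => //.
  by apply: (@bounded_integrable _ _ _ _ _ _ E) => //= [|x Sx]; [exact: measurableT_comp|rewrite normr_id; exact: gE].
by apply: (@bounded_integrable _ _ _ _ _ _ `|E|).
Qed.

End affine_fields.

(** Since affine fields are reproduced, the flux of the reconstruction differs
    from the flux of an affine field by the flux of the reconstructed error,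
    which the moving-least-squares stability controls at the centroid. *)
Lemma gmls_flux_error (R : realType) (d : nat) (Omega : set 'rV[R]_d) (M : pd_mesh R d)
    (eps stab B E : R) (phi : 'I_d.+1 -> 'rV[R]_d -> R) (S : set 'rV[R]_d) (nu : 'rV[R]_d)
    (uh : 'I_(npts M) -> 'rV[R]_d) a l :
  is_gmls Omega M eps phi -> mls_stable Omega M eps phi stab -> gmls_face Omega M S ->
  measurable S -> 0 < area S -> (forall y, S y -> `|y| <= B) -> enorm nu = 1 -> 0 <= E ->
  (forall k, k \notin gam M -> enorm (pt k - centroid S) < eps ->
     enorm (uh k - affine_field a l (pt k)) <= E) ->
  `|gmls_flux eps phi S nu uh - \int[surf R d]_(y in S) dotv (affine_field a l y) nu| <=
  area S * (`|stab| * E).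
Proof.
move=> hg hst hS mS S0 SB nu1 E0 uhE; have [_ phiP _] := hg.
have [q qE] := field_of_surj phiP (affine_field_poly a l).
rewrite (gmls_flux_centroid _ _ _ phiP mS S0 SB).
rewrite (integral_affine_poly mS S0 SB (affine_field_flux_poly a l nu)).
rewrite -mulrBr normrM gtr0_norm// ler_wpM2l ?(ltW S0)//.
rewrite -qE -dotvBl -field_ofB -(gmls_coef_shift hg hS).
rewrite (le_trans (ler_dotv _ _))// nu1 mulr1 (le_trans (hst _ hS _))//.
set m := \big[Num.max/0]_(k | _) _.
have m0 : 0 <= m.
  rewrite /m; elim/big_ind : _ => //= [x y x0 y0|k _]; last exact: enorm_ge0.
  by rewrite le_max x0.
have mE : m <= E.
  rewrite /m; elim/big_ind : _ => //= [x y x0 y0|k /andP[kg ke]]; first by rewrite ge_max x0.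
  by rewrite qE; exact: uhE.
by rewrite (le_trans (ler_wpM2r m0 (ler_norm _)))// ler_wpM2l.
Qed.

Section smooth_fields.
Context {R : realType} {d : nat} (Omega : set 'rV[R]_d.+1).
Variable u : 'rV[R]_d.+1 -> 'rV[R]_d.+1.
Hypotheses (uC2 : forall k, C2_on Omega (component u k)) (uN : (C2_norm Omega u < +oo)%E).

Let N := fine (C2_norm Omega u).

Let le_C2_norm x k (r : R) : Omega x ->
  [\/ r = `|component u k x|, exists i, r = `|partial i (component u k) x| |
      exists i j, r = `|partial j (partial i (component u k)) x|] -> r <= N.
Proof.
move=> Ox rE.
have rN : (r%:E <= C2_norm Omega u)%E.
  apply: ereal_sup_ubound; exists x, k; split=> //.
  case: rE => [->|[i ->]|[i [j ->]]]; [by apply: Or31|by apply: Or32; exists i|].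
  by apply: Or33; exists i, j.
rewrite -lee_fin fineK// fin_numE; apply/andP; split; apply/eqP => CE.
  by rewrite CE in rN.
  by have := uN; rewrite CE.
Qed.

Lemma partial_le_C2 x k i : Omega x -> `|partial i (component u k) x| <= N.
Proof. by move=> Ox; apply: (le_C2_norm Ox (k := k)); apply: Or32; exists i. Qed.

Lemma partial2_le_C2 x k i j : Omega x -> `|partial j (partial i (component u k)) x| <= N.
Proof. by move=> Ox; apply: (le_C2_norm Ox (k := k)); apply: Or33; exists i, j. Qed.

Lemma C2_norm_ge0 : Omega !=set0 -> 0 <= N.
Proof. by move=> [x /(partial_le_C2 ord0 ord0)]; exact: le_trans. Qed.

End smooth_fields.

(** Quasiconvexity turns the estimates along polygonal lines into estimates by the
    distance, even where the segment leaves the region; these pass to the closure. *)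
Lemma field_taylor (R : realType) (d : nat) (Omega : set 'rV[R]_d.+1) : lipschitz_region Omega ->
  exists2 c : R, 0 <= c & forall u : 'rV[R]_d.+1 -> 'rV[R]_d.+1,
  (forall k, C2_on Omega (component u k)) -> (C2_norm Omega u < +oo)%E ->
  [/\ forall (S : set 'rV[R]_d.+1) k, closed S -> S `<=` closure Omega ->
        measurable_fun S (fun y => extension Omega u y 0 k),
      forall x, closure Omega x -> extension Omega (divergence u) x =
        \sum_k extension Omega (partial k (component u k)) x &
      forall x y k, closure Omega x -> closure Omega y ->
        `|extension Omega u y 0 k - extension Omega u x 0 k
          - \sum_i extension Omega (partial i (component u k)) x * (y 0 i - x 0 i)| <=
        c * fine (C2_norm Omega u) * enorm (y - x) ^+ 2].
Proof.
move=> hO; have [oO O0 _ _ _] := hO; have [L L0 OL] := quasiconvex hO.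
exists ((d.+1%:R * L) ^+ 2); first by rewrite exprn_ge0// mulr_ge0.
move=> u uC2 uN; have N0 := C2_norm_ge0 uN O0; set N := fine _ in N0 *.
have K0 : 0 <= d.+1%:R * N * L by rewrite !mulr_ge0.
have fC1 k := proj1 (C2_C1 (uC2 k)); have gC1 k := proj2 (C2_C1 (uC2 k)).
have fL k := quasiconvex_lipschitz oO N0 OL (fC1 k) (fun z Oz i => partial_le_C2 uN k i Oz).
have gL k i := quasiconvex_lipschitz oO N0 OL (gC1 k i) (fun z Oz j => partial2_le_C2 uN k i j Oz).
have fcvg x k (cx : closure Omega x) := extension_cvg K0 cx (fL k).
have gcvg x k i (cx : closure Omega x) := extension_cvg K0 cx (gL k i).
have row x (cx : closure Omega x) := extension_row cx (fun k => fcvg x k cx).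
split.
- move=> S k cS SO.
  apply: (eq_measurable_fun (extension Omega (component u k))).
    by move=> y /set_mem/SO cy; rewrite row.
  exact: extension_measurable K0 cS SO (fL k).
- move=> x cx; have PF := into_proper cx.
  apply: cvg_lim; first exact: Rhausdorff.
  exact: (@cvg_sumr R 'I_d.+1 (index_enum 'I_d.+1) _ (within Omega (nbhs x))
    (fun k z => partial k (component u k) z) _ _ (fun k => gcvg x k k cx)).
- move=> x y k cx cy; rewrite !row//.
  have -> : enorm (y - x) ^+ 2 = \sum_i (y 0 i - x 0 i) ^+ 2.
    by rewrite enorm_sqr; apply: eq_bigr => i _; rewrite !mxE expr2.
  apply: (@extension_taylor R d.+1 Omega (component u k) (fun i => partial i (component u k))
    (extension Omega (component u k)) (fun i => extension Omega (partial i (component u k)))) => //.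
  + by move=> z cz; exact: fcvg.
  + by move=> z i cz; exact: gcvg.
  + move=> z w; exact: (quasiconvex_taylor oO N0 OL (fC1 k) (gC1 k)
      (fun v Ov i j => partial2_le_C2 uN k i j Ov)).
Qed.

Section accuracy.
Context {R : realType} {n : nat} (Omega : set 'rV[R]_n.+1).
Hypothesis hO : lipschitz_region Omega.

Lemma fill_distance_ge0 (M : pd_mesh R n.+1) (i : 'I_(npts M)) : 0 <= fill_distance Omega M.
Proof.
have [_ [y Oy] _ _ _] := hO; rewrite /fill_distance; set A := [set r | _].
have A0 r : A r -> 0 <= r.
  move=> [z _ ->]; apply: lb_le_inf; first by exists (enorm (z - pt i)); exists i.
  by move=> _ [j _ <-]; exact: enorm_ge0.
have [supA|/sup_out->//] := pselect (has_sup A).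
have [[r Ar] ubA] := supA.
exact: le_trans (A0 _ Ar) (ub_le_sup ubA Ar).
Qed.

Lemma pt_closure (M : pd_mesh R n.+1) (k : 'I_(npts M)) : is_mesh Omega M ->
  closure Omega (pt k).
Proof.
move=> hM; have [[_ _ inn bd] _ _ _] := hM.
have [kb|kb] := boolP (k \in bdry M); last by apply: subset_closure; exact: inn.
by have [yb _] := bd k kb; exact: bface_sub hM _ _ yb.
Qed.

Variable K : uniformity_constants R.

Let D : R := n.+1%:R.
Let rho := `|eps_ratio K| + `|dface_dist K|.

Section mesh.
Variables (c : R) (M : pd_mesh R n.+1) (eps : R) (phi : 'I_n.+2 -> 'rV[R]_n.+1 -> R).
Variable u : 'rV[R]_n.+1 -> 'rV[R]_n.+1.
Hypotheses (c0 : 0 <= c) (hM : is_mesh Omega M) (hg : is_gmls Omega M eps phi).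
Hypothesis hK : uniform_mesh Omega M eps phi K.
Variable N : R.
Hypothesis N0 : 0 <= N.

Let h := fill_distance Omega M.
Let ue := extension Omega u.

Hypothesis ue_measurable : forall (S : set 'rV[R]_n.+1) k, closed S -> S `<=` closure Omega ->
  measurable_fun S (fun y => ue y 0 k).
Hypothesis div_extension : forall x, closure Omega x -> extension Omega (divergence u) x =
  \sum_k extension Omega (partial k (component u k)) x.
Hypothesis taylor : forall x y k, closure Omega x -> closure Omega y ->
  `|ue y 0 k - ue x 0 k
    - \sum_i extension Omega (partial i (component u k)) x * (y 0 i - x 0 i)| <=
  c * N * enorm (y - x) ^+ 2.

Variable i : 'I_(npts M).
Let x := pt i.
Let A (m : 'I_n.+1) : 'rV[R]_n.+1 := \row_l extension Omega (partial l (component u m)) x.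
Let a m := ue x 0 m - dotv (A m) x.
Let P := affine_field a A.

Let h0 : 0 < h.
Proof.
have [_ [[vl /(_ i)/andP[+ _]] _]] := hK.
rewrite lt_def fill_distance_ge0// andbT => vli; apply: contraTneq vli => hE.
by rewrite -/h hE expr0n invr0 mulr0 -ltNge.
Qed.

Let xc : closure Omega x. Proof. exact: pt_closure. Qed.

Let err y m : closure Omega y -> `|(ue y - P y) 0 m| <= c * N * enorm (y - x) ^+ 2.
Proof.
move=> yc; rewrite (le_trans _ (taylor m xc yc))// le_eqVlt; apply/orP; left; apply/eqP.
congr (`| _ |); rewrite !mxE /a.
have -> : \sum_l extension Omega (partial l (component u m)) x * (y 0 l - x 0 l) = dotv (A m) (y - x).
  by apply: eq_bigr => l _; rewrite !mxE.
by rewrite dotvBr; ring.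
Qed.

Let errh y (r : R) : closure Omega y -> 0 <= r -> enorm (y - x) <= r * h ->
  enorm (ue y - P y) <= D * (c * N * (r * h) ^+ 2).
Proof.
move=> yc r0 yr; apply: enorm_le_coord => m; rewrite (le_trans (err m yc))//.
rewrite ler_wpM2l ?mulr_ge0// ler_pXn2r// nnegrE ?enorm_ge0// mulr_ge0//.
exact: ltW.
Qed.

Let E := D * (c * N * (rho * h) ^+ 2).
Let E2 := D * (c * N * (`|bface_dist K| * h) ^+ 2).

Let rho0 : 0 <= rho. Proof. by rewrite addr_ge0. Qed.

Let E_ge0 : 0 <= E.
Proof. by apply: mulr_ge0 => //; apply: mulr_ge0; [exact: mulr_ge0|exact: sqr_ge0]. Qed.

Let E2_ge0 : 0 <= E2.
Proof. by apply: mulr_ge0 => //; apply: mulr_ge0; [exact: mulr_ge0|exact: sqr_ge0]. Qed.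

Let Q_ge0 : 0 <= `|stability K| * E.
Proof. exact: mulr_ge0. Qed.

Let eps_h : eps <= `|eps_ratio K| * h.
Proof.
have [_ [_ [+ _]]] := hK; rewrite -/h ler_pdivrMr// => /le_trans; apply.
by rewrite ler_wpM2r ?ler_norm// ltW.
Qed.

Let sample_err (S : set 'rV[R]_n.+1) (r : R) : enorm (x - centroid S) <= r * h -> r <= `|dface_dist K| ->
  forall k, k \notin gam M -> enorm (pt k - centroid S) < eps ->
  enorm (ue (pt k) - P (pt k)) <= E.
Proof.
move=> xS rd k _ ke; apply: errh => //; first exact: pt_closure.
rewrite (le_trans (enorm_triangle _ (centroid S) _))// (enormBC _ x) /rho mulrDl lerD//.
  by rewrite (le_trans (ltW ke)).
by rewrite (le_trans xS)// ler_wpM2r// ltW.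
Qed.

Let stab : mls_stable Omega M eps phi (stability K).
Proof. by have [_ [_ [_ [_ [_ [_]]]]]] := hK. Qed.

Let uh (k : 'I_(npts M)) := ue (pt k).

Let dflux j : adj i j ->
  `|gmls_flux eps phi (dface i j) (dnormal i j) uh
    - \int[surf R n.+1]_(y in dface i j) dotv (P y) (dnormal i j)| <=
  `|dface_area K| * h ^+ n * (`|stability K| * E).
Proof.
move=> ij; have [B _ BP] := closure_bounded (let: And5 _ _ b _ _ := hO in b).
have SB y : dface i j y -> `|y| <= B by move=> /(dface_sub hM)/BP.
have [_ [_ [_ [_ [/(_ i j ij)[ar ds] _]]]]] := hK.
have fd : gmls_face Omega M (dface i j) by left; exists i, j.
have S0 := dface_area_gt0 hM ij.
have nu1 := flat_face_unit (dface_measurable i j) (dface_flat hM ij).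
rewrite (le_trans (gmls_flux_error hg stab fd (dface_measurable i j) S0 SB nu1 E_ge0 _))//.
  apply: (@sample_err _ (dface_dist K)); last exact: ler_norm.
  by rewrite -ler_pdivrMr.
rewrite (ler_wpM2r Q_ge0)//; rewrite ler_pdivrMr ?exprn_gt0// in ar.
by rewrite (le_trans ar)// ler_wpM2r ?ler_norm// exprn_ge0// ltW.
Qed.

Let bflux : i \in bdry M -> i \notin gam M ->
  `|gmls_flux eps phi (bface Omega i) (bnormal i) uh
    - \int[surf R n.+1]_(y in bface Omega i) dotv (P y) (bnormal i)| <=
  `|bface_area K| * h ^+ n * (`|stability K| * E).
Proof.
move=> ib ig; have [B _ BP] := closure_bounded (let: And5 _ _ b _ _ := hO in b).
have SB y : bface Omega i y -> `|y| <= B by move=> /(bface_sub hM)/BP.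
have [_ [_ [_ [_ [_ [/(_ i ib)[ar _] _]]]]]] := hK.
have fd : gmls_face Omega M (bface Omega i) by right; exists i => //; rewrite inE ig.
have S0 := bface_area_gt0 hM ib.
have nu1 := flat_face_unit (bface_measurable Omega i) (bface_flat hM ib).
rewrite (le_trans (gmls_flux_error hg stab fd (bface_measurable Omega i) S0 SB nu1 E_ge0 _))//.
  apply: (@sample_err _ 0) => //; have [[_ _ _ /(_ i ib)[_ xE]] _ _ _] := hM.
  by rewrite /x xE subrr enorm0 mul0r.
rewrite (ler_wpM2r Q_ge0)//; rewrite ler_pdivrMr ?exprn_gt0// in ar.
by rewrite (le_trans ar)// ler_wpM2r ?ler_norm// exprn_ge0// ltW.
Qed.

Let gflux : i \in bdry M ->
  `|\int[surf R n.+1]_(y in bface Omega i) dotv (ue y) (bnormal i)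
    - \int[surf R n.+1]_(y in bface Omega i) dotv (P y) (bnormal i)| <=
  `|bface_area K| * h ^+ n * E2.
Proof.
move=> ib; have [B _ BP] := closure_bounded (let: And5 _ _ b _ _ := hO in b).
have [_ [_ [_ [_ [_ [/(_ i ib)[ar ds] _]]]]]] := hK.
have S0 := bface_area_gt0 hM ib; have mS := bface_measurable Omega i.
have nu1 := flat_face_unit mS (bface_flat hM ib).
have mue : measurable_fun (bface Omega i) (fun y => dotv (ue y) (bnormal i)).
  apply: measurable_sum => m; apply: measurable_funM => //.
  by apply: ue_measurable; [exact: bface_closed|exact: bface_sub].
have [b [l PE]] := affine_field_flux_poly a A (bnormal i).
have mP : measurable_fun (bface Omega i) (fun y => dotv (P y) (bnormal i)).
  apply: (eq_measurable_fun (fun y => b + dotv l y)) => [y _|]; first by rewrite -PE.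
  by apply: measurable_funTS; apply: measurable_funD => //; exact: measurable_dotv.
have Pi : (surf R n.+1).-integrable (bface Omega i) (EFin \o (fun y => dotv (P y) (bnormal i))).
  have [] := @Rintegral_bound _ _ _ _ (`|b| + \sum_q `|l 0 q| * B) mS S0 mP => // y yS.
  rewrite PE (le_trans (ler_normD _ _))// lerD2l (le_trans (ler_norm_sum _ _ _))//.
  apply: ler_sum => q _; rewrite normrM ler_wpM2l// (le_trans (coord_le_norm y q))//.
  by apply: BP; exact: bface_sub yS.
have md : measurable_fun (bface Omega i) (fun y => dotv (ue y - P y) (bnormal i)).
  apply: (eq_measurable_fun (fun y => dotv (ue y) (bnormal i) - dotv (P y) (bnormal i))).
    by move=> y _; rewrite dotvBl.
  exact: measurable_funB.
have [di dle] : (surf R n.+1).-integrable (bface Omega i) (EFin \o (fun y => dotv (ue y - P y) (bnormal i)))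
    /\ `|\int[surf R n.+1]_(y in bface Omega i) dotv (ue y - P y) (bnormal i)| <= area (bface Omega i) * E2.
  apply: Rintegral_bound => // y yS; rewrite (le_trans (ler_dotv _ _))// nu1 mulr1.
  apply: errh => //; first exact: bface_sub yS.
  have := ds y yS; rewrite ler_pdivrMr// => /le_trans; apply.
  by rewrite ler_wpM2r ?ler_norm// ltW.
have -> : \int[surf R n.+1]_(y in bface Omega i) dotv (ue y) (bnormal i) =
    \int[surf R n.+1]_(y in bface Omega i) dotv (ue y - P y) (bnormal i)
    + \int[surf R n.+1]_(y in bface Omega i) dotv (P y) (bnormal i).
  by rewrite -RintegralD//; apply: eq_Rintegral => y _; rewrite -dotvDl subrK.
rewrite addrK (le_trans dle)// ler_wpM2r//; rewrite ler_pdivrMr ?exprn_gt0// in ar.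
by rewrite (le_trans ar)// ler_wpM2r ?ler_norm// exprn_ge0// ltW.
Qed.

Let bound := (nb_faces K)%:R * (`|dface_area K| * (`|stability K| * (D * (c * rho ^+ 2))))
  + `|bface_area K| * (`|stability K| * (D * (c * rho ^+ 2)))
  + `|bface_area K| * (D * (c * `|bface_dist K| ^+ 2)).

(** On the cell, the divergence theorem is exact for the Taylor polynomial [P] of the
    field at [x], whose divergence is that of the field at [x]. What remains is the
    difference between the discrete fluxes and those of [P]: each is of order
    [h ^+ 2] times the area of the face, and the volume is at least a multiple of
    [h ^+ n.+1]. *)
Lemma local_truncation_error :
  `|extension Omega (divergence u) x - div_gmls Omega eps phi ue uh i| <=
  bound / vol_lower K * h * N.
Proof.
have vi := vol_gt0 hM i.
have divE : \sum_m A m 0 m = extension Omega (divergence u) x.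
  by rewrite div_extension//; apply: eq_bigr => m _; rewrite mxE.
have cd : \sum_(j | adj i j) \int[surf R n.+1]_(y in dface i j) dotv (P y) (dnormal i j)
    + (if i \in bdry M then \int[surf R n.+1]_(y in bface Omega i) dotv (P y) (bnormal i) else 0)
    = (\sum_m A m 0 m) * vol i.
  exact: (cell_divergence (let: And5 _ _ b _ _ := hO in b) hM).
rewrite -divE; set ed := \sum_m _ in cd *.
have vd := vol_div_gmls eps phi hM ue uh i.
have [_ [[vl /(_ i)/andP[vli _]] [_ [/(_ i) nbi _]]]] := hK.
have hn : 0 < h ^+ n by rewrite exprn_gt0.
have main : `|vol i * (div_gmls Omega eps phi ue uh i - ed)| <= bound * h ^+ n.+2 * N.
  rewrite mulrBr vd [vol i * ed]mulrC -cd.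
  set s1 := \sum_(j | adj i j) gmls_flux _ _ _ _ _.
  set s2 := \sum_(j | adj i j) \int[_]_(y in _) _.
  set t1 := (if i \in bdry M :\: gam M then _ else _).
  set t2 := (if i \in gam M then _ else _).
  set t3 := (if i \in bdry M then _ else _).
  have d1 : `|s1 - s2| <= (nb_faces K)%:R * (`|dface_area K| * h ^+ n * (`|stability K| * E)).
    rewrite /s1 /s2 -sumrB (le_trans (ler_norm_sum _ _ _))//.
    apply: (@le_trans _ _ (\sum_(j | adj i j) (`|dface_area K| * h ^+ n * (`|stability K| * E)))).
      by apply: ler_sum => j; exact: dflux.
    rewrite (eq_bigl (fun j => j \in [set j | adj i j]%classic)); last first.
      by move=> j; apply/idP/idP => [ij|/set_mem//]; rewrite inE.
    have F0 : 0 <= `|dface_area K| * h ^+ n by rewrite mulr_ge0// ltW.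
    by rewrite sumr_const -[leLHS]mulr_natl (ler_wpM2r (mulr_ge0 F0 Q_ge0))// ler_nat.
  have d2 : `|t1 + t2 - t3| <= `|bface_area K| * h ^+ n * (`|stability K| * E) + `|bface_area K| * h ^+ n * E2.
    have F0 : 0 <= `|bface_area K| * h ^+ n by rewrite mulr_ge0// ltW.
    have F1 := mulr_ge0 F0 Q_ge0; have F2 := mulr_ge0 F0 E2_ge0.
    have [ig|ig] := boolP (i \in gam M).
      have ib := gam_bdry hM ig.
      rewrite /t1 /t2 /t3 inE ig ib/= add0r (le_trans (gflux ib))// lerDr//.
    rewrite /t1 /t2 /t3 inE (negbTE ig)/= addr0; case: ifPn => ib.
      by rewrite (le_trans (bflux ib ig))// lerDl.
    by rewrite subrr normr0 addr_ge0.
  rewrite (_ : _ - _ = (s1 - s2) + (t1 + t2 - t3)); last by ring.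
  rewrite (le_trans (ler_normD _ _))// (le_trans (lerD d1 d2))// le_eqVlt; apply/orP; left; apply/eqP.
  rewrite /bound /E /E2 !exprMn !exprS; ring.
have vlh : vol_lower K * h ^+ n.+1 <= vol i by rewrite -ler_pdivlMr// exprn_gt0.
rewrite distrC -(ler_pM2l vi) -{1}(gtr0_norm vi) -normrM (le_trans main)//.
have bd0 : 0 <= bound.
  have q1 (r : R) : 0 <= D * (c * r ^+ 2) by rewrite mulr_ge0// mulr_ge0// sqr_ge0.
  by apply: addr_ge0; [apply: addr_ge0|]; rewrite ?mulr_ge0.
rewrite (_ : bound * h ^+ n.+2 * N = vol_lower K * h ^+ n.+1 * (bound / vol_lower K * h * N)); last first.
  by rewrite !exprS; field; rewrite gt_eqF.
by rewrite ler_wpM2r// !mulr_ge0// ?invr_ge0 ltW.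
Qed.

End mesh.

Lemma first_order_accuracy : exists C : R,
  forall (M : pd_mesh R n.+1) (eps : R) (phi : 'I_n.+2 -> 'rV[R]_n.+1 -> R)
     (u : 'rV[R]_n.+1 -> 'rV[R]_n.+1),
   is_mesh Omega M -> is_gmls Omega M eps phi ->
   uniform_mesh Omega M eps phi K ->
   (forall k, C2_on Omega (component u k)) -> (C2_norm Omega u < +oo)%E ->
   forall i : 'I_(npts M),
   `|extension Omega (divergence u) (pt i)
     - div_gmls Omega eps phi (extension Omega u)
         (fun k => extension Omega u (pt k)) i|
   <= C * fill_distance Omega M * fine (C2_norm Omega u).
Proof.
have [c c0 T] := field_taylor hO; eexists => M eps phi u hM hg hK uC2 uN i.
have [ue_measurable div_extension taylor] := T u uC2 uN.
have N0 : 0 <= fine (C2_norm Omega u).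
  by apply: C2_norm_ge0 => //; have [] := hO.
exact: (local_truncation_error c0 hM hg hK N0 ue_measurable div_extension taylor).
Qed.

End accuracy.

Theorem theorem3 (R : realType) (d : nat) (hd : d = 2%N \/ d = 3%N)
  (Omega : set 'rV[R]_d) (hOmega : lipschitz_region Omega) :
  (* local conservation *)
  (forall (M : pd_mesh R d) (eps : R) (phi : 'I_d.+1 -> 'rV[R]_d -> R)
     (ug : 'rV[R]_d -> 'rV[R]_d) (uh : 'I_(npts M) -> 'rV[R]_d)
     (C : {set 'I_(npts M)}),
   is_mesh Omega M -> is_gmls Omega M eps phi ->
   \sum_(i in C) vol i * div_gmls Omega eps phi ug uh i =
     \sum_(i in C) \sum_(j | adj i j && (j \notin C))
        gmls_flux eps phi (dface i j) (dnormal i j) uh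
     + \sum_(k in C :&: (bdry M :\: gam M))
        gmls_flux eps phi (bface Omega k) (bnormal k) uh
     + \sum_(k in C :&: gam M)
        \int[surf R d]_(y in bface Omega k) dotv (ug y) (bnormal k))
  /\
  (* global conservation *)
  (forall (M : pd_mesh R d) (eps : R) (phi : 'I_d.+1 -> 'rV[R]_d -> R)
     (ug : 'rV[R]_d -> 'rV[R]_d) (uh : 'I_(npts M) -> 'rV[R]_d),
   is_mesh Omega M -> is_gmls Omega M eps phi ->
   (forall k, (surf R d).-integrable (boundary Omega) (EFin \o component ug k)) ->
   gam M = bdry M ->
   \sum_i vol i * div_gmls Omega eps phi ug uh i =
     \int[surf R d]_(y in boundary Omega) dotv (ug y) (normal_field Omega y))
  /\
  (* first-order accuracy *)
  (forall K : uniformity_constants R, exists C : R,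
   forall (M : pd_mesh R d) (eps : R) (phi : 'I_d.+1 -> 'rV[R]_d -> R)
     (u : 'rV[R]_d -> 'rV[R]_d),
   is_mesh Omega M -> is_gmls Omega M eps phi ->
   uniform_mesh Omega M eps phi K ->
   (forall k, C2_on Omega (component u k)) -> (C2_norm Omega u < +oo)%E ->
   forall i : 'I_(npts M),
   `|extension Omega (divergence u) (pt i)
     - div_gmls Omega eps phi (extension Omega u)
         (fun k => extension Omega u (pt k)) i|
   <= C * fill_distance Omega M * fine (C2_norm Omega u)).
Proof.
have bO : bounded_set Omega by have [] := hOmega.
case: hd => dE; subst d.
all: split; first by move=> M eps phi ug uh C hM hg; exact: local_conservation.
all: split; last by move=> K; exact: first_order_accuracy.
all: by move=> M eps phi ug uh hM hg; exact: global_conservation.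
Qed.
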